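(* Let $k$ be a field of characteristic $\ell$, let $q$ be a prime power and $n$ a natural number. Suppose that $\ell \nmid q$ and that $V \subseteq W$ are subspaces of $\mathbb{F}_q^n$. Then: (1) The $W$-weight space $\Delta_{V,k}^W$ of the standard $S_k(PG(n-1,q))$-module $\Delta_{V,k}$ is naturally a $k[GL(W/V)]$-module, isomorphic to the dual $\mathrm{St}^k(W/V)^*$ of the Steinberg representation. (2) The $W$-weight space $L_{V,k}^W$ of the simple module $L_{V,k}$ is isomorphic, as a $k[GL(W/V)]$-module, to the socle of the Steinberg representation $\mathrm{St}^k(W/V)$ of $GL(W/V)$ (and this socle is self-dual).
   Context: Algebra. For subspaces of $\mathbb{F}_q^n$ write $V\lessdot W$ (or $W\gtrdot V$) if $V\subset W$ and $\dim W=\dim V+1$. A flag path is a finite nonempty sequence $(V_1,\dots,V_l)$ of subspaces of $\mathbb{F}_q^n$ such that for each $i<l$ either $V_i\lessdot V_{i+1}$ or $V_i\gtrdot V_{i+1}$ (commas may be replaced by these symbols). The free $\mathbb{Z}$-module on flag paths is an algebra under concatenation: $(K_1,\dots,K_l)\cdot(L_1,\dots,L_{l'})=(K_1,\dots,K_l=L_1,L_2,\dots,L_{l'})$ if $K_l=L_1$ and $0$ otherwise. $S(PG(n-1,q))$ is its quotient by the two-sided ideal generated by the relations: (FS) for $V\subset W$ with $\dim W=\dim V+2$: $\sum_X (V\lessdot X\lessdot W)=0=\sum_X (W\gtrdot X\gtrdot V)$, sums over all $X$ with $V\lessdot X\lessdot W$; ($\bigwedge$) for $V\lessdot W\gtrdot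 V'$: $(V\lessdot W\gtrdot V')=q^{\dim V}(V)$ if $V=V'$, and $=-(V\gtrdot V\cap V'\lessdot V')$ if $V\ne V'$. $S_k(PG(n-1,q))=S(PG(n-1,q))\otimes_{\mathbb Z}k$. For a left module $X$, its $W$-weight space is $X^W=(W)X$. Standard and simple modules. $\Delta_V$ is the left module $S(PG(n-1,q))\cdot(V)$ modulo the $\mathbb Z$-span of the images of all flag paths that end at $V$ and pass through some subspace not containing $V$. It is spanned over $\mathbb Z$ by the classes of flags $(V_m\gtrdot\dots\gtrdot V_1\gtrdot V)$, and is isomorphic to the free $\mathbb Z$-module on such flags modulo the (FS) relations. It carries a symmetric bilinear form $\langle\,,\rangle_V:\Delta_V\times\Delta_V\to\mathbb Z$ defined on flags $V_\bullet=(V_l\gtrdot\dots\gtrdot V_1\gtrdot V)$, $W_\bullet=(W_m\gtrdot\dots\gtrdot W_1\gtrdot V)$ by $\langle V_\bullet,W_\bullet\rangle_V\,(V)=(V,W_1,\dots,W_m)\cdot(V_l,\dots,V_1,V)$ in $S(PG(n-1,q))$ (the product is always an integer multiple of $(V)$). $\Delta_{V,k}=\Delta_V\otimes k$ with the induced form $\langle\,,\rangle_{V,k}$, and $L_{V,k}=\Delta_{V,k}/\mathrm{rad}\langle\,,\rangle_{V,k}$. For $V\subseteq W$, $GL(W/V)$ acts on $\Delta_{V,k}^W$ by permuting the flags $(W\gtrdot\dots\gtrdot V)$ from $W$ down to $V$; this preserves the form and induces an action on $L_{V,k}^W$. Steinberg representation. For $G=GL_m(\mathbb{F}_q)$ with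 upper triangular subgroup $B$ and permutation matrices $\mathfrak S_m\subset G$, put $\mathfrak e=\big(\sum_{\sigma\in\mathfrak S_m}\mathrm{sgn}(\sigma)\sigma\big)\sum_{b\in B}b\in kG$ and $\mathrm{St}^k(\mathbb F_q^m)=kG\,\mathfrak e$ (left ideal). For an $m$-dimensional $\mathbb F_q$-vector space $U$, $\mathrm{St}^k(U)$ is the corresponding representation of $GL(U)$ after choosing an isomorphism $U\cong\mathbb F_q^m$. *)

(* Defs.v *)
From HB Require Import structures.
From mathcomp Require Import all_boot all_order all_algebra all_fingroup.
From mathcomp.multinomials Require Import freeg.
From mathcomp.classical Require Import boolp classical_sets.

Set Implicit Arguments.
Unset Strict Implicit.
Unset Printing Implicit Defensive.

Import GRing.Theory.
Local Open Scope ring_scope.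
Local Open Scope quotient_scope.

(* The kernel of the unique map from the integers to k is generated by l; in
   particular l = 0 is allowed. *)
Definition has_characteristic (k : fieldType) (l : nat) : Prop :=
  forall m : nat, (m%:R == 0 :> k) = (l %| m)%N.

Section FiniteSpace.
Variables (F : finFieldType) (vT : vectType F).
HB.instance Definition _ : isCountable {vspace vT} :=
  CanIsCountable (@VectorInternalTheory.vs2mxK F vT).
HB.instance Definition _ : isFinite {vspace vT} :=
  CanIsFinite (@VectorInternalTheory.vs2mxK F vT).
End FiniteSpace.

Section ZSpan.
Variables (M : zmodType) (P : M -> Prop).

Inductive zspan : M -> Prop :=
| zspan_gen x : P x -> zspan x
| zspan0 : zspan 0
| zspanB x y : zspan x -> zspan y -> zspan (x - y).

Lemma zspanN x : zspan x -> zspan (- x).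
Proof. by rewrite -sub0r; apply: zspanB; apply: zspan0. Qed.

Lemma zspanD x y : zspan x -> zspan y -> zspan (x + y).
Proof. by move=> Hx Hy; rewrite -[y]opprK; apply/zspanB/zspanN. Qed.

Lemma zspanMz x (m : int) : zspan x -> zspan (x *~ m).
Proof.
move=> Hx; have HM j : zspan (x *+ j).
  by elim: j => [|j IH]; rewrite ?mulr0n ?mulrS; [apply: zspan0 | apply: zspanD].
by case: m => j; [apply: HM | rewrite NegzE mulrNz; apply/zspanN/HM].
Qed.

End ZSpan.

Section LinearSpan.
Variables (R : pzRingType) (M : lmodType R) (P : M -> Prop).

Inductive lin_span : M -> Prop :=
| lin_span_gen x : P x -> lin_span x
| lin_span0 : lin_span 0
| lin_spanP a x y : lin_span x -> lin_span y -> lin_span (a *: x + y).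

Definition lin_span_pred : {pred M} := fun x => `[< lin_span x >].

Fact lin_span_closed : GRing.subsemimod_closed lin_span_pred.
Proof.
split.
  split; first exact/asboolP/lin_span0.
  move=> x y /asboolP Px /asboolP Py; apply/asboolP.
  by rewrite -[x]scale1r; apply: lin_spanP.
move=> a x /asboolP Px; apply/asboolP.
by rewrite -[_ *: _]addr0; apply: lin_spanP => //; apply: lin_span0.
Qed.
HB.instance Definition _ :=
  GRing.isSubmodClosed.Build R M lin_span_pred lin_span_closed.

End LinearSpan.

Lemma lin_image_closed (R : pzRingType) (M N : lmodType R) (f : M -> N) :
  linear f ->
  GRing.subsemimod_closed ((fun x => `[< exists y, x = f y >]) : {pred N}).
Proof.
move=> fl; have f0 : f 0 = 0.
  by have := fl (-1) 0 0; rewrite scaler0 addr0 scaleN1r addNr.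
split=> [|a x /asboolP[u ->]]; last first.
  by apply/asboolP; exists (a *: u); rewrite -[in RHS](addr0 (a *: u)) fl f0 addr0.
split=> [|x y /asboolP[u ->] /asboolP[v ->]]; apply/asboolP; first by exists 0.
by exists (u + v); rewrite -[u in RHS]scale1r fl scale1r.
Qed.

Section LmodQuotient.
Variables (R : pzRingType) (M : lmodType R) (N : submodClosed M).

(* submodClosed is a structure on semimodules and does not record closure under
   opposite, which Quotient.quot asks for. *)
Definition submod_pred : {pred M} := fun x => x \in N.

Fact submod_pred_closed : GRing.subsemimod_closed submod_pred.
Proof.
split; last by move=> a x; apply: rpredZ.
by split=> [|x y]; [apply: rpred0 | apply: rpredD].
Qed.
HB.instance Definition _ :=
  GRing.isSubmodClosed.Build R M submod_pred submod_pred_closed.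

Definition lmod_quot := Quotient.quot submod_pred.
HB.instance Definition _ := GRing.Zmodule.on lmod_quot.

Definition to_quot (x : M) : lmod_quot := \pi_(Quotient.quot submod_pred) x.

Lemma to_quotE x y : (to_quot x = to_quot y) <-> (x - y \in N).
Proof.
rewrite -[x - y \in N]/(x - y \in submod_pred) /to_quot; split=> [e|xy].
  by rewrite Quotient.idealrBE e eqxx.
by apply/eqP; rewrite -Quotient.idealrBE.
Qed.

Lemma to_quotB : {morph to_quot : x y / x - y}.
Proof. by move=> x y; rewrite /to_quot raddfB. Qed.

Lemma to_quotD : {morph to_quot : x y / x + y}.
Proof. by move=> x y; rewrite /to_quot raddfD. Qed.

Definition of_quot (x : lmod_quot) : M :=
  generic_quotient.repr (x : Quotient.quot submod_pred).

Lemma of_quotK x : to_quot (of_quot x) = x.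
Proof. exact: reprK. Qed.

Definition quot_scale (a : R) (x : lmod_quot) : lmod_quot :=
  to_quot (a *: of_quot x).

Lemma quot_scaleE a x : quot_scale a (to_quot x) = to_quot (a *: x).
Proof.
apply/to_quotE; rewrite -scalerBr rpredZ //.
by apply/to_quotE; rewrite of_quotK.
Qed.

Lemma to_quotW (P : lmod_quot -> Prop) : (forall x, P (to_quot x)) -> forall x, P x.
Proof. by move=> Px x; rewrite -[x]of_quotK. Qed.

Fact quot_scaleA a b x : quot_scale a (quot_scale b x) = quot_scale (a * b) x.
Proof. by elim/to_quotW: x => x; rewrite !quot_scaleE scalerA. Qed.

Fact quot_scale1 : left_id 1 quot_scale.
Proof. by elim/to_quotW=> x; rewrite quot_scaleE scale1r. Qed.

Fact quot_scaleDr : right_distributive quot_scale +%R.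
Proof.
by move=> a; elim/to_quotW=> x; elim/to_quotW=> y;
   rewrite !quot_scaleE -!to_quotD quot_scaleE scalerDr.
Qed.

Fact quot_scaleDl x : {morph quot_scale^~ x : a b / a + b}.
Proof.
by elim/to_quotW: x => x a b; rewrite !quot_scaleE -to_quotD scalerDl.
Qed.

HB.instance Definition _ := GRing.Zmodule_isLmodule.Build R lmod_quot
  quot_scaleA quot_scale1 quot_scaleDr quot_scaleDl.

Fact to_quot_linear : linear to_quot.
Proof. by move=> a x y; rewrite to_quotD -quot_scaleE. Qed.
HB.instance Definition _ :=
  GRing.isLinear.Build R M lmod_quot _ to_quot to_quot_linear.

End LmodQuotient.

Section RingQuotient.
Variables (R : pzRingType) (rel : R -> Prop).

Inductive ideal_gen : R -> Prop :=
| ideal_gen_rel x : rel x -> ideal_gen x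
| ideal_gen0 : ideal_gen 0
| ideal_genB x y : ideal_gen x -> ideal_gen y -> ideal_gen (x - y)
| ideal_genMl a x : ideal_gen x -> ideal_gen (a * x)
| ideal_genMr a x : ideal_gen x -> ideal_gen (x * a).

Definition ideal_pred : {pred R} := fun x => `[< ideal_gen x >].

Fact ideal_closed : zmod_closed ideal_pred.
Proof.
split; first exact/asboolP/ideal_gen0.
by move=> x y /asboolP Px /asboolP Py; apply/asboolP/ideal_genB.
Qed.
HB.instance Definition _ := GRing.isZmodClosed.Build R ideal_pred ideal_closed.

Definition ring_quot := Quotient.quot ideal_pred.
HB.instance Definition _ := GRing.Zmodule.on ring_quot.

Definition to_rquot (x : R) : ring_quot := \pi_(Quotient.quot ideal_pred) x.

Lemma to_rquotE x y : (to_rquot x = to_rquot y) <-> ideal_gen (x - y).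
Proof.
rewrite /to_rquot; split=> [e|xy].
  by apply/asboolP; rewrite -[asbool _]/(x - y \in ideal_pred)
     Quotient.idealrBE e eqxx.
by apply/eqP; rewrite -Quotient.idealrBE; apply/asboolP.
Qed.

Lemma to_rquotD : {morph to_rquot : x y / x + y}.
Proof. by move=> x y; rewrite /to_rquot raddfD. Qed.

Definition of_rquot (x : ring_quot) : R :=
  generic_quotient.repr (x : Quotient.quot ideal_pred).

Lemma of_rquotK x : to_rquot (of_rquot x) = x.
Proof. exact: reprK. Qed.

Lemma to_rquotW (P : ring_quot -> Prop) :
  (forall x, P (to_rquot x)) -> forall x, P x.
Proof. by move=> Px x; rewrite -[x]of_rquotK. Qed.

Definition rquot_mul (x y : ring_quot) : ring_quot :=
  to_rquot (of_rquot x * of_rquot y).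

Lemma rquot_mulE x y : rquot_mul (to_rquot x) (to_rquot y) = to_rquot (x * y).
Proof.
apply/to_rquotE; set x' := of_rquot _; set y' := of_rquot _.
have dx : ideal_gen (x' - x) by apply/to_rquotE; rewrite of_rquotK.
have dy : ideal_gen (y - y') by apply/to_rquotE; rewrite of_rquotK.
have -> : x' * y' - x * y = (x' - x) * y' - x * (y - y').
  by rewrite mulrBl mulrBr opprB addrA subrK.
by apply: ideal_genB; [apply: ideal_genMr | apply: ideal_genMl].
Qed.

Fact rquot_mulA : associative rquot_mul.
Proof.
by elim/to_rquotW=> x; elim/to_rquotW=> y; elim/to_rquotW=> z;
   rewrite !rquot_mulE mulrA.
Qed.

Fact rquot_mul1 : left_id (to_rquot 1) rquot_mul.
Proof. by elim/to_rquotW=> x; rewrite rquot_mulE mul1r. Qed.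

Fact rquot_mulr1 : right_id (to_rquot 1) rquot_mul.
Proof. by elim/to_rquotW=> x; rewrite rquot_mulE mulr1. Qed.

Fact rquot_mulDl : left_distributive rquot_mul +%R.
Proof.
by elim/to_rquotW=> x; elim/to_rquotW=> y; elim/to_rquotW=> z;
   rewrite -to_rquotD !rquot_mulE -to_rquotD mulrDl.
Qed.

Fact rquot_mulDr : right_distributive rquot_mul +%R.
Proof.
by elim/to_rquotW=> x; elim/to_rquotW=> y; elim/to_rquotW=> z;
   rewrite -to_rquotD !rquot_mulE -to_rquotD mulrDr.
Qed.

HB.instance Definition _ := GRing.Zmodule_isPzRing.Build ring_quot
  rquot_mulA rquot_mul1 rquot_mulr1 rquot_mulDl rquot_mulDr.

Fact to_rquot_zmod : zmod_morphism to_rquot.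
Proof. by move=> x y; rewrite /to_rquot raddfB. Qed.
HB.instance Definition _ :=
  GRing.isZmodMorphism.Build R ring_quot to_rquot to_rquot_zmod.

Fact to_rquot_monoid : monoid_morphism to_rquot.
Proof. by split=> // x y; rewrite -rquot_mulE. Qed.
HB.instance Definition _ :=
  GRing.isMonoidMorphism.Build R ring_quot to_rquot to_rquot_monoid.

End RingQuotient.

Section FreegLift.
Variables (R : nzRingType) (K : choiceType) (M : lmodType R).

Variable f : K -> M.

Fact fglift_zmod : zmod_morphism (fglift f : {freeg K / R} -> M).
Proof. exact: lift_is_additive. Qed.
HB.instance Definition _ :=
  GRing.isZmodMorphism.Build {freeg K / R} M (fglift f) fglift_zmod.

Lemma fglift_sum (D : {freeg K / R}) :
  fglift f D = \sum_(z <- dom D) coeff z D *: f z.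
Proof.
rewrite -{1}[D]freeg_sumE raddf_sum /=.
by apply: eq_bigr => z _; rewrite liftU.
Qed.

Lemma fglift_scale a (x : {freeg K / R}) : fglift f (a *: x) = a *: fglift f x.
Proof.
have ZU b z : a *: << b *g z >> = << (a * b) *g z >> :> {freeg K / R}.
  by apply/eqP/freeg_eqP=> y; rewrite coeffZ !coeffU mulrA.
rewrite -[x]freeg_sumE.
elim: (dom x) => [|z s IH]; first by rewrite !big_nil scaler0 !raddf0.
by rewrite !big_cons scalerDr !raddfD /= IH ZU !liftU scalerA.
Qed.

Fact fglift_scalable : scalable (fglift f : {freeg K / R} -> M).
Proof. exact: fglift_scale. Qed.
HB.instance Definition _ :=
  GRing.isScalable.Build R {freeg K / R} M _ (fglift f) fglift_scalable.

End FreegLift.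

(* The base change M (x) k of an abelian group: the free k-module on M modulo
   the k-span of the elements <<m + m'>> - <<m>> - <<m'>>. *)
Section Tensor.
Variables (k : fieldType) (M : zmodType).

Definition tens_rel (x : {freeg M / k}) : Prop :=
  exists m m' : M, x = << m + m' >> - << m >> - << m' >>.

Definition tens := lmod_quot (lin_span_pred tens_rel).
HB.instance Definition _ := GRing.Lmodule.on tens.

Definition tens_mk (m : M) : tens := to_quot (lin_span_pred tens_rel) << m >>.

Lemma tens_mkD : {morph tens_mk : x y / x + y}.
Proof.
move=> x y; rewrite /tens_mk -to_quotD; apply/to_quotE/asboolP/lin_span_gen.
by exists x, y; rewrite opprD addrA.
Qed.

Lemma tens_mkB : zmod_morphism tens_mk.
Proof.
move=> x y; apply: (addIr (tens_mk y)).
by rewrite -tens_mkD subrK [RHS]subrK.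
Qed.

Lemma tens_ind (Q : tens -> Prop) :
  Q 0 -> (forall (a : k) m x, Q x -> Q (a *: tens_mk m + x)) -> forall x, Q x.
Proof.
move=> Q0 QD; elim/to_quotW=> x; rewrite -[x]freeg_sumE raddf_sum /=.
elim: (dom x) => [|m s IH]; first by rewrite big_nil.
rewrite big_cons; have -> : << coeff m x *g m >> = coeff m x *: << m >> :> {freeg M / k}.
  by apply/eqP/freeg_eqP=> y; rewrite coeffZ !coeffU mul1r.
by rewrite linearZ; apply: QD.
Qed.

Variables (P : lmodType k) (f : M -> P).

(* For additive f, the k-linear map tens -> P sending tens_mk m to f m. *)
Definition tens_lift (x : tens) : P :=
  fglift f (of_quot (x : lmod_quot (lin_span_pred tens_rel))).

Hypothesis fB : zmod_morphism f.

Lemma tens_lift_quot (x : {freeg M / k}) :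
  tens_lift (to_quot (lin_span_pred tens_rel) x) = fglift f x.
Proof.
have fD u v : f (u + v) = f u + f v.
  have f0 : f 0 = 0 by rewrite -[X in f X](subrr 0) fB subrr.
  have fN w : f (- w) = - f w by rewrite -sub0r fB f0 sub0r.
  by rewrite -[v in LHS]opprK fB fN opprK.
have span0 (z : {freeg M / k}) : lin_span tens_rel z -> fglift f z = 0.
  elim=> [{}z [m [m' ->]]||a u v _ Hu _ Hv].
  - by rewrite !raddfB /= !liftU !scale1r fD addrAC addrK subrr.
  - exact: raddf0.
  - by rewrite linearP /= Hu Hv scaler0 addr0.
apply/eqP; rewrite -subr_eq0 /tens_lift -raddfB /= span0 //.
apply/asboolP; rewrite -[asbool _]/(_ \in lin_span_pred tens_rel).
by apply/to_quotE; rewrite of_quotK.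
Qed.

Lemma tens_lift_linear : linear tens_lift.
Proof.
move=> a; elim/to_quotW=> x; elim/to_quotW=> y.
by rewrite -linearP !tens_lift_quot linearP.
Qed.

Lemma tens_lift_mk m : tens_lift (tens_mk m) = f m.
Proof. by rewrite tens_lift_quot liftU scale1r. Qed.

End Tensor.

(* For biadditive f, the k-bilinear map induced by f. *)
Definition tens_bilin (k : fieldType) (M N : zmodType) (P : lmodType k)
    (f : M -> N -> P) (x : tens k M) (y : tens k N) : P :=
  tens_lift (fun m => tens_lift (f m) y) x.

Definition biadditive (M N P : zmodType) (f : M -> N -> P) : Prop :=
  (forall x, zmod_morphism (f x)) /\ (forall y, zmod_morphism (f^~ y)).

Section TensorBilinear.
Variables (k : fieldType) (M N : zmodType) (P : lmodType k) (f : M -> N -> P).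
Hypothesis f_biadd : biadditive f.

Lemma tens_bilin_linear_l (y : tens k N) :
  linear ((tens_bilin f)^~ y : tens k M -> P).
Proof.
apply: tens_lift_linear => u v; rewrite /tens_lift !fglift_sum -sumrB.
by apply: eq_bigr => z _; rewrite -scalerBr (f_biadd.2 z).
Qed.

Lemma tens_bilin_linear_r (x : tens k M) :
  linear (tens_bilin f x : tens k N -> P).
Proof.
move=> a u v; rewrite /tens_bilin /tens_lift !fglift_sum scaler_sumr -big_split.
apply: eq_bigr => z _ /=; rewrite scalerA mulrC -scalerA -scalerDr.
by rewrite -(tens_lift_linear (f_biadd.1 z)).
Qed.

Lemma tens_bilin_mk m m' : tens_bilin f (tens_mk k m) (tens_mk k m') = f m m'.
Proof.
rewrite /tens_bilin tens_lift_mk ?tens_lift_mk //; first exact: f_biadd.1.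
move=> u v; rewrite /tens_lift !fglift_sum -sumrB.
by apply: eq_bigr => z _; rewrite -scalerBr (f_biadd.2 z).
Qed.

End TensorBilinear.

Section FlagPaths.
Variables (F : finFieldType) (n : nat).

Local Notation subspace := {vspace 'rV[F]_n}.

(* V \lessdot W *)
Definition covered (V W : subspace) : bool :=
  (V <= W)%VS && (\dim W == (\dim V).+1).

Definition flag_step : rel subspace := fun V W => covered V W || covered W V.

Definition is_flag_path (s : seq subspace) : bool :=
  if s is V :: s' then path flag_step V s' else false.

Record flag_path := FlagPath {
  path_seq :> seq subspace;
  path_seqP : is_flag_path path_seq }.
HB.instance Definition _ := [isSub for path_seq].
HB.instance Definition _ := [Choice of flag_path by <:].

Definition path_head (p : flag_path) : subspace := head 0%VS p.
Definition path_last (p : flag_path) : subspace := last 0%VS p.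

Definition path_mod := {freeg flag_path / int}.
HB.instance Definition _ := GRing.Lmodule.on path_mod.

(* The basis vector of a flag path; 0 on lists that are not flag paths. *)
Definition pbasis (s : seq subspace) : path_mod :=
  if insub s is Some p then << p : flag_path >> else 0.

Definition path_concat (p r : flag_path) : path_mod :=
  if path_last p == path_head r then pbasis (p ++ behead r) else 0.

Definition path_mul (a b : path_mod) : path_mod :=
  fglift (fun p => fglift (path_concat p) b) a.

Definition path_one : path_mod := \sum_(V : subspace) pbasis [:: V].

Lemma pbasisE (p : flag_path) : pbasis p = << p >>.
Proof. by rewrite /pbasis valK. Qed.

Lemma pbasisPn s : ~~ is_flag_path s -> pbasis s = 0.
Proof. by move=> sN; rewrite /pbasis insubN. Qed.

Lemma is_flag_path_cat (p r : flag_path) :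
  path_last p = path_head r -> is_flag_path (p ++ behead r).
Proof.
case: p r => [[|V s] //= ps] [[|W t] //= pt]; rewrite /path_last /path_head /=.
by move=> e; rewrite cat_path ps e.
Qed.

Lemma path_head_cat (p r : flag_path) (e : path_last p = path_head r) :
  path_head (FlagPath (is_flag_path_cat e)) = path_head p.
Proof. by rewrite /path_head /=; case: (p) => [[|U s]]. Qed.

Lemma path_last_cat (p r : flag_path) (e : path_last p = path_head r) :
  path_last (FlagPath (is_flag_path_cat e)) = path_last r.
Proof.
case: p r e => [[|V s] ps] [[|W t] pt] //= e.
by rewrite /path_last /= last_cat; move: e; rewrite /path_last /= => ->.
Qed.

Lemma path_mulDl : left_distributive path_mul +%R.
Proof. by move=> a b c; rewrite /path_mul raddfD. Qed.

Lemma path_mulDr : right_distributive path_mul +%R.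
Proof.
move=> a b c; rewrite /path_mul !fglift_sum -big_split.
by apply: eq_bigr => p _; rewrite raddfD scalerDr.
Qed.

Lemma path_mulZl (m : int) a b : path_mul (m *: a) b = m *: path_mul a b.
Proof. by rewrite /path_mul fglift_scale. Qed.

Lemma path_mulZr (m : int) a b : path_mul a (m *: b) = m *: path_mul a b.
Proof.
rewrite /path_mul !fglift_sum scaler_sumr; apply: eq_bigr => p _.
by rewrite fglift_scale !scalerA mulrC.
Qed.

Lemma path_mul0l b : path_mul 0 b = 0.
Proof. by rewrite /path_mul raddf0. Qed.

Lemma path_mul0r a : path_mul a 0 = 0.
Proof. by rewrite -[X in path_mul a X](scale0r 0) path_mulZr scale0r. Qed.

Lemma path_mulU p r : path_mul << p >> << r >> = path_concat p r.
Proof. by rewrite /path_mul !liftU !scale1r. Qed.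

Lemma path_mod_ind (P : path_mod -> Prop) :
  P 0 -> (forall (m : int) p a, P a -> P (m *: << p >> + a)) -> forall a, P a.
Proof.
move=> P0 PD a; rewrite -[a]freeg_sumE.
elim: (dom a) => [|p s IH]; first by rewrite big_nil.
have -> : \sum_(z <- p :: s) << coeff z a *g z >> =
    coeff p a *: << p >> + \sum_(z <- s) << coeff z a *g z >> :> path_mod.
  rewrite big_cons; congr (_ + _).
  by apply/eqP/freeg_eqP=> y; rewrite coeffZ !coeffU mul1r.
exact: PD.
Qed.

Lemma path_mulA : associative path_mul.
Proof.
elim/path_mod_ind=> [|m p a IHa] b c; first by rewrite !path_mul0l.
rewrite !path_mulDl !path_mulZl IHa; congr (_ *: _ + _).
elim/path_mod_ind: b c => [|m' r b IHb] c.
  by rewrite path_mul0l !path_mul0r path_mul0l.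
rewrite !(path_mulDl, path_mulDr) !(path_mulZl, path_mulZr) IHb.
congr (_ *: _ + _).
elim/path_mod_ind: c => [|m'' t c IHc]; first by rewrite !path_mul0r.
rewrite !path_mulDr !path_mulZr IHc; congr (_ *: _ + _).
rewrite !path_mulU /path_concat.
have [e1|/eqP e1] := eqVneq (path_last p) (path_head r); last first.
  rewrite path_mul0l; case: eqP => [e2|_]; last exact: path_mul0r.
  rewrite -[_ ++ _]/(val (FlagPath (is_flag_path_cat e2))) pbasisE path_mulU.
  by rewrite /path_concat path_head_cat (negPf (introN eqP e1)).
rewrite -[_ ++ behead r]/(val (FlagPath (is_flag_path_cat e1))) pbasisE path_mulU.
rewrite {1}/path_concat path_last_cat.
have [e2|_] := eqVneq (path_last r) (path_head t); last by rewrite path_mul0r.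
rewrite -[r ++ _]/(val (FlagPath (is_flag_path_cat e2))) pbasisE path_mulU.
rewrite /path_concat path_head_cat e1 eqxx /= -catA; congr (pbasis (_ ++ _)).
by case: (r) => [[|W s']].
Qed.

Lemma path_mul_pt V (p : flag_path) :
  path_mul (pbasis [:: V]) << p >> = if V == path_head p then << p >> else 0.
Proof.
rewrite -[[:: V]]/(val (@FlagPath [:: V] isT)) pbasisE path_mulU /path_concat.
rewrite /path_last /=; case: eqP => // ->; rewrite -pbasisE.
by congr pbasis; case: p => [[|W s]].
Qed.

Lemma path_mulpt V (p : flag_path) :
  path_mul << p >> (pbasis [:: V]) = if V == path_last p then << p >> else 0.
Proof.
rewrite -[[:: V]]/(val (@FlagPath [:: V] isT)) pbasisE path_mulU /path_concat.
by rewrite /path_head /= eq_sym cats0 pbasisE.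
Qed.

Lemma path_mul1 : left_id path_one path_mul.
Proof.
elim/path_mod_ind=> [|m p a IHa]; first exact: path_mul0r.
rewrite path_mulDr path_mulZr IHa; congr (_ *: _ + _).
rewrite /path_one; have suml (I : Type) (s : seq I) (G : I -> path_mod) b :
    path_mul (\sum_(i <- s) G i) b = \sum_(i <- s) path_mul (G i) b.
  by elim: s => [|i s IH]; rewrite ?big_nil ?path_mul0l // !big_cons path_mulDl IH.
rewrite suml (eq_bigr _ (fun V _ => path_mul_pt V p)) -big_mkcond.
by rewrite big_pred1_eq.
Qed.

Lemma path_mulr1 : right_id path_one path_mul.
Proof.
elim/path_mod_ind=> [|m p a IHa]; first exact: path_mul0l.
rewrite path_mulDl path_mulZl IHa; congr (_ *: _ + _).
rewrite /path_one; have sumr (I : Type) (s : seq I) (G : I -> path_mod) b :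
    path_mul b (\sum_(i <- s) G i) = \sum_(i <- s) path_mul b (G i).
  by elim: s => [|i s IH]; rewrite ?big_nil ?path_mul0r // !big_cons path_mulDr IH.
rewrite sumr (eq_bigr _ (fun V _ => path_mulpt V p)) -big_mkcond.
by rewrite big_pred1_eq.
Qed.

HB.instance Definition _ := GRing.Zmodule_isPzRing.Build path_mod
  path_mulA path_mul1 path_mulr1 path_mulDl path_mulDr.

Inductive S_rel : path_mod -> Prop :=
| S_rel_FS_up V W : (V <= W)%VS -> \dim W = (\dim V + 2)%N ->
    S_rel (\sum_(X | covered V X && covered X W) pbasis [:: V; X; W])
| S_rel_FS_down V W : (V <= W)%VS -> \dim W = (\dim V + 2)%N ->
    S_rel (\sum_(X | covered V X && covered X W) pbasis [:: W; X; V])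
| S_rel_wedge_eq V W : covered V W ->
    S_rel (pbasis [:: V; W; V] - pbasis [:: V] *+ (#|F| ^ \dim V)%N)
| S_rel_wedge_neq V W V' : covered V W -> covered V' W -> V != V' ->
    S_rel (pbasis [:: V; W; V'] + pbasis [:: V; (V :&: V')%VS; V']).

(* The algebra S(PG(n-1,q)), with q = #|F|. *)
Definition S_alg := ring_quot S_rel.
HB.instance Definition _ := GRing.PzRing.on S_alg.

Definition S_path (s : seq subspace) : S_alg := to_rquot S_rel (pbasis s).

Definition S_idem (V : subspace) : S_alg := S_path [:: V].

Lemma S_alg_ind (P : S_alg -> Prop) :
  P 0 -> (forall (m : int) (p : flag_path) a, P a -> P (S_path p *~ m + a)) ->
  forall a, P a.
Proof.
move=> P0 PD; elim/to_rquotW; elim/path_mod_ind=> [|m p a].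
  by rewrite raddf0.
by rewrite raddfD -pbasisE -[m]intz scaler_int raddfMz; apply: PD.
Qed.

Section Standard.
Variable V : subspace.

(* The left ideal S_alg * (V). *)
Definition proj_pred : {pred S_alg^o} := fun x => `[< exists s : S_alg, x = s * S_idem V >].

Fact proj_closed : GRing.subsemimod_closed proj_pred.
Proof.
split.
  split; first by apply/asboolP; exists 0; rewrite mul0r.
  move=> x y /asboolP[s ->] /asboolP[t ->]; apply/asboolP.
  by exists (s + t); rewrite mulrDl.
by move=> a x /asboolP[s ->]; apply/asboolP; exists (a * s); rewrite -mulrA.
Qed.
HB.instance Definition _ :=
  GRing.isSubmodClosed.Build S_alg S_alg^o proj_pred proj_closed.

Record proj_mod := ProjMod { proj_val :> S_alg^o; proj_valP : proj_val \in proj_pred }.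
HB.instance Definition _ := [isSub for proj_val].
HB.instance Definition _ := [Choice of proj_mod by <:].
HB.instance Definition _ := [SubChoice_isSubZmodule of proj_mod by <:].
HB.instance Definition _ := [SubZmodule_isSubLmodule of proj_mod by <:].

Fact proj_of_subproof (s : S_alg) : (s * S_idem V : S_alg^o) \in proj_pred.
Proof. by apply/asboolP; exists s. Qed.

Definition proj_of (s : S_alg) : proj_mod := ProjMod (proj_of_subproof s).

Inductive bad_path : S_alg -> Prop :=
| BadPath (p : flag_path) X :
    path_last p = V -> X \in (p : seq subspace) -> ~~ (V <= X)%VS ->
    bad_path (S_path p).

Definition bad_pred : {pred proj_mod} := fun x => `[< zspan bad_path (proj_val x : S_alg) >].

Lemma bad_left_stable (s x : S_alg) : zspan bad_path x -> zspan bad_path (s * x).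
Proof.
move=> xP; elim/S_alg_ind: s => [|m p s IH]; first by rewrite mul0r; apply: zspan0.
rewrite mulrDl; apply: zspanD => //; rewrite mulrzAl; apply: zspanMz.
elim: xP => {x IH} [x|| x y _ Hx _ Hy].
- case=> r X rV Xr VX; rewrite /S_path -rmorphM /= !pbasisE.
  rewrite -[_ * _]/(path_mul _ _) path_mulU /path_concat.
  case: eqP => [e|_]; last by rewrite raddf0; apply: zspan0.
  rewrite -[_ ++ _]/(val (FlagPath (is_flag_path_cat e))).
  apply/zspan_gen/(BadPath (X := X)) => //; first by rewrite path_last_cat.
  rewrite /= mem_cat; case: r e {rV} Xr => [[|Y t] //= pt] e.
  rewrite /path_head /= in e; rewrite inE => /orP[/eqP->|->]; last by rewrite orbT.
  by apply/orP; left; rewrite -e; rewrite /path_last; case: (p) => [[|Z u] pu] //; apply: (mem_last Z u).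
- by rewrite mulr0; apply: zspan0.
- by rewrite mulrBr; apply: zspanB.
Qed.

Fact bad_closed : GRing.subsemimod_closed bad_pred.
Proof.
split.
  split=> [|x y /asboolP xP /asboolP yP]; apply/asboolP; first exact: zspan0.
  exact: zspanD.
by move=> a x /asboolP xP; apply/asboolP/bad_left_stable.
Qed.
HB.instance Definition _ :=
  GRing.isSubmodClosed.Build S_alg proj_mod bad_pred bad_closed.

Definition Delta := lmod_quot bad_pred.
HB.instance Definition _ := GRing.Lmodule.on Delta.

Definition Delta_class (s : seq subspace) : Delta :=
  to_quot bad_pred (proj_of (S_path s)).

(* A flag (W = V_m > ... > V_1 > V), listed downwards as in the path notation. *)
Definition is_flag (W : subspace) (s : seq subspace) : bool :=
  if s is X :: s' then
    [&& X == W, path (fun Y Z => covered Z Y) X s' & last X s' == V]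
  else false.

Definition is_flag_form (f : Delta -> Delta -> int) : Prop :=
  biadditive f /\
  forall (U U' : subspace) (s t : seq subspace), is_flag U s -> is_flag U' t ->
    S_idem V *~ f (Delta_class s) (Delta_class t) = S_path (rev t) * S_path s.

(* The form < , >_V, as the unique form with the defining property: the flag
   classes span Delta, and (V) has infinite order in S_alg. *)
Definition flag_form : Delta -> Delta -> int :=
  xget (fun _ _ => 0) [set f | is_flag_form f].

Lemma flag_form_biadditive : biadditive flag_form.
Proof.
rewrite /flag_form; case: xgetP => [f _ [] // | _].
by split=> x y z /=; rewrite subr0.
Qed.

Section BaseChange.
Variable k : fieldType.

Definition Delta_k := tens k Delta.
HB.instance Definition _ := GRing.Lmodule.on Delta_k.

Definition S_k := tens k S_alg.
HB.instance Definition _ := GRing.Lmodule.on S_k.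

(* (s (x) a) (d (x) b) = s d (x) a b. *)
Definition Sk_act : S_k -> Delta_k -> Delta_k :=
  tens_bilin (fun s x => tens_mk k (s *: x)).

Definition Sk_mul : S_k -> S_k -> S_k :=
  tens_bilin (fun s t => tens_mk k (s * t)).

Definition idem_k (W : subspace) : S_k := tens_mk k (S_idem W).

Definition flag_class_k (s : seq subspace) : Delta_k :=
  tens_mk k (Delta_class s).

Definition form_k : Delta_k -> Delta_k -> k :=
  tens_bilin (fun x y => (flag_form x y)%:~R : k^o).

Definition rad_pred : {pred Delta_k} := fun x => `[< forall y, form_k x y = 0 >].

Lemma Sk_act_linear s : linear (Sk_act s).
Proof.
apply: tens_bilin_linear_r; split=> x y z.
  by rewrite scalerBr tens_mkB.
by rewrite scalerBl tens_mkB.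
Qed.

Lemma Sk_act_linear_l x : linear (Sk_act^~ x).
Proof.
apply: tens_bilin_linear_l; split=> u v w.
  by rewrite scalerBr tens_mkB.
by rewrite scalerBl tens_mkB.
Qed.

Lemma Sk_mul_biadditive :
  biadditive ((fun s t => tens_mk k (s * t)) : S_alg -> S_alg -> S_k).
Proof. by split=> x y z; rewrite ?mulrBr ?mulrBl tens_mkB. Qed.

Lemma Sk_act_mk s x : Sk_act (tens_mk k s) (tens_mk k x) = tens_mk k (s *: x).
Proof.
apply: tens_bilin_mk; split=> u v w.
  by rewrite scalerBr tens_mkB.
by rewrite scalerBl tens_mkB.
Qed.

Lemma Sk_act1 x : Sk_act (tens_mk k 1) x = x.
Proof.
have act0 s : Sk_act s 0 = 0.
  by have := Sk_act_linear s (-1) 0 0; rewrite scaler0 addr0 scaleN1r addNr.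
elim/tens_ind: x => [|a m x IH]; first exact: act0.
by rewrite Sk_act_linear IH Sk_act_mk scale1r.
Qed.

Lemma Sk_actM s t x : Sk_act (Sk_mul s t) x = Sk_act s (Sk_act t x).
Proof.
have ml := tens_bilin_linear_l Sk_mul_biadditive.
have mr := tens_bilin_linear_r Sk_mul_biadditive.
have l0 (M N : lmodType k) (f : M -> N) : linear f -> f 0 = 0.
  by move=> /(_ (-1) 0 0); rewrite scaler0 addr0 scaleN1r addNr.
elim/tens_ind: s => [|a s s' IHs].
  by rewrite /Sk_mul (l0 _ _ _ (ml t)) !(l0 _ _ _ (Sk_act_linear_l _)).
rewrite /Sk_mul ml !Sk_act_linear_l IHs; congr (_ *: _ + _).
elim/tens_ind: t {IHs} => [|b t t' IHt].
  rewrite (l0 _ _ _ (mr _)) !(l0 _ _ _ (Sk_act_linear_l _)).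
  by rewrite (l0 _ _ _ (Sk_act_linear _)).
rewrite mr !Sk_act_linear_l Sk_act_linear IHt; congr (_ *: _ + _).
elim/tens_ind: x {IHt} => [|c x x' IHx].
  by rewrite !(l0 _ _ _ (Sk_act_linear _)).
rewrite !Sk_act_linear IHx; congr (_ *: _ + _).
by rewrite (tens_bilin_mk Sk_mul_biadditive) !Sk_act_mk scalerA.
Qed.

Lemma form_k_linear_l y : linear (form_k^~ y : Delta_k -> k^o).
Proof.
apply: tens_bilin_linear_l; have [fr fl] := flag_form_biadditive.
by split=> x u v; rewrite ?fr ?fl rmorphB.
Qed.

Fact rad_closed : GRing.subsemimod_closed rad_pred.
Proof.
split=> [|a x /asboolP xP]; first split=> [|x y /asboolP xP /asboolP yP].
- apply/asboolP => z; have := form_k_linear_l z (-1) 0 0.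
  by rewrite scaler0 addr0 scaleN1r addNr.
- apply/asboolP => z; have := form_k_linear_l z 1 x y.
  by rewrite scale1r xP yP scaler0 addr0.
apply/asboolP => z; have := form_k_linear_l z a x 0.
rewrite addr0 xP scaler0 add0r => ->.
have := form_k_linear_l z (-1) 0 0.
by rewrite scaler0 addr0 scaleN1r addNr.
Qed.
HB.instance Definition _ :=
  GRing.isSubmodClosed.Build k Delta_k rad_pred rad_closed.

Definition L_k := lmod_quot rad_pred.
HB.instance Definition _ := GRing.Lmodule.on L_k.

Section WeightSpaces.
Variable W : subspace.

Definition Delta_wt_pred : {pred Delta_k} :=
  fun x => `[< exists y, x = Sk_act (idem_k W) y >].

(* (W) acts on L_k = Delta_k / rad through representatives. *)
Definition L_wt_pred : {pred L_k} :=
  fun x => `[< exists y, x = to_quot rad_pred (Sk_act (idem_k W) y) >].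

Fact Delta_wt_closed : GRing.subsemimod_closed Delta_wt_pred.
Proof. exact: lin_image_closed (Sk_act_linear _). Qed.
HB.instance Definition _ :=
  GRing.isSubmodClosed.Build k Delta_k Delta_wt_pred Delta_wt_closed.

Fact L_wt_closed : GRing.subsemimod_closed L_wt_pred.
Proof.
apply: (@lin_image_closed _ _ _ (to_quot rad_pred \o Sk_act (idem_k W))) => a x y.
by rewrite /= Sk_act_linear linearP.
Qed.
HB.instance Definition _ :=
  GRing.isSubmodClosed.Build k L_k L_wt_pred L_wt_closed.

Record Delta_wt := DeltaWt {
  Delta_wt_val :> Delta_k; Delta_wt_valP : Delta_wt_val \in Delta_wt_pred }.
HB.instance Definition _ := [isSub for Delta_wt_val].
HB.instance Definition _ := [Choice of Delta_wt by <:].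
HB.instance Definition _ := [SubChoice_isSubZmodule of Delta_wt by <:].
HB.instance Definition _ := [SubZmodule_isSubLmodule of Delta_wt by <:].

Record L_wt := LWt { L_wt_val :> L_k; L_wt_valP : L_wt_val \in L_wt_pred }.
HB.instance Definition _ := [isSub for L_wt_val].
HB.instance Definition _ := [Choice of L_wt by <:].
HB.instance Definition _ := [SubChoice_isSubZmodule of L_wt by <:].
HB.instance Definition _ := [SubZmodule_isSubLmodule of L_wt by <:].

End WeightSpaces.
End BaseChange.
End Standard.
End FlagPaths.

Section LinearAutomorphisms.
Variable R : pzRingType.

Record lin_iso (U U' : lmodType R) := LinIso {
  iso_fun :> U -> U';
  iso_inv : U' -> U;
  iso_linear : linear iso_fun;
  iso_funK : cancel iso_fun iso_inv;
  iso_invK : cancel iso_inv iso_fun }.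

Lemma lin_iso_eq (U U' : lmodType R) (f g : lin_iso U U') : f =1 g -> f = g.
Proof.
case: f g => [f f' fl fK f'K] [g g' gl gK g'K] /= /funext efg.
rewrite -{g}efg in gl gK g'K *.
have e : f' = g' by apply: funext => x; rewrite -[x in LHS]g'K fK.
rewrite -{g'}e in gK g'K *.
by congr LinIso; apply: Prop_irrelevance.
Qed.

Lemma iso_inv_linear (U U' : lmodType R) (f : lin_iso U U') : linear (iso_inv f).
Proof.
move=> a x y; apply: (can_inj (iso_funK f)).
by rewrite iso_linear !iso_invK.
Qed.

Definition GL (U : lmodType R) := lin_iso U U.

Variable U : lmodType R.
HB.instance Definition _ := gen_eqMixin (GL U).
HB.instance Definition _ := gen_choiceMixin (GL U).

Definition GL_one : GL U :=
  @LinIso U U id id (fun _ _ _ => erefl) (fun _ => erefl) (fun _ => erefl).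

Fact iso_comp_linear (g h : GL U) : linear (g \o h).
Proof. by move=> a x y; rewrite /= !iso_linear. Qed.

Definition GL_mul (g h : GL U) : GL U :=
  @LinIso U U (g \o h) (iso_inv h \o iso_inv g) (iso_comp_linear g h)
    (can_comp (iso_funK g) (iso_funK h)) (can_comp (iso_invK h) (iso_invK g)).

Definition GL_inv (g : GL U) : GL U :=
  @LinIso U U (iso_inv g) g (iso_inv_linear g) (iso_invK g) (iso_funK g).

Fact GL_mulA : associative GL_mul.
Proof. by move=> f g h; apply: lin_iso_eq. Qed.
Fact GL_mul1 : left_id GL_one GL_mul.
Proof. by move=> f; apply: lin_iso_eq. Qed.
Fact GL_mulr1 : right_id GL_one GL_mul.
Proof. by move=> f; apply: lin_iso_eq. Qed.
Fact GL_mulV : left_inverse GL_one GL_inv GL_mul.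
Proof. by move=> f; apply: lin_iso_eq => x; apply: iso_funK. Qed.
Fact GL_mulrV : right_inverse GL_one GL_inv GL_mul.
Proof. by move=> f; apply: lin_iso_eq => x; apply: iso_invK. Qed.

HB.instance Definition _ :=
  isGroup.Build (GL U) GL_mulA GL_mul1 GL_mulr1 GL_mulV GL_mulrV.

End LinearAutomorphisms.

Section SubquotientSpace.
Variables (F : finFieldType) (n : nat) (V W : {vspace 'rV[F]_n}).

Definition in_V_pred : {pred subvs_of W} := fun w => vsval w \in V.

Fact in_V_closed : GRing.subsemimod_closed in_V_pred.
Proof.
split=> [|a x xV]; first split=> [|x y xV yV].
- by rewrite -topredE /= /in_V_pred linear0 mem0v.
- by rewrite -topredE /= /in_V_pred linearD memvD.
by rewrite -topredE /= /in_V_pred linearZ memvZ.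
Qed.
HB.instance Definition _ :=
  GRing.isSubmodClosed.Build F (subvs_of W) in_V_pred in_V_closed.

(* W / V, for V contained in W. *)
Definition subquot := lmod_quot in_V_pred.
HB.instance Definition _ := GRing.Lmodule.on subquot.

Definition to_subquot (w : 'rV[F]_n) : subquot := to_quot in_V_pred (vsproj W w).

(* The action of GL(W / V) on the subspaces X with V <= X <= W: the set of the
   w in W whose class lies in the image under g of X / V. *)
Definition GL_subspace (g : GL subquot) (X : {vspace 'rV[F]_n}) :
    {vspace 'rV[F]_n} :=
  <<enum [pred w | (w \in W) &&
       [exists x, (x \in X) && (to_subquot w == g (to_subquot x))]]>>%VS.

End SubquotientSpace.

Section Representations.
Variables (G : groupType) (k : fieldType).

Definition is_rep (M : lmodType k) (rho : G -> M -> M) : Prop :=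
  [/\ forall g, linear (rho g), forall x, rho 1%g x = x
    & forall g h x, rho (g * h)%g x = rho g (rho h x)].

Definition rep_iso (M N : lmodType k) (rho : G -> M -> M) (sigma : G -> N -> N)
    : Prop :=
  exists f : {linear M -> N},
    bijective f /\ forall g x, f (rho g x) = sigma g (f x).

Variables (M : vectType k) (rho : G -> M -> M).

Definition dual_rep (g : G) (f : 'Hom(M, k^o)) : 'Hom(M, k^o) :=
  linfun (fun x => f (rho g^-1%g x)).

Definition invariant_sub (U : {vspace M}) : Prop :=
  forall g x, x \in U -> rho g x \in U.

Definition sub_rep (U : {vspace M}) (g : G) (x : subvs_of U) : subvs_of U :=
  vsproj U (rho g (vsval x)).

Definition simple_sub (U : {vspace M}) : Prop :=
  [/\ invariant_sub U, U <> 0%VS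
    & forall U' : {vspace M}, invariant_sub U' -> (U' <= U)%VS ->
        U' = 0%VS \/ U' = U].

(* The sum of all simple submodules, that is, the least subspace containing
   every simple submodule. *)
Definition is_socle (S : {vspace M}) : Prop :=
  (forall U, simple_sub U -> (U <= S)%VS) /\
  (forall T : {vspace M}, (forall U, simple_sub U -> (U <= T)%VS) -> (S <= T)%VS).

Definition socle : {vspace M} := xget 0%VS [set S | is_socle S].

End Representations.
Arguments sub_rep {G k M} rho U g x.

Section GroupAlgebra.
Variables (k : fieldType) (G : finGroupType).

Definition grp_alg := {ffun G -> k^o}.
HB.instance Definition _ := Vector.on grp_alg.

Definition grp_elt (g : G) : grp_alg := [ffun h => (h == g)%:R].

Definition grp_mul (a b : grp_alg) : grp_alg :=
  [ffun g => \sum_(h : G) a h * b (h^-1 * g)%g].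

Fact grp_mul_linear_l (e : grp_alg) : linear (grp_mul^~ e).
Proof.
move=> c a b; apply/ffunP => g; rewrite !ffunE scaler_sumr -big_split.
by apply: eq_bigr => h _ /=; rewrite !ffunE mulrDl -scalerAl.
Qed.

(* The left ideal kG e. *)
Definition left_ideal (e : grp_alg) : {vspace grp_alg} :=
  limg (linfun (grp_mul^~ e)).

Lemma left_idealP (e x : grp_alg) :
  reflect (exists a, x = grp_mul a e) (x \in left_ideal e).
Proof.
pose f : {linear grp_alg -> grp_alg} :=
  HB.pack (grp_mul^~ e) (GRing.isLinear.Build k _ _ _ _ (grp_mul_linear_l e)).
have fE a : linfun (grp_mul^~ e) a = grp_mul a e by apply: (lfunE f).
apply: (iffP memv_imgP) => [[a _ ->]|[a ->]]; exists a; rewrite ?fE ?memvf //.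
Qed.

End GroupAlgebra.

Section Steinberg.
Variables (k : fieldType) (F : finFieldType) (m : nat).

(* {'GL_m[F]} is not used, since it stands for GL_1 when m = 0. *)
Record GLmx := GLMx { GLmx_val :> 'M[F]_m; GLmx_valP : GLmx_val \in unitmx }.
HB.instance Definition _ := [isSub for GLmx_val].
HB.instance Definition _ := [Finite of GLmx by <:].

Fact GLmx_one_subproof : 1%:M \in @unitmx F m.
Proof. exact: unitmx1. Qed.
Definition GLmx_one : GLmx := GLMx GLmx_one_subproof.

Fact GLmx_mul_subproof (A B : GLmx) : A *m B \in unitmx.
Proof. by rewrite unitmx_mul !GLmx_valP. Qed.
Definition GLmx_mul (A B : GLmx) : GLmx := GLMx (GLmx_mul_subproof A B).

Fact GLmx_inv_subproof (A : GLmx) : invmx A \in unitmx.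
Proof. by rewrite unitmx_inv GLmx_valP. Qed.
Definition GLmx_inv (A : GLmx) : GLmx := GLMx (GLmx_inv_subproof A).

Fact GLmx_mulA : associative GLmx_mul.
Proof. by move=> A B C; apply: val_inj; rewrite /= mulmxA. Qed.
Fact GLmx_mul1 : left_id GLmx_one GLmx_mul.
Proof. by move=> A; apply: val_inj; rewrite /= mul1mx. Qed.
Fact GLmx_mulV : left_inverse GLmx_one GLmx_inv GLmx_mul.
Proof. by move=> A; apply: val_inj; rewrite /= mulVmx ?GLmx_valP. Qed.
HB.instance Definition _ :=
  Finite_isGroup.Build GLmx GLmx_mulA GLmx_mul1 GLmx_mulV.

Definition perm_GLmx (s : 'S_m) : GLmx := GLMx (unitmx_perm F s).

Definition upper_trig (A : GLmx) : bool :=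
  [forall i : 'I_m, forall j : 'I_m, (j < i)%N ==> (A i j == 0)].

Definition steinberg_elt : grp_alg k GLmx :=
  grp_mul (\sum_(s : 'S_m) (-1) ^+ s *: grp_elt k (perm_GLmx s))
          (\sum_(b : GLmx | upper_trig b) grp_elt k b).

Definition St : {vspace grp_alg k GLmx} := left_ideal steinberg_elt.

Variables (U : lmodType F) (theta : lin_iso U 'cV[F]_m).

(* The matrix of g in the coordinates theta. *)
Definition coord_mx (g : GL U) : 'M[F]_m :=
  \matrix_(i, j) theta (g (iso_inv theta (delta_mx j 0))) i 0.

Lemma coord_mxE (g : GL U) u : theta (g u) = coord_mx g *m theta u.
Proof.
pose h v := theta (g (iso_inv theta v)).
have hl : linear h by move=> a x y; rewrite /h iso_inv_linear !iso_linear.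
pose h' : {linear 'cV[F]_m -> 'cV[F]_m} :=
  HB.pack h (GRing.isLinear.Build F 'cV[F]_m 'cV[F]_m _ h hl).
rewrite -[u in LHS](iso_funK theta) -[LHS]/(h' (theta u)).
rewrite [X in h' X]matrix_sum_delta linear_sum; apply/matrixP => i z.
rewrite ord1 summxE !mxE; apply: eq_bigr => j _.
by rewrite big_ord1 linearZ /= !mxE mulrC.
Qed.

Fact coord_mx_unit (g : GL U) : coord_mx g \in unitmx.
Proof.
have e : coord_mx (g^-1)%g *m coord_mx g = 1%:M.
  apply/matrixP => i j; set x := iso_inv theta (delta_mx j 0).
  have -> : (coord_mx (g^-1)%g *m coord_mx g) i j =
      (coord_mx (g^-1)%g *m coord_mx g *m (delta_mx j 0 : 'cV_m)) i 0.
    by rewrite -colE !mxE.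
  rewrite -mulmxA -[delta_mx j 0 in LHS](iso_invK theta) -!coord_mxE.
  rewrite -[(g^-1)%g (g _)]/((g^-1 * g)%g _) mulVg /= iso_invK.
  by rewrite !mxE eqxx andbT.
by have [] := mulmx1_unit e.
Qed.

Definition coord_GLmx (g : GL U) : GLmx := GLMx (coord_mx_unit g).

Definition St_rep (g : GL U) (x : subvs_of St) : subvs_of St :=
  vsproj St (grp_mul (grp_elt k (coord_GLmx g)) (vsval x)).

End Steinberg.
Arguments St_rep k {F m U} theta g x.

Section NaturalActions.
Variables (F : finFieldType) (n : nat) (k : fieldType).
Variables V W : {vspace 'rV[F]_n}.

(* The action of GL(W / V) on the W-weight space of Delta_k that permutes the
   classes of the flags from W down to V. *)
Definition flag_action (rho : GL (subquot V W) -> Delta_wt V k W -> Delta_wt V k W)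
    : Prop :=
  is_rep rho /\
  forall g s (x : Delta_wt V k W), is_flag V W s ->
    Delta_wt_val x = flag_class_k V k s ->
    Delta_wt_val (rho g x) = flag_class_k V k (map (GL_subspace g) s).

Definition induced_action
    (rho : GL (subquot V W) -> Delta_wt V k W -> Delta_wt V k W)
    (rhoL : GL (subquot V W) -> L_wt V k W -> L_wt V k W) : Prop :=
  is_rep rhoL /\
  forall g (x : Delta_wt V k W) (z : L_wt V k W),
    L_wt_val z = to_quot (@rad_pred F n V k) (Delta_wt_val x) ->
    L_wt_val (rhoL g z) = to_quot (@rad_pred F n V k) (Delta_wt_val (rho g x)).

End NaturalActions.

(* Main.v *)
From HB Require Import structures.
Require Import Defs.
From mathcomp Require Import all_boot all_order all_algebra all_fingroup zify.
From mathcomp.multinomials Require Import freeg.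
From mathcomp.classical Require Import boolp classical_sets.
Set Implicit Arguments.
Unset Strict Implicit.
Unset Printing Implicit Defensive.
Import GRing.Theory.
Local Open Scope ring_scope.

(** Let FS be the space of functions on the flags from W down to V that satisfy
    the relations (FS).  The algebra acts from the right on all such functions
    (for all W at once): a step down prepends a subspace to a flag, and a step up
    Y < X intersects a flag from X with Y, with the sign and the power of q
    forced by the wedge relations.  Hence every function in FS extends to a
    functional on Delta_V, and the W-weight space is dual to FS.

    On the other hand a flag is a coset gB, so FS consists of right B-invariant
    functions on GL_m, and contains St.  A function in FS that vanishes on the
    big cell (the lower unitriangular matrices L) is zero, by Gaussian elimination;
    since the L-translates of the generator of St form a dual basis on that
    cell, St = FS.

    For the socle, the form maps Delta_V^W to FS = St, with kernel the radical;
    its image is spanned by the vectors <gB, ->.  Let M be a nonzero submodule of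
    St.  Averaging a suitable element over the lower unitriangular group U^-, whose
    order is a power of q, produces a nonzero U^- -invariant vector of M, and these
    are unique up to a scalar by the vanishing property, hence proportional to
    <w0 B, ->.  So M contains the image of the form, which is therefore the unique
    simple submodule, and the symmetric form makes it self-dual. *)

(** * Covering relations between subspaces *)

(** [Delta] and the form are given by generators and relations, so no class can be shown nonzero
    before a model exists. The model lets a function psi act and retains the value of psi.a at the
    trivial flag [:: V]; for this to descend to the algebra, all four relations have to be checked
    on arbitrary flags. The check is a count on the projective line B/A: one of its q+1 points
    contributes a factor q^(dim A + 1), each of the q others -q^(dim A), and these cancel; this ties
    the sign and the power of q in the wedge relations to (FS). The same action, applied to the
    indicator of [:: V], computes the form.

    That l does not divide q enters through two powers of q that must be nonzero in k: the value
    <gB, gB> and the order of U^-. The choice of w0 comes from U^- w0 B = w0 B: after a translation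
    that makes a vector nonzero at w0, averaging multiplies that value by the order of U^- and
    cannot kill it. Uniqueness of the invariant vector is cheap because the big cell is U^- itself,
    on which an invariant function is constant. *)

Section Covers.
Variables (F : finFieldType) (n : nat).
Local Notation subspace := {vspace 'rV[F]_n}.
Implicit Types (A B X Y Z V : subspace) (v : 'rV[F]_n).

Lemma covered_sub Y X : covered Y X -> (Y <= X)%VS.
Proof. by case/andP. Qed.

Lemma covered_dim Y X : covered Y X -> \dim X = (\dim Y).+1.
Proof. by case/andP=> _ /eqP. Qed.

Lemma covered_asym Y X : covered Y X -> covered X Y = false.
Proof. by move=> /covered_dim e; apply/negP => /covered_dim; lia. Qed.

Lemma covered_irr X : covered X X = false.
Proof. by apply/negP => h; move: (covered_asym h); rewrite h. Qed.

Lemma covered_eqS Y X Z : covered Y X -> (Z <= X)%VS -> (Y <= Z)%VS ->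
  Y != Z -> Z = X.
Proof.
move=> /andP[YX /eqP dX] ZX YZ YnZ; apply/eqP; rewrite eqEdim ZX dX ltnNge.
by apply: contra YnZ => dZ; rewrite eqEdim YZ dZ.
Qed.

Lemma covered_sub_eq Y Y' X : covered Y X -> covered Y' X -> (Y <= Y')%VS -> Y = Y'.
Proof.
move=> YX Y'X YY'; apply/eqP; rewrite eqEdim YY' /=.
by rewrite -ltnS -(covered_dim YX) -(covered_dim Y'X).
Qed.

Lemma covered_up_eq Y X X' : covered Y X -> covered Y X' -> (X <= X')%VS -> X = X'.
Proof.
by move=> YX YX' XX'; apply/eqP; rewrite eqEdim XX' (covered_dim YX) (covered_dim YX') leqnn.
Qed.

Lemma covered_add A v : v \notin A -> covered A (A + <[v]>)%VS.
Proof.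
move=> vA; rewrite /covered addvSl /=.
have vn0 : v != 0 by apply: contraNneq vA => ->; apply: mem0v.
have /eqP := dimv_sum_cap A <[v]>; rewrite dim_vline vn0 addn1.
suff -> : (A :&: <[v]>)%VS = 0%VS by rewrite dimv0 addn0.
apply/eqP; rewrite -subv0; apply/subvP => u; rewrite memv_cap memv0.
case/andP=> uA /vlineP[c eu]; have [c0|cn0] := eqVneq c 0.
  by rewrite eu c0 scale0r.
by case/negP: vA; rewrite -[v]scale1r -(mulVf cn0) -scalerA -eu memvZ.
Qed.

Lemma covered_addE A Y v : covered A Y -> v \in Y -> v \notin A -> Y = (A + <[v]>)%VS.
Proof.
move=> AY vY vA; symmetry; apply: (covered_up_eq (covered_add vA) AY).
by rewrite subv_add (covered_sub AY) -memvE.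
Qed.

Lemma covered_ex A Y : covered A Y -> exists2 v, v \in Y & v \notin A.
Proof.
move=> AY; have : ~~ (Y <= A)%VS.
  by apply/negP => /dimvS; rewrite (covered_dim AY) ltnn.
by case/subvPn => v vY vA; exists v.
Qed.

Lemma covered_capl Y X Y' : covered Y X -> covered Y' X -> Y != Y' ->
  covered (Y :&: Y')%VS Y.
Proof.
move=> YX Y'X ne; rewrite /covered capvSl /=.
have e : (Y + Y')%VS = X.
  apply: (covered_eqS YX); rewrite ?addvSl ?subv_add ?covered_sub //.
  apply: contra ne => /eqP e; apply/eqP/esym/(covered_sub_eq Y'X YX).
  by rewrite e addvSr.
have := dimv_sum_cap Y Y'; rewrite e.
by have := covered_dim YX; have := covered_dim Y'X; move=> h1 h2 h3; lia.
Qed.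

Lemma covered_capr Y X Y' : covered Y X -> covered Y' X -> Y != Y' ->
  covered (Y :&: Y')%VS Y'.
Proof. by move=> YX Y'X ne; rewrite capvC; apply: covered_capl Y'X YX _; rewrite eq_sym. Qed.

Lemma covered_cap Y X A : covered Y X -> (A <= X)%VS -> ~~ (A <= Y)%VS ->
  covered (Y :&: A)%VS A.
Proof.
move=> YX AX AY; rewrite /covered capvSr /=.
have eX : (Y + A)%VS = X.
  apply: (covered_eqS YX); rewrite ?addvSl ?subv_add ?(covered_sub YX) //.
  by apply: contra AY => /eqP->; apply: addvSr.
by have := dimv_sum_cap Y A; have := covered_dim YX; rewrite eX; lia.
Qed.

Definition between A B X := covered A X && covered X B.

Lemma between_dim A B X : between A B X -> (A <= B)%VS /\ \dim B = (\dim A + 2)%N.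
Proof.
case/andP=> AX XB; split; first exact: subv_trans (covered_sub AX) (covered_sub XB).
by rewrite (covered_dim XB) (covered_dim AX) addn2.
Qed.

Lemma betweenE A B X : (A <= X)%VS -> (X <= B)%VS -> \dim B = (\dim A + 2)%N ->
  \dim X = (\dim A).+1 -> between A B X.
Proof. by move=> AX XB dB dX; rewrite /between /covered AX XB dB dX addn2 !eqxx. Qed.

(** Affine coordinates on the projective line B/A: [v] spans the point at infinity, and the other
    points are the lines through [t *: v + v']. *)
Lemma between_sum (M : zmodType) (G : subspace -> M) A B v v' :
    v \notin A -> v' \notin (A + <[v]>)%VS -> B = (A + <[v]> + <[v']>)%VS ->
  \sum_(X | between A B X) G X
    = G (A + <[v]>)%VS + \sum_(t : F) G (A + <[t *: v + v']>)%VS.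
Proof.
move=> vA v'A eB; pose X0 := (A + <[v]>)%VS; pose h t := (A + <[t *: v + v']>)%VS.
have AX0 : covered A X0 by apply: covered_add.
have X0B : covered X0 B by rewrite eB; apply: covered_add.
have uA t : t *: v + v' \notin X0.
  apply: contra v'A => uX0; rewrite -[v'](addKr (t *: v)) memvD //.
  by rewrite memvN memvZ // (subvP (addvSr _ _)) // memv_line.
have AX0' : (A <= X0)%VS by apply: addvSl.
have AB : (A <= B)%VS by apply: subv_trans AX0' (covered_sub X0B).
have dB : \dim B = (\dim A + 2)%N by rewrite (covered_dim X0B) (covered_dim AX0) addn2.
have v'B : v' \in B by rewrite eB memvE addvSr.
have vX0 : v \in X0 by rewrite memvE addvSr.
have vB : v \in B by rewrite (subvP (covered_sub X0B)).
have hB t : between A B (h t).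
  have At : covered A (h t).
    by apply: covered_add; apply: contra (uA t); apply: (subvP AX0').
  apply: betweenE => //; first exact: covered_sub.
    by rewrite subv_add AB -memvE memvD ?memvZ.
  exact: covered_dim.
have hX0 t : h t != X0.
  by apply: contraNneq (uA t) => <-; rewrite memvE addvSr.
have hu t : t *: v + v' \in h t by rewrite memvE addvSr.
have h_inj : injective h.
  move=> t u e; apply/eqP; apply: contraT => ne.
  have vt : v \in h t.
    have : (t *: v + v') - (u *: v + v') \in h t by rewrite memvB ?hu // e hu.
    rewrite opprD addrACA subrr addr0 -scalerBl => H.
    have tu : t - u != 0 by rewrite subr_eq0.
    by rewrite -[v]scale1r -(mulVf tu) -scalerA memvZ.
  case/eqP: (hX0 t); case/andP: (hB t) => At _.
  exact: covered_addE At vt vA.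
rewrite (bigD1 X0) /=; last by rewrite /between AX0.
congr (_ + _); pose h' X := odflt 0 [pick t | h t == X].
have hK : cancel h h'.
  by move=> t; rewrite /h'; case: pickP => [u /eqP/h_inj //|/(_ t)]; rewrite eqxx.
rewrite (reindex_onto h h') /=.
  apply: eq_bigl => t; rewrite hB hX0 hK eqxx; done.
move=> X /andP[XB XX0]; rewrite /h'; case: pickP => [u /eqP //|/= noh].
case/andP: XB => AX XB.
have vX : v \notin X.
  by apply: contra XX0 => vX; apply/eqP/(covered_addE AX).
have eXB : (X + <[v]>)%VS = B.
  apply: (covered_up_eq (covered_add vX) XB).
  by rewrite subv_add (covered_sub XB) -memvE.
(* B = X + <[v]> gives v' = x + c v with x in X, so the parameter of X is -c. *)
move: v'B; rewrite -eXB => /memv_addP[x xX [u /vlineP[c ->] e]].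
have := noh (- c); rewrite /h => /eqP[]; symmetry; apply: covered_addE => //.
  by rewrite scaleNr e addrC addrK.
by apply: contra (uA (- c)) => /(subvP AX0').
Qed.

Lemma between_ex A B : (A <= B)%VS -> \dim B = (\dim A + 2)%N -> exists C, between A B C.
Proof.
move=> AB dB; have /subvPn[v vB vA] : ~~ (B <= A)%VS.
  by apply/negP => /dimvS; lia.
exists (A + <[v]>)%VS; apply: betweenE; rewrite ?addvSl ?subv_add ?AB -?memvE //.
exact/covered_dim/covered_add.
Qed.

(** Taking [Z] as the point at infinity leaves q affine points. With a suitable [c] this produces
    the cancellation in both (FS) arguments below. *)
Lemma between_const (M : zmodType) (G : subspace -> M) A B Z c :
    between A B Z -> (forall X, between A B X -> X != Z -> G X = c) ->
  \sum_(X | between A B X) G X = G Z + c *+ #|F|.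
Proof.
move=> AZB Gc; case/andP: (AZB) => AZ ZB.
have [v vZ vA] := covered_ex AZ; have [v' v'B v'Z] := covered_ex ZB.
have eZ := covered_addE AZ vZ vA; have eB := covered_addE ZB v'B v'Z.
rewrite (@between_sum _ G A B v v') //; last 2 first.
- by rewrite -eZ.
- by rewrite -eZ.
rewrite -eZ; congr (_ + _); rewrite -sumr_const; apply: eq_bigr => t _.
have uZ : t *: v + v' \notin Z.
  apply: contra v'Z => uZ; rewrite -[v'](addKr (t *: v)) memvD //.
  by rewrite memvN memvZ.
apply: Gc; last by apply: contraNneq uZ => <-; rewrite memvE addvSr.
have uA : t *: v + v' \notin A by apply: contra uZ => /(subvP (covered_sub AZ)).
apply: betweenE; rewrite ?addvSl ?(covered_dim (covered_add uA)) //.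
  rewrite subv_add (subv_trans (covered_sub AZ)) ?(covered_sub ZB) //.
  by rewrite -memvE memvD // memvZ // (subvP (covered_sub ZB)).
by have [] := between_dim AZB.
Qed.

(* Meeting with a hyperplane Y of X that does not contain B is a bijection from
   the projective line of X/B to that of Y/(Y :&: B). *)
Lemma between_cap (M : zmodType) (G : subspace -> M) B X Y :
    covered Y X -> (B <= X)%VS -> \dim X = (\dim B + 2)%N -> ~~ (B <= Y)%VS ->
  \sum_(Z | between B X Z) G (Y :&: Z)%VS
    = \sum_(Z | between (Y :&: B) Y Z) G Z.
Proof.
move=> YX BX dX BY; have dY := covered_dim YX.
have dcap : (\dim (Y :&: B)).+1 = \dim B.
  by rewrite (covered_dim (covered_cap YX BX BY)).
have eX : (Y + B)%VS = X.
  apply: (covered_eqS YX); rewrite ?addvSl ?subv_add ?(covered_sub YX) //.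
  by apply: contra BY => /eqP->; apply: addvSr.
rewrite [RHS](reindex_onto (fun Z => (Y :&: Z)%VS) (fun Z => (Z + B)%VS)) /=.
  apply: eq_bigl => Z; apply/idP/idP.
    case/andP=> BZ ZX; have ZY : ~~ (Z <= Y)%VS.
      by apply: contra BY; apply: subv_trans (covered_sub BZ).
    have YnZ : Y != Z by apply: contraNneq ZY => ->.
    have YZ := covered_capl YX ZX YnZ.
    have YBZ : ((Y :&: B) <= (Y :&: Z))%VS by rewrite capvS // covered_sub.
    have d2 := covered_dim YZ; have d3 := covered_dim BZ; have d4 := covered_dim ZX.
    apply/andP; split.
      by apply: betweenE; rewrite ?capvSl //; clear -dX dY dcap d2 d3 d4; lia.
    have BcZ : ~~ ((Y :&: Z) <= B)%VS.
      by apply/negP => h; have := dimvS (_ : (Y :&: Z <= Y :&: B)%VS);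
         rewrite subv_cap capvSl h => /(_ isT);
         clear -dX dY dcap d2 d3 d4; lia.
    apply/eqP; apply: (covered_eqS BZ); rewrite ?addvSr ?subv_add ?capvSr ?(covered_sub BZ) //.
    by apply: contra BcZ => /eqP e; rewrite [X in (_ <= X)%VS]e addvSl.
  case/andP=> /andP[h1 h2] /eqP e.
  have BZ : (B <= Z)%VS by rewrite -e addvSr.
  have ZX : (Z <= X)%VS by rewrite -e subv_add BX (subv_trans (capvSl _ _) (covered_sub YX)).
  apply: betweenE => //.
  have := dimv_sum_cap Y Z.
  have -> : (Y + Z)%VS = X.
    by apply/eqP; rewrite eqEsubv subv_add (covered_sub YX) ZX -eX addvS.
  by have := covered_dim h2; lia.
move=> Z /andP[h1 h2]; rewrite capvC -vspace_modl ?(covered_sub h2) //.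
by rewrite capvC (addv_idPl (covered_sub h1)).
Qed.

End Covers.

(** * Functions on flags *)

Section Flags.
Variables (F : finFieldType) (n : nat).
Local Notation subspace := {vspace 'rV[F]_n}.
Variable V : subspace.
Implicit Types (A B C W X Y Z : subspace) (D s t : seq subspace).

Lemma flag_consE W X D : is_flag V W [:: W, X & D] = covered X W && is_flag V X (X :: D).
Proof. by rewrite /is_flag /= !eqxx /= andbA. Qed.

Lemma flag_cons W X D : covered X W -> is_flag V X D -> is_flag V W (W :: D).
Proof.
case: D => // Y D XW fD; have /andP[/eqP eY _] : (Y == X) && true by case/and3P: fD => ->.
by rewrite eY in fD *; rewrite flag_consE XW.
Qed.

Lemma flag_last : is_flag V V [:: V].
Proof. by rewrite /is_flag /= !eqxx. Qed.

Lemma flag_ind (P : subspace -> seq subspace -> Prop) :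
    P V [:: V] ->
    (forall W X D, covered X W -> is_flag V X D -> P X D -> P W (W :: D)) ->
  forall W D, is_flag V W D -> P W D.
Proof.
move=> P0 PS W D; elim: D W => // Y D IH W fD.
have /andP[/eqP eY _] : (Y == W) && true by case/and3P: fD => ->.
move: fD; rewrite {Y}eY; case: D IH => [|X D] IH.
  by rewrite /is_flag /= eqxx /= => /eqP->.
by rewrite flag_consE => /andP[XW fD]; apply: PS XW fD (IH _ fD).
Qed.

Lemma flag_head W D : is_flag V W D -> exists D', D = W :: D'.
Proof. by move=> fD; elim/flag_ind: W D / fD => [|W X D' _ _ _]; eexists. Qed.

Lemma flag_sub W D : is_flag V W D -> (V <= W)%VS.
Proof.
move=> fD; elim/flag_ind: W D / fD => // W X D XW _ VX.
exact: subv_trans VX (covered_sub XW).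
Qed.

Section Cochains.
Variable M : zmodType.
Implicit Types psi : seq subspace -> M.

Definition FS W psi := forall s A B t, (A <= B)%VS -> \dim B = (\dim A + 2)%N ->
  (forall C, between A B C -> is_flag V W (s ++ [:: B, C, A & t])) ->
  \sum_(C | between A B C) psi (s ++ [:: B, C, A & t]) = 0.

(* psi evaluated at the product of (Y < X) with a flag D that starts at X: the
   wedge relation moves Y down the flag by intersection. *)
Fixpoint wedge_act Y D psi : M :=
  if D is X :: D1 then
    if D1 is X' :: _ then
      if X' == Y then psi D1 *+ (#|F| ^ \dim Y)
      else - wedge_act (Y :&: X')%VS D1 (fun s => psi (Y :: s))
    else 0
  else 0.

Lemma wedge_act_eq Y X D psi : wedge_act Y [:: X, Y & D] psi = psi (Y :: D) *+ (#|F| ^ \dim Y).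
Proof. by rewrite /= eqxx. Qed.

Lemma wedge_act_neq Y X X' D psi : X' != Y ->
  wedge_act Y [:: X, X' & D] psi = - wedge_act (Y :&: X')%VS (X' :: D) (fun s => psi (Y :: s)).
Proof. by move=> /negPf /= ->. Qed.

(** The recursion evaluates [psi] only on flags from [Y]. If [Y] does not contain [V] there are none
    and the value is 0; this disposes of paths that leave the subspaces containing [V]. *)
Lemma wedge_act_ext Y X D psi psi' : covered Y X -> is_flag V X D ->
  (forall s, is_flag V Y s -> psi s = psi' s) -> wedge_act Y D psi = wedge_act Y D psi'.
Proof.
move=> YX fD; elim/flag_ind: X D / fD Y YX psi psi' => // W X D XW fD IH Y YW psi psi' e.
have [D' eD] := flag_head fD; rewrite eD in fD IH *.
have [eXY|ne] := eqVneq X Y.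
  by rewrite -eXY in YW e *; rewrite !wedge_act_eq e.
rewrite !wedge_act_neq //; congr (- _); apply: IH; first by apply: covered_capr YW XW _; rewrite eq_sym.
by move=> s fs; apply: e; apply: flag_cons fs; apply: covered_capl YW XW _; rewrite eq_sym.
Qed.

Lemma wedge_act_lin Y D psi psi' (m : int) :
  wedge_act Y D (fun s => psi s *~ m + psi' s) = wedge_act Y D psi *~ m + wedge_act Y D psi'.
Proof.
elim: D Y psi psi' => [|X D IH] Y psi psi'; first by rewrite mul0rz addr0.
case: D IH => [|X' D] IH; first by rewrite mul0rz addr0.
have [->|ne] := eqVneq X' Y.
  by rewrite !wedge_act_eq mulrnDl; congr (_ + _); rewrite !pmulrn mulrzAC.
by rewrite !wedge_act_neq // IH opprD mulNrz.
Qed.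

Lemma wedge_act0 Y D : wedge_act Y D (fun=> 0) = 0.
Proof.
have e : (fun=> 0) = (fun s : seq subspace => 0 *~ (-1) + 0 : M).
  by apply: funext => s; rewrite mul0rz addr0.
by rewrite e wedge_act_lin mulrN1z addNr.
Qed.

Lemma wedge_actN Y D psi : wedge_act Y D (fun s => - psi s) = - wedge_act Y D psi.
Proof.
rewrite -[RHS]addr0 -[X in _ + X](wedge_act0 Y D) -mulrN1z -wedge_act_lin; congr wedge_act.
by apply: funext => s; rewrite mulrN1z addr0.
Qed.

Lemma wedge_act_sum Y D (I : Type) (r : seq I) (P : pred I) (psi : I -> seq subspace -> M) :
  wedge_act Y D (fun s => \sum_(i <- r | P i) psi i s) = \sum_(i <- r | P i) wedge_act Y D (psi i).
Proof.
elim: r => [|i r IH].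
  by rewrite big_nil -[RHS](wedge_act0 Y D); congr wedge_act; apply: funext => s; rewrite big_nil.
rewrite big_cons -IH; case: (boolP (P i)) => Pi.
  rewrite -[X in X + _]mulr1z -wedge_act_lin; congr wedge_act; apply: funext => s.
  by rewrite big_cons Pi mulr1z.
by congr wedge_act; apply: funext => s; rewrite big_cons (negPf Pi).
Qed.

Lemma FS_ext W psi psi' : (forall s, is_flag V W s -> psi s = psi' s) -> FS W psi -> FS W psi'.
Proof.
move=> e fs s A B t AB dB fl; rewrite -[RHS](fs s A B t AB dB fl).
by apply: eq_bigr => C Cb; rewrite e // fl.
Qed.

Lemma FS_cons W X psi : covered X W -> FS W psi -> FS X (fun s => psi (W :: s)).
Proof.
move=> XW fs s A B t AB dB fl; apply: (fs (W :: s)) => // C Cb.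
by apply: flag_cons XW _; apply: fl.
Qed.

(** Induction on the position of the relation. Below the top of the flag, the wedge either stops
    above the relation or passes down by intersection; only a relation at the top needs a
    computation. *)
Lemma wedge_act_FS X Y psi : covered Y X -> FS Y psi -> FS X (fun D => wedge_act Y D psi).
Proof.
move=> YX fs s; elim: s X Y YX psi fs => [|X0 s IH] X Y YX psi fs A B t AB dB fl.
  have [C0 C0b] := between_ex AB dB.
  have fl0 : is_flag V X [:: B, C0, A & t] := fl _ C0b.
  have eB : B = X by have [D' []] := flag_head fl0.
  subst B; move: fl0; rewrite !flag_consE => /and3P[_ _ fA].
  rewrite /=; have [AY|AY] := boolP (A <= Y)%VS.
    have AbY : between A X Y.
      by apply: betweenE; rewrite ?(covered_sub YX) //; have := covered_dim YX; lia.
    have cAY := proj1 (andP AbY).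
    (* The point C = Y contributes q^(dim Y) = q^(dim A + 1); every other C meets Y in A and
       contributes -q^(dim A). *)
    rewrite (between_const (c := - (psi [:: Y, A & t] *+ #|F| ^ \dim A)) AbY).
      rewrite eqxx (covered_dim cAY) expnSr mulrnA mulNrn subrr; done.
    move=> C Cb CY; rewrite (negPf CY); case/andP: (Cb) => AC CX.
    have eA : A = (Y :&: C)%VS.
      have YC : Y != C by rewrite eq_sym.
      apply: covered_sub_eq cAY (covered_capl YX CX YC) _.
      by rewrite subv_cap AY covered_sub.
    by rewrite -eA eqxx.
  have CnY C : between A X C -> C != Y.
    by case/andP=> AC _; apply: contraNneq AY => <-; apply: covered_sub.
  pose H Z := wedge_act (Y :&: A)%VS (A :: t) (fun s => psi [:: Y, Z & s]).
  (* Two wedge moves, past C and past A: the signs cancel and the term depends on C only through Y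
     :&: C, which runs over the pencil between Y :&: A and Y. *)
  rewrite (eq_bigr (fun C => H (Y :&: C)%VS)); last first.
    move=> C Cb; rewrite (negPf (CnY C Cb)); case/andP: (Cb) => AC CX.
    case: eqP => [eA|_]; first by case/negP: AY; rewrite eA capvSl.
    by rewrite opprK -capvA (capv_idPr (covered_sub AC)).
  rewrite (between_cap H YX AB dB AY) /H -wedge_act_sum.
  have cA : covered (Y :&: A)%VS A := covered_cap YX AB AY.
  rewrite -[RHS](wedge_act0 (Y :&: A)%VS (A :: t)); apply: (wedge_act_ext cA fA).
  move=> u fu; have [u' eu] := flag_head fu; rewrite eu in fu *.
  apply: (fs [::]); rewrite ?capvSl //.
    by have := covered_dim YX; have := covered_dim cA; lia.
  by move=> C /andP[h1 h2]; rewrite cat0s !flag_consE h1 h2.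
have [C0 C0b] := between_ex AB dB.
set X' := head B s.
have hdE C : exists L, s ++ [:: B, C, A & t] = X' :: L.
  by rewrite /X'; case: (s) => [|X1 s'] /=; eexists.
have eX : X0 = X by have [D' []] := flag_head (fl _ C0b).
subst X0; have fX' C : between A B C -> covered X' X /\ is_flag V X' (s ++ [:: B, C, A & t]).
  by move=> /fl; have [L e] := hdE C; rewrite cat_cons e flag_consE => /andP.
have [X'X _] := fX' _ C0b.
have [eX'|ne] := eqVneq X' Y.
  rewrite (eq_bigr (fun C => psi (s ++ [:: B, C, A & t]) *+ (#|F| ^ \dim Y))).
    rewrite sumrMnl (fs s) ?mul0rn // => C Cb; rewrite -eX'.
    by have [] := fX' _ Cb.
  by move=> C _; have [L /= ->] := hdE C; rewrite eX' eqxx.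
rewrite (eq_bigr (fun C => - wedge_act (Y :&: X')%VS (s ++ [:: B, C, A & t]) (fun u => psi (Y :: u)))).
  have neY : Y != X' by rewrite eq_sym.
  rewrite sumrN (IH X' (Y :&: X')%VS) ?oppr0 //; first exact: covered_capr YX X'X neY.
    by apply: FS_cons fs; apply: covered_capl YX X'X neY.
  by move=> C Cb; have [] := fX' _ Cb.
by move=> C _; have [L /= ->] := hdE C; rewrite (negPf ne).
Qed.

(** If the next subspace [W1] of the flag contains [V'], the point X = W1 contributes q^(dim W1) and
    each of the q others -q^(dim V'); otherwise intersecting with [W1] moves the relation one step
    down the flag. *)
Lemma wedge_act_up W D psi V' : is_flag V W D -> (V' <= W)%VS -> \dim W = (\dim V' + 2)%N ->
  \sum_(X | between V' W X) wedge_act X D (fun E => wedge_act V' E psi) = 0.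
Proof.
move=> fD; elim/flag_ind: W D / fD V' psi => [|W W1 D W1W fD IH] V' psi V'W dW.
  by apply: big1.
have [D' eD] := flag_head fD; subst D.
have [V'W1|nV'W1] := boolP (V' <= W1)%VS.
  have W1b : between V' W W1.
    by apply: betweenE; rewrite ?(covered_sub W1W) //; have := covered_dim W1W; lia.
  have cV' := proj1 (andP W1b).
  rewrite (between_const (c := - (wedge_act V' (W1 :: D') psi *+ #|F| ^ \dim V')) W1b).
    by rewrite wedge_act_eq (covered_dim cV') expnSr mulrnA mulNrn subrr.
  move=> X Xb XW1; case/andP: (Xb) => V'X XW.
  rewrite wedge_act_neq; last by rewrite eq_sym.
  have -> : (X :&: W1)%VS = V'.
    apply/esym/(covered_sub_eq V'X (covered_capl XW W1W XW1)).
    by rewrite subv_cap covered_sub.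
  congr (- _).
  have -> : wedge_act V' (W1 :: D') psi *+ #|F| ^ \dim V' =
     wedge_act V' (W1 :: D') (fun s => psi s *~ Posz (#|F| ^ \dim V')%N + 0).
    by rewrite wedge_act_lin wedge_act0 addr0.
  apply: (wedge_act_ext cV' fD) => s fs.
  by have [s' ->] := flag_head fs; rewrite wedge_act_eq addr0.
pose psi' s := psi (V' :: s).
pose H Z := wedge_act Z (W1 :: D') (fun s => wedge_act (V' :&: W1)%VS s psi').
have cW1 : covered (W1 :&: V')%VS V' := covered_cap W1W V'W nV'W1.
rewrite (eq_bigr (fun X => H (W1 :&: X)%VS)).
  rewrite (between_cap H W1W V'W dW nV'W1) capvC /H IH ?capvSr //.
  by rewrite capvC; have := covered_dim cW1; have := covered_dim W1W; lia.
move=> X Xb; case/andP: (Xb) => V'X XW.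
have W1X : W1 != X by apply: contraNneq nV'W1 => ->; apply: covered_sub.
rewrite wedge_act_neq // /H (capvC W1 X) -wedge_actN.
have cXW1 : covered (X :&: W1)%VS W1.
  by apply: covered_capr XW W1W _; rewrite eq_sym.
apply: (wedge_act_ext cXW1 fD) => s fs; have [s' ->] := flag_head fs.
rewrite wedge_act_neq; last by apply: contraNneq nV'W1 => <-; apply: capvSr.
by rewrite opprK capvA (capv_idPl (covered_sub V'X)).
Qed.

End Cochains.
End Flags.

(** * The right action of the algebra on functions on flags *)

Section RightAction.
Variables (F : finFieldType) (n : nat).
Local Notation subspace := {vspace 'rV[F]_n}.
Variables (V : subspace) (M : zmodType).
Implicit Types (A B C W X Y Z U : subspace) (D s t : seq subspace).
Implicit Types (psi : seq subspace -> M) (a b : path_mod F n) (p r : flag_path F n).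

Definition FSall psi := forall W, FS V W psi.

Definition step_act P X psi D : M :=
  if covered X P then psi (P :: D) else wedge_act P D psi.

(** The path is consumed from its left end, so a function on flags from [P] becomes one on flags
    from the last subspace: a right action. *)
Fixpoint path_act P s psi : seq subspace -> M :=
  if s is X :: s' then path_act X s' (step_act P X psi) else psi.

Lemma step_act_ext P X psi psi' D : flag_step P X -> is_flag V X D ->
  (forall s, is_flag V P s -> psi s = psi' s) -> step_act P X psi D = step_act P X psi' D.
Proof.
rewrite /flag_step /step_act => PX fD e; case: ifP PX => [XP _|_].
  by apply: e; apply: flag_cons fD.
by rewrite orbF => PX; apply: (wedge_act_ext PX fD).
Qed.

Lemma step_act_FS P X psi : flag_step P X -> FS V P psi -> FS V X (step_act P X psi).
Proof.
rewrite /flag_step; case XP: (covered X P) => /=; rewrite ?orbT ?orbF => PX fs.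
  by apply: FS_ext (FS_cons XP fs) => s _; rewrite /step_act XP.
by apply: FS_ext (wedge_act_FS PX fs) => s _; rewrite /step_act XP.
Qed.

Lemma step_act_lin P X psi psi' m :
  step_act P X (fun s => psi s *~ m + psi' s)
    = (fun s => step_act P X psi s *~ m + step_act P X psi' s).
Proof. by apply: funext => s; rewrite /step_act; case: ifP => // _; rewrite wedge_act_lin. Qed.

Lemma path_act_ext P s psi psi' D : path (@flag_step F n) P s -> is_flag V (last P s) D ->
  (forall u, is_flag V P u -> psi u = psi' u) -> path_act P s psi D = path_act P s psi' D.
Proof.
elim: s P psi psi' => [|X s IH] P psi psi' /=; first by move=> _ fD; apply.
case/andP=> PX pX fD e; apply: IH => // u fu; exact: step_act_ext.
Qed.

Lemma path_act_FS P s psi : path (@flag_step F n) P s -> FS V P psi ->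
  FS V (last P s) (path_act P s psi).
Proof.
elim: s P psi => [|X s IH] P psi //= /andP[PX pX] fs.
by apply: IH => //; apply: step_act_FS.
Qed.

Lemma path_act_lin P s psi psi' m :
  path_act P s (fun s => psi s *~ m + psi' s)
    = (fun u => path_act P s psi u *~ m + path_act P s psi' u).
Proof. by elim: s P psi psi' => [|X s IH] P psi psi' //=; rewrite step_act_lin IH. Qed.

Lemma path_act_cat P s t psi :
  path_act P (s ++ t) psi = path_act (last P s) t (path_act P s psi).
Proof. by elim: s P psi => [|X s IH] P psi //=. Qed.

Lemma path_act0 P s D : path_act P s (fun=> 0) D = 0.
Proof.
have e : (fun=> 0) = (fun s : seq subspace => 0 *~ (-1) + 0 : M).
  by apply: funext => u; rewrite mul0rz addr0.
by rewrite e path_act_lin mulrN1z addNr.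
Qed.

(** At the subspace [X] the current function lives on an empty set of flags, so it may be replaced
    by 0. *)
Lemma path_act_bad P s X psi D : path (@flag_step F n) P s -> is_flag V (last P s) D ->
  X \in P :: s -> ~~ (V <= X)%VS -> path_act P s psi D = 0.
Proof.
move=> pP fD Xs VX; elim: s P psi pP fD Xs => [|Y s IH] P psi pP fD.
  by rewrite inE => /eqP eX; move: VX; rewrite eX (flag_sub fD).
rewrite inE => /orP[/eqP eX|Xs]; last first.
  by case/andP: pP => _ pY; apply: IH.
rewrite -[RHS](path_act0 P (Y :: s) D); apply: path_act_ext => // u fu.
by move: VX; rewrite eX (flag_sub fu).
Qed.

Lemma path_act_flag W s psi : is_flag V W (W :: s) -> path_act W s psi [:: V] = psi (W :: s).
Proof.
elim: s W psi => [|X s IH] W psi; first by rewrite /is_flag /= eqxx /= => /eqP->.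
by rewrite flag_consE => /andP[XW fX] /=; rewrite IH // /step_act XW.
Qed.

(** The grading by the first subspace of the flag makes products of non-composable paths act by
    0. *)
Definition graded_act p psi D : M :=
  if head 0%VS D == path_last p then path_act (path_head p) (behead p) psi D else 0.

Lemma flag_path_head p : exists P s, [/\ path_seq p = P :: s, path (@flag_step F n) P s,
   path_head p = P & path_last p = last P s].
Proof. by case: p => [[|P s] pP] //; exists P, s. Qed.

Lemma graded_act_cat p r psi U D (e : path_last p = path_head r) : is_flag V U D ->
  graded_act (FlagPath (is_flag_path_cat e)) psi D = graded_act r (graded_act p psi) D.
Proof.
move=> fD; rewrite /graded_act path_last_cat path_head_cat.
case: eqP => // hD; have [D' eD] := flag_head fD.
have eU : U = path_last r by rewrite -hD eD.
have [P [s [ep pP hp lp]]] := flag_path_head p.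
have [Q [t [er pQ hr lr]]] := flag_path_head r.
rewrite /= ep er /= path_act_cat hp hr -lp e hr.
apply: path_act_ext => //; first by rewrite -lr -eU.
move=> u fu; have [u' ->] := flag_head fu.
by rewrite /= -hr -e eqxx.
Qed.

Lemma graded_act_neq p r psi U D : path_last p != path_head r -> is_flag V U D ->
  graded_act r (graded_act p psi) D = 0.
Proof.
move=> ne fD; rewrite {1}/graded_act; case: eqP => // hD.
have [D' eD] := flag_head fD; have eU : U = path_last r by rewrite -hD eD.
have [Q [t [er pQ hr lr]]] := flag_path_head r; rewrite er hr.
rewrite -[RHS](path_act0 Q t D); apply: path_act_ext => //; first by rewrite -lr -eU.
by move=> u fu; have [u' ->] := flag_head fu; rewrite /graded_act /= -hr eq_sym (negPf ne).
Qed.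

Definition fun_act psi a D : M := fglift (fun p => graded_act p psi D : zmodule M) a.

Lemma fun_act_basis psi p D : fun_act psi << p >> D = graded_act p psi D.
Proof. by rewrite /fun_act liftU scale1r. Qed.

Lemma fun_act_linr psi (m : int) a b D : fun_act psi (m *: a + b) D = fun_act psi a D *~ m + fun_act psi b D.
Proof. exact: (linearP (fglift (fun p => graded_act p psi D : zmodule M))). Qed.

Lemma fun_act0 psi D : fun_act psi 0 D = 0.
Proof. exact: (linear0 (fglift (fun p => graded_act p psi D : zmodule M))). Qed.

Lemma fun_actD psi a b D : fun_act psi (a + b) D = fun_act psi a D + fun_act psi b D.
Proof. by rewrite -[a in LHS]scale1r fun_act_linr. Qed.

Lemma fun_actB psi a b D : fun_act psi (a - b) D = fun_act psi a D - fun_act psi b D.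
Proof. by rewrite addrC -scaleN1r fun_act_linr mulrN1z addrC. Qed.

Lemma fun_act_sum psi (I : Type) (q : seq I) (P : pred I) (G : I -> path_mod F n) D :
  fun_act psi (\sum_(i <- q | P i) G i) D = \sum_(i <- q | P i) fun_act psi (G i) D.
Proof.
by apply: (big_morph (fun a => fun_act psi a D)) => [a b|]; rewrite ?fun_actD ?fun_act0.
Qed.

Lemma fun_actMn psi a m D : fun_act psi (a *+ m) D = fun_act psi a D *+ m.
Proof.
by elim: m => [|m IH]; rewrite ?mulr0n ?fun_act0 // !mulrS fun_actD IH.
Qed.

Lemma fun_act_linl psi psi' m a D :
  fun_act (fun s => psi s *~ m + psi' s) a D = fun_act psi a D *~ m + fun_act psi' a D.
Proof.
elim/path_mod_ind: a => [|c p a IH]; first by rewrite !fun_act0 mul0rz addr0.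
rewrite !fun_act_linr IH !fun_act_basis /graded_act; case: ifP => _; last first.
  by rewrite !mul0rz !add0r.
by rewrite path_act_lin !mulrzDl -[_ *~ m *~ c]mulrzA mulrC mulrzA !addrA;
   congr (_ + _); rewrite addrAC.
Qed.

Lemma fun_act_ext psi psi' a U D : (forall W s, is_flag V W s -> psi s = psi' s) ->
  is_flag V U D -> fun_act psi a D = fun_act psi' a D.
Proof.
move=> e fD; elim/path_mod_ind: a => [|m p a IH]; first by rewrite !fun_act0.
rewrite !fun_act_linr IH !fun_act_basis /graded_act; case: eqP => // hD.
have [D' eD] := flag_head fD; have eU : U = path_last p by rewrite -hD eD.
have [P [s [ep pP hp lp]]] := flag_path_head p; rewrite ep hp.
congr (_ *~ _ + _); apply: path_act_ext => //; first by rewrite -lp -eU.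
by move=> u; apply: e.
Qed.

Lemma fun_actM psi a b U D : is_flag V U D -> fun_act psi (a * b) D = fun_act (fun_act psi a) b D.
Proof.
move=> fD; elim/path_mod_ind: a => [|m p a IH].
  rewrite mul0r fun_act0; have -> : fun_act psi 0 = (fun=> 0) by apply: funext => s; apply: fun_act0.
  elim/path_mod_ind: b => [|c r b IHb]; first by rewrite fun_act0.
  rewrite fun_act_linr -IHb fun_act_basis /graded_act addr0.
  by case: ifP => _; rewrite ?path_act0 mul0rz.
pose P := << p >> : path_mod F n.
have -> : (m *: << p >> + a : path_mod F n) * b = m *: (P * b) + a * b.
  by rewrite mulrDl; congr (_ + _); apply: path_mulZl.
have -> : fun_act psi (m *: << p >> + a) = (fun s => graded_act p psi s *~ m + fun_act psi a s).
  by apply: funext => s; rewrite fun_act_linr fun_act_basis.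
rewrite fun_act_linr fun_act_linl IH; congr (_ *~ _ + _) => {IH}.
elim/path_mod_ind: b => [|c r b IHb]; first by rewrite mulr0 !fun_act0.
pose R := << r >> : path_mod F n.
have -> : P * (c *: << r >> + b : path_mod F n) = c *: (P * R) + P * b.
  by rewrite mulrDr; congr (_ + _); apply: path_mulZr.
rewrite !fun_act_linr IHb; congr (_ *~ _ + _); rewrite fun_act_basis.
have -> : P * R = path_concat p r by apply: path_mulU.
rewrite /path_concat; case: eqP => [e|/eqP ne].
  have -> : pbasis (p ++ behead r) = << FlagPath (is_flag_path_cat e) >>.
    by rewrite -pbasisE.
  by rewrite fun_act_basis (graded_act_cat _ _ fD).
by rewrite fun_act0 (graded_act_neq _ ne fD).
Qed.

Lemma FS_lin W psi psi' m : FS V W psi -> FS V W psi' -> FS V W (fun s => psi s *~ m + psi' s).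
Proof.
move=> fs fs' s A B t AB dB fl; rewrite big_split /= fs' // addr0 -mulrz_suml.
by rewrite fs // mul0rz.
Qed.

Lemma FS0 W : FS V W (fun=> 0 : M).
Proof. by move=> s A B t _ _ _; apply: big1. Qed.

Lemma fun_act_FS psi a : FSall psi -> FSall (fun_act psi a).
Proof.
move=> fs W; elim/path_mod_ind: a => [|m p a IH].
  by apply: FS_ext (@FS0 W) => s _; rewrite fun_act0.
apply: (@FS_ext _ _ V M W (fun s => graded_act p psi s *~ m + fun_act psi a s)).
  by move=> s _; rewrite fun_act_linr fun_act_basis.
apply: FS_lin => // {IH}.
have [P [s [ep pP hp lp]]] := flag_path_head p.
have [eW|ne] := eqVneq W (path_last p).
  rewrite eW lp; apply: FS_ext (path_act_FS pP (fs P)) => u fu.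
  by have [u' eu] := flag_head fu; rewrite /graded_act ep hp lp eu /= eqxx.
apply: FS_ext (@FS0 W) => u fu; have [u' ->] := flag_head fu.
by rewrite /graded_act /= (negPf ne).
Qed.

Lemma fun_act_pbasis psi P s D : is_flag_path (P :: s) ->
  fun_act psi (pbasis (P :: s)) D = if head 0%VS D == last P s then path_act P s psi D else 0.
Proof.
move=> Ps; rewrite -[P :: s]/(path_seq (FlagPath Ps)) pbasisE fun_act_basis.
by [].
Qed.

(** The upward (FS) relation is [wedge_act_up], the downward one is the hypothesis on [psi], and the
    wedge relations are built into [wedge_act]. *)
Lemma fun_act_rel psi x U D : FSall psi -> S_rel x -> is_flag V U D -> fun_act psi x D = 0.
Proof.
move=> fs rx fD; have [D' eD] := flag_head fD.
have hD : head 0%VS D = U by rewrite eD.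
case: rx => [A B AB dB|A B AB dB|A B cAB|A B A' AB A'B ne].
- rewrite fun_act_sum (eq_bigr (fun X => if U == B then wedge_act X D (fun E => wedge_act A E psi) else 0)).
    case: eqP => [eU|_]; last exact: big1.
    by rewrite -eU in AB dB *; apply: (wedge_act_up psi fD).
  move=> X /andP[AX XB]; rewrite fun_act_pbasis ?hD /= ?AX /= /flag_step ?AX ?XB //.
  case: eqP => // _; rewrite /step_act (covered_asym XB); congr wedge_act.
  by apply: funext => s; rewrite (covered_asym AX).
- rewrite fun_act_sum (eq_bigr (fun X => if U == A then psi [:: B, X & D] else 0)).
    case: eqP => [eU|_]; last exact: big1.
    rewrite eD eU in fD *; apply: (fs B [::]) => // C /andP[AC CB].
    by rewrite cat0s !flag_consE CB AC.
  move=> X /andP[AX XB]; rewrite fun_act_pbasis ?hD /= /flag_step ?AX ?XB ?orbT //.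
  by case: eqP => // _; rewrite /step_act AX XB.
- rewrite fun_actB fun_actMn !fun_act_pbasis //= ?hD /flag_step ?cAB ?orbT //.
  case: eqP => [eU|_]; last by rewrite mul0rn subrr.
  rewrite {1 2}/step_act cAB (covered_asym cAB) eD eU wedge_act_eq subrr; done.
rewrite fun_actD !fun_act_pbasis //= ?hD /flag_step ?AB ?A'B ?orbT //=; last first.
  by rewrite (covered_capl AB A'B ne) (covered_capr AB A'B ne) !orbT.
case: eqP => [eU|_]; last by rewrite addr0.
rewrite /step_act A'B (covered_asym AB) eD eU wedge_act_neq; last by rewrite eq_sym.
rewrite (covered_asym (covered_capr AB A'B ne)).
have -> : (fun D0 => if covered (A :&: A')%VS A then psi (A :: D0) else wedge_act A D0 psi)
   = (fun D0 => psi (A :: D0)) by apply: funext => s; rewrite (covered_capl AB A'B ne).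
by rewrite addNr.
Qed.

(** [psi] varies in the induction: a left factor [a] replaces it by [fun_act psi a], which is why
    the action has to preserve (FS). *)
Lemma fun_act_ideal psi x U D :
  ideal_gen (@S_rel F n) x -> FSall psi -> is_flag V U D -> fun_act psi x D = 0.
Proof.
move=> ix; elim: ix psi U D => {x} [x rx||x y _ IHx _ IHy|a x _ IH|a x _ IH] psi U D fs fD.
- exact: fun_act_rel fD.
- exact: fun_act0.
- by rewrite fun_actB (IHx _ _ _ fs fD) (IHy _ _ _ fs fD) subrr.
- by rewrite (fun_actM _ _ _ fD) (IH _ U) //; apply: fun_act_FS.
rewrite (fun_actM _ _ _ fD) (@fun_act_ext _ (fun=> 0) _ U) //; last first.
  by move=> W s; apply: IH.
elim/path_mod_ind: a {IH} => [|m p a IHa]; first exact: fun_act0.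
rewrite fun_act_linr IHa fun_act_basis /graded_act addr0.
by case: ifP => _; rewrite ?path_act0 mul0rz.
Qed.

(** A path ending at [V] turns [psi] into a function on the flags from [V] to [V], and [:: V] is the
    only one. *)
Definition S_eval psi (x : S_alg F n) : M := fun_act psi (of_rquot x) [:: V].

Variable psi : seq subspace -> M.
Hypothesis psi_FS : FSall psi.

Lemma S_evalE a : S_eval psi (to_rquot _ a) = fun_act psi a [:: V].
Proof.
apply/eqP; rewrite -subr_eq0 -fun_actB; apply/eqP; apply: fun_act_ideal psi_FS (flag_last V).
by apply/to_rquotE; rewrite of_rquotK.
Qed.

Lemma S_evalB : zmod_morphism (S_eval psi).
Proof.
elim/to_rquotW=> x; elim/to_rquotW=> y.
by rewrite -(rmorphB (to_rquot _)) !S_evalE fun_actB.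
Qed.

Lemma S_eval_path P s : path (@flag_step F n) P s ->
  S_eval psi (S_path (P :: s)) = if V == last P s then path_act P s psi [:: V] else 0.
Proof. by move=> Ps; rewrite /S_path S_evalE fun_act_pbasis. Qed.

Lemma S_eval_flag W s : is_flag V W s -> S_eval psi (S_path s) = psi s.
Proof.
move=> fs; have [s' es] := flag_head fs; rewrite es in fs *.
have pW : path (@flag_step F n) W s'.
  case/and3P: fs => _ + _; apply: sub_path => X Y.
  by rewrite /flag_step orbC => ->.
rewrite S_eval_path // path_act_flag //.
by case/and3P: fs => _ _ /eqP->; rewrite eqxx.
Qed.

Lemma S_eval_bad p X : X \in (p : seq subspace) -> ~~ (V <= X)%VS -> S_eval psi (S_path p) = 0.
Proof.
have [P [s [ep pP hp lp]]] := flag_path_head p; rewrite ep => Xp VX.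
rewrite S_eval_path //; case: eqP => // eV; apply: path_act_bad Xp VX => //.
by rewrite -eV flag_last.
Qed.

End RightAction.

(** * Standard modules *)

Section StandardModule.
Variables (F : finFieldType) (n : nat).
Local Notation subspace := {vspace 'rV[F]_n}.
Implicit Types (A B C W X Y Z U : subspace) (D s t : seq subspace).

Lemma is_flag_path_split s X t : is_flag_path (s ++ X :: t) =
  is_flag_path (rcons s X) && is_flag_path (X :: t).
Proof. by case: s => [|Y s] //=; rewrite cat_path rcons_path /= andbA. Qed.

Lemma pbasis_split s X t : is_flag_path (s ++ X :: t) ->
  pbasis (s ++ X :: t) = pbasis (rcons s X) * pbasis (X :: t) :> path_mod F n.
Proof.
rewrite is_flag_path_split => /andP[p1 p2].
rewrite -[rcons s X]/(path_seq (FlagPath p1)) -[X :: t in RHS]/(path_seq (FlagPath p2)).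
rewrite !pbasisE -[_ * _]/(path_mul _ _) path_mulU /path_concat /path_last /path_head /=.
by rewrite last_rcons eqxx -cats1 -catA.
Qed.

Lemma S_path_split s X t : is_flag_path (s ++ X :: t) ->
  S_path (s ++ X :: t) = S_path (rcons s X) * S_path (X :: t).
Proof. by move=> p; rewrite /S_path -rmorphM /= pbasis_split. Qed.

Lemma S_path_mul0 P s Q t : last P s != Q -> S_path (P :: s) * S_path (Q :: t) = 0.
Proof.
move=> ne; rewrite /S_path -rmorphM /=.
have [p1|/pbasisPn ->] := boolP (is_flag_path (P :: s)); last by rewrite mul0r raddf0.
have [p2|/pbasisPn ->] := boolP (is_flag_path (Q :: t)); last by rewrite mulr0 raddf0.
rewrite -[P :: s]/(path_seq (FlagPath p1)) -[Q :: t]/(path_seq (FlagPath p2)).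
rewrite !pbasisE -[_ * _]/(path_mul _ _) path_mulU /path_concat /path_last /path_head /=.
by rewrite (negPf ne) raddf0.
Qed.

Lemma S_path_rel (a : path_mod F n) : S_rel a -> to_rquot (@S_rel F n) a = 0.
Proof.
move=> ra; rewrite -(raddf0 (to_rquot (@S_rel F n))); apply/to_rquotE.
by rewrite subr0; apply: ideal_gen_rel.
Qed.

Lemma S_path_eq X W : covered X W -> S_path [:: X; W; X] = S_path [:: X] *+ (#|F| ^ \dim X).
Proof.
move=> XW; apply/eqP; rewrite -subr_eq0 /S_path -raddfMn -raddfB /=.
by rewrite S_path_rel //; apply: S_rel_wedge_eq.
Qed.

Lemma S_path_neq X W X' : covered X W -> covered X' W -> X != X' ->
  S_path [:: X; W; X'] = - S_path [:: X; (X :&: X')%VS; X'].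
Proof.
move=> XW X'W ne; apply/eqP; rewrite -subr_eq0 opprK /S_path -raddfD /=.
by rewrite S_path_rel //; apply: S_rel_wedge_neq.
Qed.

Variable V : subspace.

Lemma flag_is_path W s : is_flag V W s -> is_flag_path s.
Proof.
case: s => //= X s /and3P[_ + _]; apply: sub_path => Y Z.
by rewrite /flag_step orbC => ->.
Qed.

Lemma flag_is_path_cons W P s : flag_step P W -> is_flag V W s -> is_flag_path (P :: s).
Proof.
move=> PW fs; have := flag_is_path fs; have [s' ->] := flag_head fs => /= ->.
by rewrite PW.
Qed.

Lemma flag_rcons W s : is_flag V W s -> exists s', s = rcons s' V.
Proof.
move=> fs; elim/flag_ind: W s / fs => [|W X D _ _ [s' ->]]; first by exists [::].
by exists (W :: s').
Qed.

(** Counterpart of [wedge_act] inside the algebra: a step up is pushed down the flag until it meets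
    an equal subspace. [V <= Y] keeps the intersections above [V], and so guarantees that this
    happens. *)
Lemma S_path_wedge Y X D : (V <= Y)%VS -> covered Y X -> is_flag V X D ->
  exists E c, is_flag V Y E /\ S_path (Y :: D) = S_path E *~ c.
Proof.
move=> VY YX fD; elim/flag_ind: X D / fD Y VY YX => [|W X D XW fD IH] Y VY YX.
  by have := dimvS VY; rewrite (covered_dim YX) ltnn.
have [D' eD] := flag_head fD.
have fW := flag_cons XW fD; have pYW : is_flag_path [:: Y, W & D].
  by apply: (flag_is_path_cons _ fW); rewrite /flag_step YX.
have pXD := flag_is_path fD.
have e : S_path [:: Y, W & D] = S_path [:: Y; W; X] * S_path D.
  by have := @S_path_split [:: Y; W] X D'; rewrite eD in pYW *; apply.
have [eYX|ne] := eqVneq Y X.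
  exists D, (#|F| ^ \dim Y)%N; rewrite e eYX; split=> //.
  rewrite S_path_eq // mulrnAl; congr (_ *+ _).
  by have := @S_path_split [::] X D'; rewrite eD in pXD *; move=> /(_ pXD) <-.
have cY := covered_capl YX XW ne; have cX := covered_capr YX XW ne.
have VYX : (V <= Y :&: X)%VS by rewrite subv_cap VY (flag_sub fD).
have [E [c [fE eE]]] := IH _ VYX cX.
exists (Y :: E), (- c); split; first exact: flag_cons fE.
rewrite e S_path_neq // mulNr mulrNz; congr (- _).
have [E' eE'] := flag_head fE.
have pYE : is_flag_path (Y :: E) by apply: (flag_is_path_cons _ fE); rewrite /flag_step cY orbT.
have pYXD : is_flag_path [:: Y, (Y :&: X)%VS & D].
  rewrite eD /= in pXD *; by rewrite /flag_step cY cX !orbT.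
transitivity (S_path [:: Y, (Y :&: X)%VS & D]).
  by have := @S_path_split [:: Y; (Y :&: X)%VS] X D'; rewrite eD in pYXD *; move=> /(_ pYXD) ->.
have := @S_path_split [:: Y] (Y :&: X)%VS D; rewrite /= in pYXD *; move=> /(_ pYXD) ->.
rewrite eE mulrzAr; congr (_ *~ _).
by have := @S_path_split [:: Y] (Y :&: X)%VS E'; rewrite eE' in pYE *; move=> /(_ pYE) ->.
Qed.

Local Notation cls := (Delta_class V).

Lemma proj_ofB : zmod_morphism (proj_of V).
Proof. by move=> x y; apply: val_inj; rewrite /= mulrBl. Qed.
HB.instance Definition _ :=
  GRing.isZmodMorphism.Build (S_alg F n) (proj_mod V) (proj_of V) proj_ofB.

Lemma Delta_class_scale a s : a *: cls s = to_quot (@bad_pred F n V) (proj_of V (a * S_path s)).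
Proof.
rewrite /Delta_class -linearZ; congr to_quot.
by apply: val_inj; rewrite /= -mulrA.
Qed.

Lemma proj_of_path0 P s : last P s != V -> proj_of V (S_path (P :: s)) = 0.
Proof. by move=> ne; apply: val_inj; rewrite /= /S_idem S_path_mul0. Qed.

Lemma Delta_class_bad P s X : is_flag_path (P :: s) -> X \in P :: s -> ~~ (V <= X)%VS ->
  cls (P :: s) = 0.
Proof.
move=> ps Xs VX; rewrite /Delta_class.
have [e|ne] := eqVneq (last P s) V; last by rewrite proj_of_path0 // raddf0.
rewrite -(raddf0 (to_quot (@bad_pred F n V))); apply/to_quotE/asboolP.
rewrite subr0 /= /S_idem.
have -> : S_path (P :: s) * S_path [:: V] = S_path (FlagPath ps).
  have eb : P :: s = rcons (belast P s) V by rewrite -e -lastI.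
  by have := @S_path_split (belast P s) V [::]; rewrite cats1 -eb => /(_ ps) <-.
by apply: zspan_gen; apply: (@BadPath _ _ _ (FlagPath ps) X).
Qed.

(** Straightening from the right end: a step down extends the flag, a step up is absorbed by
    [S_path_wedge], and a subspace not containing [V] kills the class. *)
Lemma Delta_class_path P s : is_flag_path (P :: s) ->
  cls (P :: s) = 0 \/ exists E c, is_flag V P E /\ cls (P :: s) = cls E *~ c.
Proof.
elim: s P => [|X s IH] P ps.
  have [<-|ne] := eqVneq P V; last by left; rewrite /Delta_class proj_of_path0 ?raddf0.
  right; exists [:: P], 1; split=> //.
  by rewrite /is_flag /= !eqxx.
have pX : is_flag_path (X :: s) by case/andP: ps.
have PX : flag_step P X by case/andP: ps.
have e t : is_flag_path [:: P, X & t] -> cls [:: P, X & t] = S_path [:: P; X] *: cls (X :: t).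
  move=> pt; rewrite Delta_class_scale /Delta_class; congr (to_quot _ (proj_of _ _)).
  exact: (@S_path_split [:: P] X t).
have [e0|[E [c [fE eE]]]] := IH _ pX; first by left; rewrite e // e0 scaler0.
have eP : cls [:: P, X & s] = cls (P :: E) *~ c.
  have [E' eE'] := flag_head fE.
  rewrite e // eE raddfMz /= eE' -e // -eE'; exact: flag_is_path_cons fE.
have pPE := flag_is_path_cons PX fE.
have [VP|VP] := boolP (V <= P)%VS; last first.
  by left; rewrite eP (Delta_class_bad pPE _ VP) ?mul0rz // mem_head.
right; case/orP: PX => [PX|XP].
  have [E1 [c1 [fE1 e1]]] := S_path_wedge VP PX fE.
  exists E1, (c1 * c); split=> //; rewrite eP mulrzA; congr (_ *~ _).
  by rewrite /Delta_class e1 raddfMz raddfMz.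
by exists (P :: E), c; split=> //; apply: flag_cons fE.
Qed.

Lemma Delta_ind (Q : Delta V -> Prop) : Q 0 ->
  (forall W s c x, is_flag V W s -> Q x -> Q (cls s *~ c + x)) -> forall x, Q x.
Proof.
move=> Q0 QS; elim/to_quotW=> -[y yP]; have /asboolP[s es] := yP.
have -> : ProjMod yP = proj_of V s by apply: val_inj.
elim/S_alg_ind: s {y yP es} => [|m p a IH]; first by rewrite !raddf0.
rewrite !raddfD !raddfMz /= -[to_quot _ (proj_of V (S_path p))]/(cls p).
have [P [s [ep pP hp lp]]] := flag_path_head p; rewrite ep.
have [->|[E [c [fE ->]]]] := @Delta_class_path P s pP; first by rewrite mul0rz add0r.
by rewrite -mulrzA; apply: QS fE IH.
Qed.

Lemma Delta_class_FS : FSall V cls.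
Proof.
move=> W s A B t AB dB fl; rewrite /Delta_class -(raddf_sum (to_quot (@bad_pred F n V))).
rewrite -(raddf_sum (proj_of V)).
rewrite (eq_bigr (fun C => S_path (rcons s B) * (S_path [:: B; C; A] * S_path (A :: t)))).
  rewrite -mulr_sumr -mulr_suml -raddf_sum /=.
  by rewrite S_path_rel ?mul0r ?mulr0 ?raddf0 //; apply: S_rel_FS_down.
move=> C Cb; have /flag_is_path p := fl _ Cb.
rewrite (S_path_split p); congr (_ * _).
move: p; rewrite is_flag_path_split => /andP[_ p].
exact: (@S_path_split [:: B; C] A t p).
Qed.

Section Evaluation.
Variables (M : zmodType) (psi : seq subspace -> M).
Hypothesis psi_FS : FSall V psi.

Definition Delta_eval (x : Delta V) : M := S_eval V psi (proj_val (of_quot x)).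

Lemma S_eval_zspan x : zspan (@bad_path F n V) x -> S_eval V psi x = 0.
Proof.
elim=> [{}x [p X _ Xp VX]||u v _ Hu _ Hv].
- exact: S_eval_bad Xp VX.
- by have := S_evalB psi_FS 0 0; rewrite subr0 subrr.
- by rewrite S_evalB // Hu Hv subrr.
Qed.

Lemma Delta_evalE y : Delta_eval (to_quot _ y) = S_eval V psi (proj_val y).
Proof.
apply/eqP; rewrite -subr_eq0 -S_evalB //; apply/eqP/S_eval_zspan.
have /to_quotE/asboolP // : to_quot (@bad_pred F n V) (of_quot (to_quot (@bad_pred F n V) y))
  = to_quot (@bad_pred F n V) y by rewrite of_quotK.
Qed.

Lemma Delta_evalB : zmod_morphism Delta_eval.
Proof.
elim/to_quotW=> x; elim/to_quotW=> y.
by rewrite -to_quotB !Delta_evalE /= S_evalB.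
Qed.

Lemma S_path_idemr W s : is_flag V W s -> S_path s * S_idem V = S_path s.
Proof.
move=> fs; have p := flag_is_path fs; have [s' es] := flag_rcons fs.
rewrite es in p *; rewrite /S_idem.
by have := @S_path_split s' V [::]; rewrite cats1 => /(_ p) <-.
Qed.

Lemma Delta_eval_class W s : is_flag V W s -> Delta_eval (cls s) = psi s.
Proof.
by move=> fs; rewrite Delta_evalE /= (S_path_idemr fs) (S_eval_flag psi_FS fs).
Qed.

End Evaluation.

Section BaseChange.
Variable k : fieldType.
Local Notation clsk := (flag_class_k V k).

Lemma tens_mkMz (m : Delta V) c : tens_mk k (m *~ c) = c%:~R *: tens_mk k m.
Proof.
pose f : {additive Delta V -> tens k (Delta V)} :=
  HB.pack (@tens_mk k (Delta V)) (GRing.isZmodMorphism.Build _ _ _ (@tens_mkB k (Delta V))).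
by rewrite -[LHS]/(f _) raddfMz scaler_int.
Qed.

Lemma Delta_k_ind (Q : Delta_k V k -> Prop) : Q 0 ->
  (forall a W s x, is_flag V W s -> Q x -> Q (a *: clsk s + x)) -> forall x, Q x.
Proof.
move=> Q0 QS; elim/tens_ind=> // a m; elim/Delta_ind: m a => [|W s c m fs IH] a x Qx.
  have -> : tens_mk k (0 : Delta V) = 0.
    by have := @tens_mkB k (Delta V) 0 0; rewrite !subrr.
  by rewrite scaler0 add0r.
rewrite tens_mkD tens_mkMz scalerDr scalerA -addrA.
by apply: QS fs (IH _ _ Qx).
Qed.

Lemma flag_class_k_FS : FSall V clsk.
Proof.
move=> W s A B t AB dB fl.
pose f : {additive Delta V -> tens k (Delta V)} :=
  HB.pack (@tens_mk k (Delta V)) (GRing.isZmodMorphism.Build _ _ _ (@tens_mkB k (Delta V))).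
by rewrite -[LHS](raddf_sum f) (Delta_class_FS AB dB fl) raddf0.
Qed.

Definition Delta_k_eval (N : lmodType k) (psi : seq subspace -> N) (x : Delta_k V k) : N :=
  tens_lift (Delta_eval psi) x.

Lemma Delta_k_eval_linear (N : lmodType k) (psi : seq subspace -> N) :
  FSall V psi -> linear (Delta_k_eval psi).
Proof. by move=> fs; apply: tens_lift_linear; apply: Delta_evalB. Qed.

Lemma Delta_k_eval_class (N : lmodType k) (psi : seq subspace -> N) W s :
  FSall V psi -> is_flag V W s -> Delta_k_eval psi (clsk s) = psi s.
Proof.
move=> psi_FS fs; rewrite /Delta_k_eval tens_lift_mk; last exact: Delta_evalB.
exact: Delta_eval_class fs.
Qed.

Lemma idem_class W U s : is_flag V U s ->
  Sk_act (idem_k k W) (clsk s) = if U == W then clsk s else 0.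
Proof.
move=> fs; rewrite Sk_act_mk Delta_class_scale.
have [s' es] := flag_head fs; rewrite es in fs *.
case: eqP => [<-|/eqP ne]; last first.
  rewrite /S_idem S_path_mul0 /= 1?eq_sym // !raddf0.
  by have := @tens_mkB k (Delta V) 0 0; rewrite !subrr.
congr (tens_mk _ (to_quot _ (proj_of _ _))).
exact/esym/(@S_path_split [::] U s')/(flag_is_path fs).
Qed.

Lemma Sk_act0 (a : S_k F n k) : Sk_act a (0 : Delta_k V k) = 0.
Proof. by have := Sk_act_linear a (-1) 0 (0 : Delta_k V k); rewrite scaler0 addr0 scaleN1r addNr. Qed.

Lemma Delta_wt_ind W (Q : Delta_k V k -> Prop) : Q 0 ->
    (forall a s x, is_flag V W s -> Q x -> Q (a *: clsk s + x)) ->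
  forall x, x \in @Delta_wt_pred F n V k W -> Q x.
Proof.
move=> Q0 QS x /asboolP[y ->]; elim/Delta_k_ind: y => [|a U s y fs IH].
  by rewrite Sk_act0.
rewrite Sk_act_linear (idem_class W fs); case: eqP => [eU|_]; last by rewrite scaler0 add0r.
by apply: QS IH; rewrite -eU.
Qed.

Lemma flag_class_wt W s : is_flag V W s -> clsk s \in @Delta_wt_pred F n V k W.
Proof. by move=> fs; apply/asboolP; exists (clsk s); rewrite (idem_class W fs) eqxx. Qed.

Lemma Delta_wt_id W x : x \in @Delta_wt_pred F n V k W -> Sk_act (idem_k k W) x = x.
Proof.
elim/Delta_wt_ind: x / => [|a s x fs IH]; first exact: Sk_act0.
by rewrite Sk_act_linear (idem_class W fs) eqxx IH.
Qed.

End BaseChange.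
End StandardModule.

(** * The bilinear form *)

Section Reversal.
Variables (F : finFieldType) (n : nat).
Local Notation subspace := {vspace 'rV[F]_n}.
Local Notation pathmod := (path_mod F n).

(** Reversal is an anti-automorphism: it exchanges the two (FS) relations and preserves the wedge
    relations. It moves the second argument of the form to the left of a product and yields the
    symmetry of the form. *)
Definition path_rev (a : pathmod) : pathmod :=
  fglift (fun p : flag_path F n => pbasis (rev p) : pathmod) a.

Lemma path_rev_lin (m : int) a b : path_rev (m *: a + b) = m *: path_rev a + path_rev b.
Proof. exact: (linearP (fglift (fun p : flag_path F n => pbasis (rev p) : pathmod))). Qed.

Lemma path_rev0 : path_rev 0 = 0.
Proof. exact: (linear0 (fglift (fun p : flag_path F n => pbasis (rev p) : pathmod))). Qed.

Lemma path_revB : zmod_morphism path_rev.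
Proof. by move=> a b; rewrite -scaleN1r addrC path_rev_lin scaleN1r addrC. Qed.
HB.instance Definition _ := GRing.isZmodMorphism.Build pathmod pathmod path_rev path_revB.

Lemma is_flag_path_rev (s : seq subspace) : is_flag_path (rev s) = is_flag_path s.
Proof.
case: s => // P s; rewrite [in LHS]lastI rev_rcons /=.
have -> : path (@flag_step F n) (last P s) (rev (belast P s)) = path (@flag_step F n) P s.
  by rewrite rev_path; apply: eq_path => X Y; rewrite /flag_step orbC.
by [].
Qed.

Lemma path_rev_pbasis s : path_rev (pbasis s) = pbasis (rev s).
Proof.
have [ps|ns] := boolP (is_flag_path s); last by rewrite !pbasisPn ?is_flag_path_rev ?path_rev0.
by rewrite -[s]/(path_seq (FlagPath ps)) pbasisE /path_rev liftU scale1r.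
Qed.

Lemma path_revM a b : path_rev (a * b) = path_rev b * path_rev a.
Proof.
elim/path_mod_ind: a => [|m p a IH]; first by rewrite mul0r path_rev0 mulr0.
pose P := << p >> : pathmod.
have -> : (m *: P + a : pathmod) * b = m *: (P * b) + a * b.
  by rewrite mulrDl; congr (_ + _); apply: path_mulZl.
rewrite !path_rev_lin IH mulrDr; congr (_ + _).
have -> : path_rev b * (m *: path_rev P) = m *: (path_rev b * path_rev P) by apply: path_mulZr.
congr (_ *: _) => {IH a}.
elim/path_mod_ind: b => [|c r b IH]; first by rewrite mulr0 path_rev0 mul0r.
pose R := << r >> : pathmod.
have -> : P * (c *: R + b : pathmod) = c *: (P * R) + P * b.
  by rewrite mulrDr; congr (_ + _); apply: path_mulZr.
rewrite !path_rev_lin IH mulrDl; congr (_ + _).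
have -> : (c *: path_rev R) * path_rev P = c *: (path_rev R * path_rev P) by apply: path_mulZl.
congr (_ *: _) => {IH b}.
have -> : P * R = path_concat p r by apply: path_mulU.
rewrite /P /R -!pbasisE !path_rev_pbasis.
have pr : is_flag_path (rev p) by rewrite is_flag_path_rev path_seqP.
have rr : is_flag_path (rev r) by rewrite is_flag_path_rev path_seqP.
rewrite -[rev p]/(path_seq (FlagPath pr)) -[rev r]/(path_seq (FlagPath rr)) !pbasisE.
rewrite -[_ * _]/(path_mul _ _) path_mulU.
have [X [s [ep _ hp lp]]] := flag_path_head p; have [Y [t [er _ hr lr]]] := flag_path_head r.
have lrr : path_last (FlagPath rr) = path_head r.
  by rewrite /path_last /= er rev_cons last_rcons hr.
have hpp : path_head (FlagPath pr) = path_last p.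
  by rewrite /path_head /= ep lastI rev_rcons lp.
rewrite /path_concat lrr hpp eq_sym; case: eqP => e; last by rewrite path_rev0.
rewrite path_rev_pbasis /= ep er rev_cat /= lastI rev_rcons /= rev_cons -cats1 -catA /=.
by rewrite -lp -e hr.
Qed.

Lemma path_rev_rel (a : pathmod) : S_rel a -> S_rel (path_rev a).
Proof.
case=> [A B AB dB|A B AB dB|A B cAB|A B A' AB A'B ne].
- by rewrite raddf_sum (eq_bigr _ (fun i _ => path_rev_pbasis _)); apply: S_rel_FS_down.
- by rewrite raddf_sum (eq_bigr _ (fun i _ => path_rev_pbasis _)); apply: S_rel_FS_up.
- by rewrite raddfB raddfMn /= !path_rev_pbasis; apply: S_rel_wedge_eq.
rewrite raddfD /= !path_rev_pbasis capvC; apply: S_rel_wedge_neq => //.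
by rewrite eq_sym.
Qed.

Lemma path_rev_ideal a : ideal_gen (@S_rel F n) a -> ideal_gen (@S_rel F n) (path_rev a).
Proof.
elim=> {a} [a ra||a b _ Ha _ Hb|a b _ H|a b _ H].
- exact/ideal_gen_rel/path_rev_rel.
- rewrite path_rev0; exact: ideal_gen0.
- rewrite raddfB; exact: ideal_genB.
- rewrite path_revM; exact: ideal_genMr.
by rewrite path_revM; apply: ideal_genMl.
Qed.

Definition S_rev (x : S_alg F n) : S_alg F n := to_rquot (@S_rel F n) (path_rev (of_rquot x)).

Lemma S_revE a : S_rev (to_rquot _ a) = to_rquot _ (path_rev a).
Proof.
apply/to_rquotE; rewrite -raddfB /=; apply: path_rev_ideal.
by apply/to_rquotE; rewrite of_rquotK.
Qed.

Lemma S_revB : zmod_morphism S_rev.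
Proof.
elim/to_rquotW=> x; elim/to_rquotW=> y.
by rewrite -(rmorphB (to_rquot _)) !S_revE raddfB rmorphB.
Qed.
HB.instance Definition _ := GRing.isZmodMorphism.Build (S_alg F n) (S_alg F n) S_rev S_revB.

Lemma S_revM x y : S_rev (x * y) = S_rev y * S_rev x.
Proof.
elim/to_rquotW: x => x; elim/to_rquotW: y => y.
by rewrite -rmorphM !S_revE /= path_revM -rmorphM.
Qed.

Lemma S_rev_path s : S_rev (S_path s) = S_path (rev s).
Proof. by rewrite /S_path S_revE path_rev_pbasis. Qed.

End Reversal.

(** * Existence and values of the form on flags *)

Section Form.
Variables (F : finFieldType) (n : nat).
Local Notation subspace := {vspace 'rV[F]_n}.
Variable V : subspace.
Implicit Types (A B C W X Y Z U : subspace) (D s t : seq subspace).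
Local Notation cls := (Delta_class V).

Definition unit_cochain D : int := (D == [:: V])%:R.

Lemma unit_cochain_FS : FSall V unit_cochain.
Proof.
move=> W s A B t _ _ _; apply: big1 => C _; rewrite /unit_cochain.
by case: s => [|X s] //=; case: eqP => // -[_]; case: s.
Qed.
Local Notation eval0 := (S_eval V unit_cochain).

(** [eval0] reads off the coefficient of (V); in particular (V) has infinite order in the
    algebra. *)
Lemma eval0_idem m : eval0 (S_idem V *~ m) = m.
Proof.
pose f : {additive S_alg F n -> int} :=
  HB.pack eval0 (GRing.isZmodMorphism.Build _ _ _ (S_evalB unit_cochain_FS)).
rewrite -[LHS]/(f _) raddfMz /= (S_eval_flag unit_cochain_FS (flag_last V)).
by rewrite /unit_cochain eqxx intz.
Qed.

(** Value of the form on two flags: the steps of the reversed flag [t], all upward, act on the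
    indicator of [:: V]. *)
Fixpoint flag_pair t : seq subspace -> int :=
  if t is W :: t1 then
    if t1 is W1 :: _ then fun D => wedge_act W1 D (flag_pair t1) else unit_cochain
  else unit_cochain.

Lemma fun_act_rev_flag W s t : is_flag V W s -> is_flag V W t ->
  fun_act unit_cochain (pbasis (rev t)) s = flag_pair t s.
Proof.
move=> fs ft; elim/flag_ind: W t / ft s fs => [|W X D XW fD IH] s fs; have [s' es] := flag_head fs.
  by rewrite fun_act_pbasis //= es /= eqxx.
have [D' eD] := flag_head fD.
have p : is_flag_path (rev [:: W, X & D']).
  by rewrite is_flag_path_rev -eD; apply: (flag_is_path_cons _ fD); rewrite /flag_step XW orbT.
rewrite eD !rev_cons -cats1 cat_rcons in p *; rewrite (pbasis_split p) -rev_cons.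
rewrite (fun_actM _ _ _ fs) fun_act_pbasis /= /flag_step ?XW // es eqxx -es.
rewrite /step_act (covered_asym XW); apply: (wedge_act_ext XW fs) => u fu.
by rewrite -eD IH // eD.
Qed.

(* All subspaces that occur in the product contain V, so it is a multiple of (V). *)
Lemma flag_product W s t : is_flag V W s -> is_flag V W t ->
  S_path (rev t) * S_path s = S_idem V *~ flag_pair t s.
Proof.
(* Any multiple will do: applying [eval0] identifies it with [flag_pair t s]. *)
move=> fs ft; suff [c ec] : exists c, S_path (rev t) * S_path s = S_idem V *~ c.
  rewrite ec; congr (_ *~ _); rewrite -(eval0_idem c) -ec /S_path -rmorphM /=.
  rewrite S_evalE; last exact: unit_cochain_FS.
  rewrite (fun_actM _ _ _ (flag_last V)) -(S_evalE (fun_act_FS _ unit_cochain_FS)).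
  by rewrite -/(S_path s) (S_eval_flag (fun_act_FS _ unit_cochain_FS) fs) (fun_act_rev_flag fs ft).
elim/flag_ind: W t / ft s fs => [|W X D XW fD IH] s fs.
  exists 1; have [s' es] := flag_head fs; rewrite es in fs *.
  have e : s' = [::].
    case: s' {es} fs => // Y s'; rewrite flag_consE => /andP[YV /flag_sub VY].
    by have := dimvS VY; rewrite (covered_dim YV) ltnn.
  by rewrite e; have := @S_path_split F n [::] V [::] isT; rewrite /= => <-.
have VX := flag_sub fD; have [D' eD] := flag_head fD.
have [s' es] := flag_head fs.
have [E [c [fE eE]]] := S_path_wedge VX XW fs.
have [c' ec'] := IH _ fE.
have pXW : flag_step X W by rewrite /flag_step XW.
have p1 : is_flag_path (rev [:: W, X & D']).
  rewrite is_flag_path_rev -eD; apply: (flag_is_path_cons _ fD).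
  by rewrite /flag_step XW orbT.
have p2 := flag_is_path_cons pXW fs; rewrite es in p2.
rewrite !rev_cons -cats1 cat_rcons in p1.
exists (c' * c); rewrite mulrzA -ec' -mulrzAr -eE eD es !rev_cons.
rewrite -[in LHS](cats1 _ W) cat_rcons (S_path_split p1) -mulrA; congr (_ * _).
by have := @S_path_split F n [:: X] W s' p2.
Qed.

Lemma flag_product0 W U s t : is_flag V W s -> is_flag V U t -> U != W ->
  S_path (rev t) * S_path s = 0.
Proof.
move=> fs ft ne; have [t' et] := flag_head ft; have [s' es] := flag_head fs.
rewrite et es; case er: (rev (U :: t')) => [|P r].
  by move/(congr1 size): er; rewrite size_rev.
by apply: S_path_mul0; move/(congr1 (last 0%VS)): er; rewrite rev_cons last_rcons /= => <-.
Qed.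

Let rep (x : Delta V) : S_alg F n := proj_val (of_quot x).

Lemma eval0_zspan_l a x : zspan (@bad_path F n V) x -> eval0 (a * x) = 0.
Proof. by move=> bx; apply: S_eval_zspan unit_cochain_FS _ (bad_left_stable a bx). Qed.

Lemma eval0_zspan_r a x : zspan (@bad_path F n V) x -> eval0 (S_rev x * a) = 0.
Proof.
pose f : {additive S_alg F n -> int} :=
  HB.pack eval0 (GRing.isZmodMorphism.Build _ _ _ (S_evalB unit_cochain_FS)).
rewrite -[eval0 _]/(f _); elim=> {x} [x bx||x y _ Hx _ Hy].
- case: bx => p X _ Xp VX; rewrite S_rev_path.
  elim/S_alg_ind: a => [|m r a IH]; first by rewrite mulr0 raddf0.
  rewrite mulrDr mulrzAr raddfD raddfMz IH addr0.
  have pr : is_flag_path (rev p) by rewrite is_flag_path_rev path_seqP.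
  suff -> : f (S_path (rev p) * S_path r) = 0 by rewrite mul0rz.
  have [P [s [ep _ _ _]]] := flag_path_head r; have [X1 [s1 [ep1 _ _ _]]] := flag_path_head (FlagPath pr).
  rewrite /= in ep1.
  have [e|ne] := eqVneq (last X1 s1) P; last by rewrite ep1 ep S_path_mul0 ?raddf0.
  have e2 : rev p = rcons (belast X1 s1) P by rewrite ep1 lastI e.
  have pc : is_flag_path (belast X1 s1 ++ P :: s).
    by rewrite is_flag_path_split -e2 pr -ep path_seqP.
  rewrite e2 ep -(S_path_split pc).
  apply: (@S_eval_bad _ _ _ _ _ unit_cochain_FS (FlagPath pc) X) VX => /=.
  by rewrite -cat_rcons mem_cat -e2 mem_rev Xp.
- by rewrite raddf0 mul0r raddf0.
by rewrite (raddfB (@S_rev F n)) mulrBl (raddfB f) Hx Hy subrr.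
Qed.

Lemma rep_zspan y : zspan (@bad_path F n V) (rep (to_quot _ y) - proj_val y).
Proof.
have /to_quotE/asboolP // : to_quot (@bad_pred F n V) (of_quot (to_quot (@bad_pred F n V) y))
  = to_quot (@bad_pred F n V) y by rewrite of_quotK.
Qed.

Lemma repB_zspan x y : zspan (@bad_path F n V) (rep x - rep y - rep (x - y)).
Proof.
elim/to_quotW: x => x; elim/to_quotW: y => y; rewrite -to_quotB.
have key (a b c u v : S_alg F n) : a - b - c = (a - u) - (b - v) - (c - (u - v)).
  have -> : (a - u) - (b - v) = (a - b) - (u - v) by rewrite !opprD !opprK addrACA.
  by rewrite (opprB c) subrKA.
rewrite (key _ _ _ (proj_val x) (proj_val y)).
by apply: zspanB; [apply: zspanB|]; apply: rep_zspan.
Qed.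

(** [flag_form] is a chosen function, so a form with the defining property has to be exhibited. The
    product of a reversed and a plain representative, evaluated by [eval0], is insensitive to bad
    paths on either side. *)
Lemma flag_form_spec : is_flag_form (@flag_form F n V).
Proof.
rewrite /flag_form; apply: (@xgetPex _ (fun _ _ => 0) [set f | is_flag_form f]%classic).
pose f : {additive S_alg F n -> int} :=
  HB.pack eval0 (GRing.isZmodMorphism.Build _ _ _ (S_evalB unit_cochain_FS)).
exists (fun x y => eval0 (S_rev (rep y) * rep x)); split.
  split=> [x y z|y x z]; apply/eqP; rewrite eq_sym -subr_eq0 -![eval0 _]/(f _) -!(raddfB f).
    rewrite -!mulrBl -!(raddfB (@S_rev F n)).
    by apply/eqP/eval0_zspan_r/repB_zspan.
  by rewrite -!mulrBr; apply/eqP/eval0_zspan_l/repB_zspan.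
move=> U U' s t fs ft.
have e : eval0 (S_rev (rep (cls t)) * rep (cls s)) = eval0 (S_path (rev t) * S_path s).
  transitivity (eval0 (S_rev (rep (cls t)) * S_path s)).
    apply/eqP; rewrite -subr_eq0 -![eval0 _]/(f _) -!(raddfB f) -mulrBr.
    rewrite -[X in _ - X](S_path_idemr fs).
    exact/eqP/eval0_zspan_l/rep_zspan.
  apply/eqP; rewrite -subr_eq0 -![eval0 _]/(f _) -!(raddfB f) -mulrBl -S_rev_path.
  rewrite -(raddfB (@S_rev F n)) -[X in _ - X](S_path_idemr ft).
  exact/eqP/eval0_zspan_r/rep_zspan.
rewrite e; have [eU|ne] := eqVneq U' U; last first.
  by rewrite (flag_product0 fs ft ne) -[eval0 0]/(f 0) raddf0 mulr0z.
by rewrite eU in ft; rewrite (flag_product fs ft) eval0_idem.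
Qed.

Lemma flag_form_class W s t : is_flag V W s -> is_flag V W t ->
  flag_form (cls s) (cls t) = flag_pair t s.
Proof.
move=> fs ft; rewrite -(eval0_idem (flag_form _ _)).
by rewrite ((proj2 flag_form_spec) W W s t fs ft) (flag_product fs ft) eval0_idem.
Qed.

Lemma flag_form_class0 W U s t : is_flag V W s -> is_flag V U t -> U != W ->
  flag_form (cls s) (cls t) = 0.
Proof.
move=> fs ft ne; rewrite -(eval0_idem (flag_form _ _)).
rewrite ((proj2 flag_form_spec) W U s t fs ft) (flag_product0 fs ft ne).
by rewrite -(mulr0z (S_idem V)) eval0_idem.
Qed.

Lemma flag_pair_sym W s t : is_flag V W s -> is_flag V W t -> flag_pair t s = flag_pair s t.
Proof.
move=> fs ft; have := congr1 (@S_rev F n) (flag_product fs ft).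
rewrite S_revM !S_rev_path revK raddfMz /= S_rev_path /= (flag_product ft fs).
by move/(congr1 eval0); rewrite !eval0_idem.
Qed.

(** When a flag is retraced, each wedge meets an equal subspace at once and gives a power of q
    without sign. *)
Lemma flag_pair_diag W s : is_flag V W s -> exists m, flag_pair s s = (#|F| ^ m)%N.
Proof.
move=> fs; elim/flag_ind: W s / fs => [|W X D XW fD [m IH]].
  by exists 0; rewrite /= /unit_cochain eqxx.
have [D' eD] := flag_head fD; exists (m + \dim X)%N.
rewrite eD in IH *.
transitivity (flag_pair (X :: D') (X :: D') *+ (#|F| ^ \dim X)); first exact: wedge_act_eq.
by rewrite IH expnD -mulr_natr PoszM natz.
Qed.

(** [wedge_act] uses only intersections, equality and dimensions of subspaces, so it commutes with
    any [h] that respects these between [V] and [W0]; [W0] stays fixed while the flag shrinks. *)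
Lemma wedge_act_map (M : zmodType) (h : subspace -> subspace) (W0 : subspace)
    (hI : forall X Y, (V <= X <= W0)%VS -> (V <= Y <= W0)%VS -> h (X :&: Y)%VS = (h X :&: h Y)%VS)
    (h_inj : forall X Y, (V <= X <= W0)%VS -> (V <= Y <= W0)%VS -> h X = h Y -> X = Y)
    (h_dim : forall X, (V <= X <= W0)%VS -> \dim (h X) = \dim X)
    (psi : seq subspace -> M) X Y D : (X <= W0)%VS -> (V <= Y)%VS -> covered Y X -> is_flag V X D ->
  wedge_act (h Y) (map h D) psi = wedge_act Y D (fun s => psi (map h s)).
Proof.
move=> XW VY YX fD; elim/flag_ind: X D / fD Y XW VY YX psi => // W X D XW fD IH Y WW0 VY YW psi.
have [D' eD] := flag_head fD; rewrite eD in fD IH *.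
have VX := flag_sub fD.
have Yin : (V <= Y <= W0)%VS by rewrite VY (subv_trans (covered_sub YW)).
have Xin : (V <= X <= W0)%VS by rewrite VX (subv_trans (covered_sub XW)).
have [eXY|ne] := eqVneq X Y.
  by rewrite -eXY /= !eqxx h_dim.
have nh : h X != h Y by apply: contra ne => /eqP/(h_inj _ _ Xin Yin) ->.
rewrite !map_cons !wedge_act_neq //; congr (- _); rewrite -hI // -map_cons IH //.
- by case/andP: Xin.
- by rewrite subv_cap VY.
by apply: covered_capr YW XW _; rewrite eq_sym.
Qed.

Lemma flag_pair_map (h : subspace -> subspace) (W0 : subspace)
    (hI : forall X Y, (V <= X <= W0)%VS -> (V <= Y <= W0)%VS -> h (X :&: Y)%VS = (h X :&: h Y)%VS)
    (h_inj : forall X Y, (V <= X <= W0)%VS -> (V <= Y <= W0)%VS -> h X = h Y -> X = Y)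
    (h_dim : forall X, (V <= X <= W0)%VS -> \dim (h X) = \dim X) (hV : h V = V) W s t :
  (W <= W0)%VS -> is_flag V W s -> is_flag V W t ->
  flag_pair (map h t) (map h s) = flag_pair t s.
Proof.
move=> WW0 fs ft; elim/flag_ind: W t / ft s fs WW0 => [|W X D XW fD IH] s fs WW0.
  have [s' es] := flag_head fs; rewrite es in fs *; have e : s' = [::].
    case: s' {es} fs => // Y s'; rewrite flag_consE => /andP[YV /flag_sub VY].
    by have := dimvS VY; rewrite (covered_dim YV) ltnn.
  by rewrite e /= hV.
have [D' eD] := flag_head fD; have VX := flag_sub fD.
have -> : flag_pair (map h (W :: D)) = fun D => wedge_act (h X) D (flag_pair (map h (X :: D'))).
  by rewrite eD.
have -> : flag_pair (W :: D) s = wedge_act X s (flag_pair (X :: D')) by rewrite eD.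
rewrite (wedge_act_map hI h_inj h_dim _ WW0 VX XW fs); apply: (wedge_act_ext XW fs) => u fu.
by rewrite -eD IH // (subv_trans (covered_sub XW)).
Qed.

End Form.

(** * Matrices and the big cell *)

Section SteinbergMatrices.
Variables (F : finFieldType) (m : nat).
Local Notation G := (GLmx F m).
Implicit Types (g h b A : G) (i j : 'I_m) (t : F).

Lemma upper_trigP A : reflect (forall i j, (j < i)%N -> A i j = 0) (upper_trig A).
Proof.
apply: (iffP forallP) => [H i j ji|H i]; last first.
  by apply/forallP => j; apply/implyP => ji; rewrite H.
by have /forallP/(_ j)/implyP/(_ ji)/eqP := H i.
Qed.

Lemma GLmxE A h i j : (A * h)%g i j = \sum_k A i k * h k j.
Proof. by rewrite /= mxE. Qed.

Lemma GLmx1E i j : (1%g : G) i j = (i == j)%:R.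
Proof. by rewrite /= mxE. Qed.

Lemma upper_trig1 : upper_trig (1%g : G).
Proof. by apply/upper_trigP => i j ji; rewrite GLmx1E -val_eqE /= (gtn_eqF ji). Qed.

Lemma upper_trigM A h : upper_trig A -> upper_trig h -> upper_trig (A * h)%g.
Proof.
move=> /upper_trigP HA /upper_trigP Hh; apply/upper_trigP => i j ji.
rewrite GLmxE big1 // => k _; have [ki|ik] := ltnP k i; first by rewrite HA ?mul0r.
by rewrite Hh ?mulr0 //; apply: leq_trans ik.
Qed.

Lemma upper_trigX A e : upper_trig A -> upper_trig (A ^+ e)%g.
Proof.
by move=> HA; elim: e => [|e IH]; rewrite ?expg0 ?upper_trig1 // expgS upper_trigM.
Qed.

Lemma upper_trigV A : upper_trig A -> upper_trig A^-1%g.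
Proof. by move=> HA; rewrite invg_expg upper_trigX. Qed.

Lemma upper_trigMr A h : upper_trig h -> upper_trig (A * h)%g = upper_trig A.
Proof.
move=> Hh; apply/idP/idP => H; last exact: upper_trigM.
by rewrite -[A](mulgK h) upper_trigM // upper_trigV.
Qed.

Lemma upper_trig_diag A i : upper_trig A -> A i i != 0.
Proof.
move=> /upper_trigP HA; have := GLmx_valP A; rewrite unitmxE -det_tr det_trig; last first.
  by apply/is_trig_mxP => a c ac; rewrite mxE HA.
by rewrite unitfE => /prodf_neq0/(_ i isT); rewrite mxE.
Qed.

Definition lower_unitrig A :=
  [forall i : 'I_m, (A i i == 1) && [forall j : 'I_m, (i < j)%N ==> (A i j == 0)]].

Lemma lower_unitrigP A : reflect ((forall i, A i i = 1) /\ forall i j, (i < j)%N -> A i j = 0)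
  (lower_unitrig A).
Proof.
apply: (iffP forallP) => [H|[H1 H0] i]; last first.
  by rewrite H1 eqxx /=; apply/forallP => j; apply/implyP => ij; rewrite H0.
split=> [i|i j ij]; first by have /andP[/eqP] := H i.
by have /andP[_ /forallP/(_ j)/implyP/(_ ij)/eqP] := H i.
Qed.

Lemma lower_unitrig1 : lower_unitrig (1%g : G).
Proof.
apply/lower_unitrigP; split=> [i|i j ij]; rewrite GLmx1E ?eqxx //.
by rewrite -val_eqE /= (ltn_eqF ij).
Qed.

Lemma lower_unitrigM A h : lower_unitrig A -> lower_unitrig h -> lower_unitrig (A * h)%g.
Proof.
move=> /lower_unitrigP[A1 A0] /lower_unitrigP[h1 h0]; apply/lower_unitrigP; split=> [i|i j ij].
  rewrite GLmxE (bigD1 i) //= A1 h1 mulr1 big1 ?addr0 // => k ki.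
  have [lt|le] := ltnP i k; first by rewrite A0 ?mul0r.
  by rewrite h0 ?mulr0 // ltn_neqAle le andbT.
rewrite GLmxE big1 // => k _; have [lt|le] := ltnP i k; first by rewrite A0 ?mul0r.
by rewrite h0 ?mulr0 // (leq_ltn_trans le).
Qed.

Lemma lower_unitrigV A : lower_unitrig A -> lower_unitrig A^-1%g.
Proof.
move=> HA; rewrite invg_expg; elim: (_.-1) => [|e IH]; rewrite ?expg0 ?lower_unitrig1 //.
by rewrite expgS lower_unitrigM.
Qed.

Lemma lower_upper1 A : lower_unitrig A -> upper_trig A -> A = 1%g.
Proof.
move=> /lower_unitrigP[A1 A0] /upper_trigP AU; apply/val_inj/matrixP => i j.
rewrite [RHS]GLmx1E; have [ij|ji|/val_inj->] := ltngtP i j; last by rewrite A1 eqxx.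
  by rewrite [LHS]A0 // -val_eqE /= (ltn_eqF ij).
by rewrite [LHS]AU // -val_eqE /= (gtn_eqF ji).
Qed.

(** The entries below the diagonal are free; N is their number. *)
Lemma card_lower_unitrig : exists N, #|[set A : G | lower_unitrig A]| = (#|F| ^ N)%N.
Proof.
pose I := {ij : 'I_m * 'I_m | (ij.2 < ij.1)%N}.
pose mx (f : {ffun I -> F}) : 'M[F]_m :=
  \matrix_(i, j) if insub (i, j) is Some u then f u else (i == j)%:R.
have mxu f : mx f \in unitmx.
  rewrite unitmxE det_trig; last first.
    apply/is_trig_mxP => i j ij; rewrite mxE insubN /= -?leqNgt 1?ltnW //.
    by rewrite -val_eqE /= (ltn_eqF ij).
  by rewrite big1 ?unitr1 // => i _; rewrite mxE insubN /= ?ltnn ?eqxx.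
pose h f : G := GLMx (mxu f).
have h_inj : injective h.
  move=> f f' /(congr1 val)/= /matrixP e; apply/ffunP => u.
  by have := e (val u).1 (val u).2; rewrite !mxE -surjective_pairing valK.
exists #|{: I}|; rewrite -card_ffun -(card_imset predT h_inj); apply: eq_card => A.
rewrite inE; apply/lower_unitrigP/imsetP => [[A1 A0]|[f _ ->]].
  exists [ffun u : I => A (val u).1 (val u).2] => //; apply/val_inj/matrixP => i j.
  rewrite /= mxE; case: insubP => [u _ eu|/=]; first by rewrite ffunE eu.
  rewrite -leqNgt => ij; have [->|ne] := eqVneq i j; first by rewrite A1.
  by rewrite A0 // ltn_neqAle ij andbT.
split=> [i|i j ij] /=; rewrite mxE insubN /= ?ltnn ?eqxx // -?leqNgt 1?ltnW //.
by rewrite -val_eqE /= (ltn_eqF ij).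
Qed.

(* Right multiplication by adj_GLmx replaces the columns i, i' of a matrix by
   (column i') + t (column i) and (column i). *)
Definition adj_mx i i' t : 'M[F]_m := tperm_mx i i' *m (1%:M + t *: delta_mx i' i).

Lemma adj_mx_unit i i' t : (i < i')%N -> adj_mx i i' t \in unitmx.
Proof.
move=> ii'; rewrite unitmx_mul unitmx_perm /= unitmxE det_trig; last first.
  apply/is_trig_mxP => a c ac; rewrite !mxE -!val_eqE /= (ltn_eqF ac) add0r.
  case: eqP => [ea|_]; last by rewrite mulr0.
  case: eqP => [ec|_]; last by rewrite mulr0.
  by move: ac; rewrite ea ec ltnNge ltnW.
rewrite big1 ?unitr1 // => a _; rewrite !mxE eqxx -!val_eqE /=.
case: eqP => [->|_]; last by rewrite mulr0 addr0.
by rewrite (gtn_eqF ii') mulr0 addr0.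
Qed.

(** Given the value 1 outside i < i', so that [FSmx] can be stated without a proof argument. *)
Definition adj_GLmx i i' t : G :=
  if (i < i')%N =P true is ReflectT ii' then GLMx (adj_mx_unit t ii') else 1%g.

Lemma adj_GLmxE g i i' t a c : (i < i')%N -> (g * adj_GLmx i i' t)%g a c =
  if c == i then g a i' + t * g a i else if c == i' then g a i else g a c.
Proof.
move=> ii'; rewrite /adj_GLmx; case: eqP => // ii2 /=.
rewrite /adj_mx mulmxA -[val g *m _]/(g *m _) -xcolE mulmxDr mulmx1 -scalemxAr !mxE.
rewrite (bigD1 i') //= big1 => [|k /negPf kn]; last by rewrite !mxE kn mulr0.
rewrite !mxE eqxx /= addr0 tpermR; have [->|ci] := eqVneq c i.
  by rewrite tpermL mulr1.
by rewrite !mulr0 addr0; have [->|ci'] := eqVneq c i'; rewrite ?tpermR ?tpermD // eq_sym.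
Qed.

(** * Vanishing by Gaussian elimination *)

Section Functions.
Variable M : zmodType.
Implicit Types a : G -> M.

Definition B_inv a := forall g b, upper_trig b -> a (g * b)%g = a g.

(** (FS) at one position: [g] and the q matrices [g * adj_GLmx i i' t] represent the q+1 flags that
    agree with the flag of [g] outside dimension i.+1 over [V]. *)
Definition FSmx a := forall g i i', i' = i.+1 :> nat ->
  a g + \sum_t a (g * adj_GLmx i i' t)%g = 0.

(** State of the elimination after [r] steps: the first [r] rows are those of a lower unitriangular
    matrix. *)
Definition low r g := forall i, (i < r)%N -> g i i = 1 /\ forall j, (i < j)%N -> g i j = 0.

(** Otherwise row [r] would be a combination of the rows before it, contradicting invertibility. *)
Lemma low_row r g (lr : (r < m)%N) : low r g ->
  exists2 j : 'I_m, (r <= j)%N & g (Ordinal lr) j != 0.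
Proof.
move=> Lg; apply: contrapT => H; set o := Ordinal lr in H *.
have H0 (j : 'I_m) : (r <= j)%N -> g o j = 0.
  by move=> rj; apply/eqP; apply: contraT => ne; case: H; exists j.
(* By triangularity, a row supported in the first s <= r columns is a combination of the first s
   rows of g. *)
have span s (u : 'rV[F]_m) : (s <= r)%N -> (forall j : 'I_m, (s <= j)%N -> u 0 j = 0) ->
    exists2 c : 'rV[F]_m, u = c *m g & forall j : 'I_m, (s <= j)%N -> c 0 j = 0.
  elim: s u => [|s IH] u sr u0.
    by exists 0 => [|j _]; rewrite ?mul0mx ?mxE //; apply/rowP => j; rewrite u0 // mxE.
  have sm : (s < m)%N by apply: leq_trans sr (ltnW lr).
  pose os := Ordinal sm; have [g1 g0] := Lg os sr.
  have [|j sj|c ec c0] := IH (u - u 0 os *: row os g); first exact: ltnW.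
    rewrite !mxE.  have [lt|le] := ltnP s j; first by rewrite (u0 j lt) (g0 j lt) mulr0 subr0.
    have -> : j = os by apply/val_inj/eqP; rewrite /= eqn_leq le sj.
    by rewrite g1 mulr1 subrr.
  exists (c + u 0 os *: delta_mx 0 os) => [|j sj].
    by rewrite mulmxDl -ec -scalemxAl -rowE subrK.
  have /negbTE jos : j != os by rewrite -val_eqE /= (gtn_eqF sj).
  by rewrite !mxE c0 ?(ltnW sj) // add0r jos andbF mulr0.
have [|c ec c0] := span r (row o g) (leqnn r); first by move=> j rj; rewrite mxE H0.
have : delta_mx 0 o = c.
  by apply: (can_inj (mulmxK (GLmx_valP g))); rewrite -rowE ec.
move/matrixP/(_ 0 o); rewrite mxE !eqxx c0 // => /eqP; rewrite oner_eq0; done.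
Qed.

(** Elimination row by row: B supplies the column operations once the pivot of row [r] is nonzero.
    If a nonzero entry sits further right, (FS) expresses [a g] by matrices in which it is one
    column closer to the diagonal. *)
Lemma vanish_lower a : B_inv a -> FSmx a -> (forall g, lower_unitrig g -> a g = 0) ->
  forall g, a g = 0.
Proof.
move=> Ba Fa a0; suff H s r g : (r + s = m)%N -> low r g -> a g = 0.
  by move=> g; apply: (H m 0%N).
elim: s r g => [|s IH] r g rs Lg.
  apply: a0; apply/lower_unitrigP; split=> [i|i j ij].
    by have [] := Lg i (leq_trans (ltn_ord i) (eq_leq (esym (etrans (esym (addn0 r)) rs)))).
  by have [_ ->] := Lg i (leq_trans (ltn_ord i) (eq_leq (esym (etrans (esym (addn0 r)) rs)))).
have lr : (r < m)%N by rewrite -rs -addSnnS leq_addr.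
pose o := Ordinal lr.
have rs' : (r.+1 + s = m)%N by rewrite addSnnS.
have pivot h : low r h -> h o o != 0 -> a h = 0.
  (* Right multiplication by [bm] scales column r to make the pivot 1 and clears row r to its right;
     earlier rows are unchanged, as they vanish in column r. *)
  move=> Lh ho; pose bm : 'M[F]_m := \matrix_(i, j)
    if i == o then (if (o < j)%N then - (h o o)^-1 * h o j else
       if j == o then (h o o)^-1 else 0) else (i == j)%:R.
  have bmE (i j : 'I_m) : bm i j = if i == o then (if (o < j)%N then - (h o o)^-1 * h o j else
       if j == o then (h o o)^-1 else 0) else (i == j)%:R by rewrite mxE.
  have bml (i j : 'I_m) : (j < i)%N -> bm i j = 0.
    move=> ji; rewrite bmE; have [ei|_] := eqVneq i o.
      by rewrite ei in ji; rewrite ltnNge (ltnW ji) /= -val_eqE /= (ltn_eqF ji).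
    by rewrite -val_eqE /= (gtn_eqF ji).
  have bu : bm \in unitmx.
    rewrite unitmxE -det_tr det_trig; last by apply/is_trig_mxP => i j ij; rewrite mxE bml.
    rewrite unitfE; apply/prodf_neq0 => i _; rewrite mxE bmE.
    by have [->|_] := eqVneq i o; rewrite ?ltnn ?eqxx ?invr_eq0 ?oner_eq0.
  rewrite -(Ba h (GLMx bu)); last by apply/upper_trigP.
  have hbE (i j : 'I_m) : (h * GLMx bu)%g i j = if (o < j)%N then h i j - h i o * ((h o o)^-1 * h o j)
       else if j == o then h i o * (h o o)^-1 else h i j.
    rewrite GLmxE (bigD1 o) //= bmE eqxx.
    under eq_bigr => k /negPf ko do rewrite bmE ko.
    have [oj|jo] := ltnP o j.
      rewrite (bigD1 j) //=; last by rewrite -val_eqE /= (gtn_eqF oj).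
      rewrite eqxx mulr1 big1 ?addr0 => [|k /andP[_ /negPf->]]; last by rewrite mulr0.
      by rewrite addrC mulNr mulrN.
    have [->|ne] := eqVneq j o.
      by rewrite big1 ?addr0 // => k /negPf->; rewrite mulr0.
    rewrite mulr0 add0r (bigD1 j) //= eqxx mulr1 big1 ?addr0 // => k /andP[_ /negPf->].
    by rewrite mulr0.
  apply: (IH r.+1) => // i; rewrite ltnS leq_eqVlt => /orP[/eqP io|ir].
    have -> : i = o by apply: val_inj.
    split=> [|j oj]; rewrite hbE; first by rewrite ltnn eqxx divff.
    by rewrite oj mulrA divff // mul1r subrr.
  have [h1 h0] := Lh i ir; have hio : h i o = 0 by apply: h0.
  have ion : (i == o) = false by apply/negbTE; rewrite -val_eqE /= neq_ltn ir.
  split=> [|j ij]; rewrite hbE.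
    by rewrite ltnNge (ltnW ir) /= ion.
  by rewrite hio !mul0r subr0 h0 // !if_same.
have [j] := low_row lr Lg; rewrite -/o.
have [d] := ubnP (j - r); elim: d j g Lg => // d IHd j g Lg jd rj gj.
have {IHd} IHd h (j' : 'I_m) : low r h -> (r <= j')%N -> (j' < j)%N -> h o j' != 0 -> a h = 0.
  by move=> Lh rj' jj hj; apply: (IHd j' h) => //; lia.
have [ej|ne] := eqVneq j o; first by rewrite ej in gj; apply: pivot.
have ltrj : (r < j)%N by rewrite ltn_neqAle rj andbT eq_sym.
have j1m : (j.-1 < m)%N by apply: leq_ltn_trans (leq_pred j) (ltn_ord j).
pose i := Ordinal j1m; have ej : j = i.+1 :> nat by rewrite /= (ltn_predK ltrj).
have ij : (i < j)%N by rewrite ej.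
have ri : (r <= i)%N by rewrite -ltnS -ej.
have [goi|gi] := eqVneq (g o i) 0; last exact: IHd gi.
(* Since row r of g vanishes in column i, all q neighbours have the entry [g o j] there; the
   induction makes [a] vanish on each of them, and (FS) gives [a g = 0]. *)
have := Fa g i j ej; rewrite big1 ?addr0 // => t _.
apply: (IHd _ i) => //; last by rewrite adj_GLmxE // eqxx goi mulr0 addr0.
move=> i0 i0r; have [g1 g0] := Lg i0 i0r.
have i0i : (i0 < i)%N by apply: leq_trans ri.
have i0j : (i0 < j)%N by apply: leq_trans rj.
split=> [|c i0c]; rewrite adj_GLmxE //.
  by rewrite -!val_eqE /= (ltn_eqF i0i) (ltn_eqF i0j).
by rewrite !g0 // mulr0 addr0; do 2![case: ifP => // _].
Qed.

End Functions.
End SteinbergMatrices.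

(** * The Steinberg representation as a space of functions *)

Section SteinbergElement.
Variables (k : fieldType) (F : finFieldType) (m : nat).
Local Notation G := (GLmx F m).
Local Notation e_St := (steinberg_elt k F m).
Implicit Types (g h b A : G) (i j : 'I_m) (s : 'S_m).

Lemma grp_elt_mul h (x : grp_alg k G) g : grp_mul (grp_elt k h) x g = x (h^-1 * g)%g.
Proof.
rewrite ffunE (bigD1 h) //= ffunE eqxx mul1r big1 ?addr0 // => h' /negPf ne.
by rewrite ffunE ne mul0r.
Qed.

Lemma steinberg_eltE g :
  e_St g = \sum_(s : 'S_m) (-1) ^+ s * (upper_trig ((perm_GLmx F s)^-1 * g)%g)%:R.
Proof.
rewrite ffunE.
have bE x : (\sum_(b : G | upper_trig b) grp_elt k b) x = (upper_trig x)%:R :> k^o.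
  rewrite sum_ffunE; have [ux|nx] := boolP (upper_trig x).
    rewrite (bigD1 x) //= ffunE eqxx big1 ?addr0 // => b /andP[_ /negPf ne].
    by rewrite ffunE eq_sym ne.
  rewrite big1 // => b ub; rewrite ffunE; case: eqP => // e.
  by case/negP: nx; rewrite e.
under eq_bigr => h _ do rewrite bE sum_ffunE mulr_suml.
rewrite exchange_big /=; apply: eq_bigr => s _.
rewrite (bigD1 (perm_GLmx F s)) //= !ffunE eqxx big1 ?addr0 => [|h /negPf ne].
  by rewrite [_ *: _]mulr1.
by rewrite !ffunE ne scaler0 mul0r.
Qed.

Lemma steinberg_elt_B_inv : B_inv e_St.
Proof.
move=> g b ub; rewrite !steinberg_eltE; apply: eq_bigr => s _.
by rewrite mulgA upper_trigMr.
Qed.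

(** For i' = i + 1 this is the minimal parabolic subgroup generated by B and the transposition of i
    and i'. *)
Definition parabolic i i' A :=
  [forall a : 'I_m, forall c : 'I_m, (c < a)%N && ((a, c) != (i', i)) ==> (A a c == 0)].

Lemma parabolicP i i' A : reflect
  (forall a c : 'I_m, (c < a)%N -> (a, c) != (i', i) -> A a c = 0) (parabolic i i' A).
Proof.
apply: (iffP forallP) => [H a c ca ne|H a].
  by have /forallP/(_ c) := H a; rewrite ca ne => /eqP.
by apply/forallP => c; apply/implyP => /andP[ca ne]; rewrite H.
Qed.

(** The parabolic subgroup has q+1 cosets modulo B: exactly one of the q+1 matrices is upper
    triangular if [A] is parabolic, and none otherwise. *)
Lemma parabolic_count i i' A : i' = i.+1 :> nat ->
  ((upper_trig A) + \sum_t (upper_trig (A * adj_GLmx i i' t)%g : nat) = parabolic i i' A)%N.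
Proof.
move=> ei; have ii' : (i < i')%N by rewrite ei.
have nii' : (i' == i) = false by rewrite -val_eqE /= (gtn_eqF ii').
have [/parabolicP HA|nP] := boolP (parabolic i i' A); last first.
  rewrite big1 => [|t _]; last first.
    apply/eqP; rewrite eqb0; apply: contra nP => /upper_trigP H.
    apply/parabolicP => a c ca ne.
    have [ec|nc] := eqVneq c i.
      have := H a i'; rewrite adj_GLmxE // nii' eqxx ec; apply.
      rewrite ec in ca ne; rewrite ltn_neqAle; rewrite xpair_eqE eqxx andbT in ne.
      by rewrite -val_eqE /= eq_sym in ne; rewrite ne ei.
    have [ec|nc'] := eqVneq c i'.
      have ia : (i < a)%N by rewrite ec in ca; apply: ltn_trans ca.
      have := H a i ia; rewrite adj_GLmxE // eqxx ec.
      have := H a i'; rewrite adj_GLmxE // nii' eqxx => -> //; last by rewrite -ec.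
      by rewrite mulr0 addr0.
    by have := H a c ca; rewrite adj_GLmxE // (negPf nc) (negPf nc').
  apply/eqP; rewrite addn0 eqb0; apply: contra nP => /upper_trigP H.
  by apply/parabolicP => a c ca _; apply: H.
have ad t : upper_trig (A * adj_GLmx i i' t)%g = (A i' i' + t * A i' i == 0).
  apply/upper_trigP/eqP => [H|H a c ca].
    by have := H i' i ii'; rewrite adj_GLmxE // eqxx.
  rewrite adj_GLmxE //; have [ec|nc] := eqVneq c i.
    have [->//|na] := eqVneq a i'.
    rewrite ec in ca; rewrite !HA ?mulr0 ?addr0 // ?xpair_eqE ?(negPf na) //.
    by rewrite ltn_neqAle eq_sym val_eqE na ei.
  have [ec|nc'] := eqVneq c i'.
    rewrite HA // ?xpair_eqE; first by rewrite ec in ca; apply: ltn_trans ca.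
    by apply/negP => /andP[/eqP ea _]; rewrite ec ea ltnn in ca.
  by rewrite HA // xpair_eqE (negPf nc) andbF.
have [c0|cn0] := eqVneq (A i' i) 0.
  have uA : upper_trig A.
    by apply/upper_trigP => a c ca; have [[-> ->]//|ne] := eqVneq (a, c) (i', i); apply: HA.
  rewrite uA big1 // => t _; rewrite ad c0 mulr0 addr0.
  by rewrite (negPf (upper_trig_diag _ uA)).
have -> : upper_trig A = false.
  by apply/negP => /upper_trigP/(_ _ _ ii')/eqP; rewrite (negPf cn0).
(* The entry at (i', i) is A i' i' + t A i' i, so this is the only t that clears it. *)
rewrite add0n (bigD1 (- A i' i' / A i' i)) //= ad mulfVK // subrr eqxx big1 // => t nt.
rewrite ad; apply/eqP; rewrite eqb0; apply: contra nt => /eqP e.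
by rewrite eq_sym -(inj_eq (mulIf cn0)) mulfVK // -subr_eq0 -opprD oppr_eq0 e.
Qed.

Lemma perm_GLmxM s t : perm_GLmx F (s * t)%g = (perm_GLmx F s * perm_GLmx F t)%g.
Proof. by apply: val_inj; rewrite /= perm_mxM. Qed.

Lemma perm_GLmx1 : perm_GLmx F (1 : 'S_m)%g = 1%g.
Proof. by apply: val_inj; rewrite /= perm_mx1. Qed.

Lemma perm_GLmxV s : ((perm_GLmx F s)^-1 = perm_GLmx F s^-1)%g.
Proof. by apply: (mulgI (perm_GLmx F s)); rewrite mulgV -perm_GLmxM mulgV perm_GLmx1. Qed.

Lemma perm_GLmxE s A i j : (perm_GLmx F s * A)%g i j = A (s i) j.
Proof. by rewrite /= -row_permE mxE. Qed.

Lemma parabolic_perm i i' A : i' = i.+1 :> nat -> parabolic i i' A ->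
  parabolic i i' (perm_GLmx F (tperm i i') * A)%g.
Proof.
move=> ei /parabolicP HA; apply/parabolicP => a c ca ne; rewrite perm_GLmxE.
have ii' : (i < i')%N by rewrite ei.
have [ea|na] := eqVneq a i.
  rewrite ea tpermL HA //; first by rewrite ea in ca; apply: ltn_trans ca ii'.
  by rewrite xpair_eqE eqxx /= -val_eqE /= neq_ltn -ea ca.
have [ea|na'] := eqVneq a i'.
  rewrite ea xpair_eqE eqxx /= in ne; rewrite ea tpermR HA //.
    by rewrite ea ei ltnS in ca; rewrite ltn_neqAle ne ca.
  by rewrite xpair_eqE -val_eqE /= (ltn_eqF ii').
by rewrite tpermD 1?eq_sym // HA // xpair_eqE (negPf na').
Qed.

(** By [parabolic_count] the sum is the signed count of the s with s^-1 g parabolic. Composing s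
    with the transposition of i and i' preserves this condition and reverses the sign. *)
Lemma steinberg_elt_FS : FSmx e_St.
Proof.
move=> g i i' ei.
have ii' : (i < i')%N by rewrite ei.
have nii' : i != i' by rewrite -val_eqE /= neq_ltn ii'.
pose x s : k := (parabolic i i' ((perm_GLmx F s)^-1 * g)%g)%:R.
transitivity (\sum_(s : 'S_m) (-1) ^+ s * x s).
  rewrite steinberg_eltE; under [in X in _ + X]eq_bigr => t _ do rewrite steinberg_eltE.
  rewrite exchange_big -big_split /=; apply: eq_bigr => s _.
  rewrite -mulr_sumr -mulrDr; congr (_ * _); rewrite /x -(parabolic_count _ ei) natrD natr_sum.
  by under [in RHS]eq_bigr => t _ do rewrite -mulgA.
have xt s : x (s * tperm i i')%g = x s.
  rewrite /x perm_GLmxM invMg -mulgA [in X in (X * _)%g]perm_GLmxV tpermV.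
  congr ((nat_of_bool _)%:R); apply/idP/idP; last exact: parabolic_perm.
  by move/(parabolic_perm ei); rewrite [X in parabolic _ _ X -> _]mulgA -perm_GLmxM tperm2 perm_GLmx1 mul1g.
rewrite (bigID (fun s : 'S_m => odd_perm s)) /= [X in X + _](reindex_inj (mulIg (tperm i i'))) /=.
have odd_t s : odd_perm (s * tperm i i')%g = ~~ odd_perm s.
  by rewrite odd_permM odd_tperm nii' addbT.
rewrite [X in X + _](eq_bigl (fun s : 'S_m => ~~ odd_perm s)) => [|s]; last by rewrite odd_t.
rewrite -big_split big1 // => s /= ns; rewrite xt odd_t (negPf ns) /=.
by rewrite expr1 expr0 mulN1r mul1r addNr.
Qed.

(** The sums of i and of s i over all i agree, so no inequality is strict. *)
Lemma perm_ge_id s : (forall i, (i <= s i)%N) -> s = 1%g.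
Proof.
move=> H; have [_ e] := @leqif_sum _ predT (fun i => nat_of_ord i == s i) (fun i => nat_of_ord i)
    (fun i => nat_of_ord (s i)) (fun i _ => (leqif_eq (H i))).
apply/permP => i; rewrite perm1; move: e.
rewrite (reindex_inj (@perm_inj _ s)) /= eqxx => /esym/forallP/(_ i)/eqP e.
exact/val_inj/esym.
Qed.

(** If s^-1 A is upper triangular, the unit diagonal of [A] forces s^-1 i >= i for all i, hence s =
    1. *)
Lemma steinberg_elt_lower A : lower_unitrig A -> e_St A = (A == 1%g)%:R.
Proof.
move=> lA; have /lower_unitrigP[A1 A0] := lA.
have nz s : upper_trig ((perm_GLmx F s)^-1 * A)%g -> s = 1%g.
  rewrite perm_GLmxV => /upper_trigP H; apply: invg_inj; rewrite invg1; apply: perm_ge_id => i.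
  rewrite leqNgt; apply/negP => lt; have := H _ _ lt.
  by rewrite perm_GLmxE A1 => /eqP; rewrite oner_eq0.
rewrite steinberg_eltE (bigD1 (1%g : 'S_m)) //= big1 ?addr0 => [|s ns]; last first.
  by case: (boolP (upper_trig _)) => [/nz e|]; rewrite ?mulr0 //; case/eqP: ns.
rewrite odd_perm1 expr0 mul1r perm_GLmx1 invg1 mul1g; congr ((nat_of_bool _)%:R).
by apply/idP/eqP => [uA|->]; [apply: lower_upper1 | apply: upper_trig1].
Qed.

(** The difference of the two sides vanishes on the big cell. Values lie in an arbitrary module
    because the expansion serves both for elements of St and for vectors of the weight space. *)
Lemma FSmx_expand (M : lmodType k) (a : G -> M) g : B_inv a -> FSmx a ->
  a g = \sum_(L : G | lower_unitrig L) e_St (L^-1 * g)%g *: a L.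
Proof.
move=> Ba Fa; apply/eqP; rewrite -subr_eq0; apply/eqP; move: g.
apply: vanish_lower.
- move=> h b ub /=; rewrite Ba //; congr (_ - _); apply: eq_bigr => L _.
  by rewrite mulgA steinberg_elt_B_inv.
- move=> h i i' ei /=; rewrite sumrB addrACA Fa // add0r -opprD.
  rewrite exchange_big -big_split big1 ?oppr0 //= => L _.
  under [in X in _ + X]eq_bigr => t _ do rewrite mulgA.
  by rewrite -scaler_suml -scalerDl steinberg_elt_FS // scale0r.
move=> A lA /=; rewrite (bigD1 A) //= mulVg steinberg_elt_lower ?lower_unitrig1 // eqxx scale1r.
rewrite big1 ?addr0 ?subrr // => L /andP[lL nLA].
rewrite steinberg_elt_lower; last by rewrite lower_unitrigM ?lower_unitrigV.
case: eqP => [e|_]; last by rewrite scale0r.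
by case/eqP: nLA; rewrite -[A](mulKVg L) e mulg1.
Qed.

Lemma St_expand (x : grp_alg k G) : B_inv x -> FSmx x ->
  x = \sum_(L : G | lower_unitrig L) x L *: grp_mul (grp_elt k L) e_St.
Proof.
move=> Bx Fx; apply/ffunP => g; rewrite (@FSmx_expand k^o x g) // sum_ffunE.
apply: eq_bigr => L _; transitivity (x L *: grp_mul (grp_elt k L) e_St g); last by rewrite [RHS]ffunE.
by rewrite grp_elt_mul [LHS]mulrC.
Qed.

Lemma StP (x : grp_alg k G) : x \in St k F m <-> B_inv x /\ FSmx x.
Proof.
split=> [/left_idealP[a ->]|[Bx Fx]]; last first.
  rewrite (St_expand Bx Fx); apply: memv_suml => L _; rewrite memvZ //.
  by apply/left_idealP; exists (grp_elt k L).
split=> [g b ub|g i i' ei]; rewrite !ffunE.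
  by apply: eq_bigr => h _; rewrite mulgA steinberg_elt_B_inv.
under [in X in _ + X]eq_bigr => t _ do rewrite ffunE.
rewrite exchange_big -big_split big1 //= => h _.
under [in X in _ + X]eq_bigr => t _ do rewrite mulgA.
by rewrite -mulr_sumr -mulrDr steinberg_elt_FS // mulr0.
Qed.

Definition w0 : G := perm_GLmx F (perm (@rev_ord_inj m)).

(** The longest permutation conjugates lower into upper triangular matrices; hence L w0 B = w0 B,
    and the lower unitriangular group fixes the flag of [w0]. *)
Lemma w0_lower A : lower_unitrig A -> upper_trig (w0^-1 * (A * w0))%g.
Proof.
move=> /lower_unitrigP[A1 A0]; apply/upper_trigP => i j ji.
rewrite /w0 perm_GLmxV perm_GLmxE.
have -> : forall s i j, (A * perm_GLmx F s)%g i j = A i ((s^-1)%g j).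
  move=> s a c; rewrite /= -[s in perm_mx s]invgK -col_permE mxE; done.
rewrite A0 //.
have rV : (perm (@rev_ord_inj m))^-1%g = perm (@rev_ord_inj m).
  apply: (mulgI (perm (@rev_ord_inj m))); rewrite mulgV; apply/permP => a.
  by rewrite permM !permE rev_ordK.
by rewrite rV !permE /=; have := ltn_ord i; lia.
Qed.

End SteinbergElement.

(** * Flags as cosets *)

Section FlagsOfMatrices.
Variables (F : finFieldType) (n : nat) (V W : {vspace 'rV[F]_n}) (VW : (V <= W)%VS).
Local Notation subspace := {vspace 'rV[F]_n}.
Local Notation m := (\dim W - \dim V)%N.
Variable theta : lin_iso (subquot V W) 'cV[F]_m.
Local Notation G := (GLmx F m).
Implicit Types (w x : 'rV[F]_n) (g : G) (c : 'cV[F]_m).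

Lemma span_enumP (P : pred 'rV[F]_n) : P 0 -> (forall a u v, P u -> P v -> P (a *: u + v)) ->
  forall w, (w \in <<enum P>>%VS) = P w.
Proof.
move=> P0 PL w; apply/idP/idP => [/coord_span ->|Pw]; last first.
  by rewrite memv_span // mem_enum.
elim/big_rec: _ => [|i x _ Px]; first exact: P0.
have : (enum P)`_i \in enum P by rewrite mem_nth -?cardE.
by rewrite mem_enum => Pi; apply: PL.
Qed.

Definition coords w : 'cV[F]_m := theta (to_subquot V W w).

Lemma to_subquot_linear : linear (to_subquot V W).
Proof. by move=> a u v; rewrite /to_subquot !linearP. Qed.

Lemma coords_linear : linear coords.
Proof. by move=> a u v; rewrite /coords to_subquot_linear iso_linear. Qed.
HB.instance Definition _ := GRing.isLinear.Build F 'rV[F]_n 'cV[F]_m _ coords coords_linear.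

Lemma coords_eq0 w : w \in W -> (coords w == 0) = (w \in V).
Proof.
move=> wW; have -> : (coords w == 0) = (to_subquot V W w == 0).
  have t0 : theta 0 = 0 by have := iso_linear theta (-1) 0 0; rewrite scaler0 addr0 scaleN1r addNr.
  by rewrite -[X in _ == X]t0 (can_eq (iso_funK theta)).
apply/eqP/idP => [|wV].
  rewrite -(raddf0 (to_quot (@in_V_pred F n V W))) => /to_quotE.
  by rewrite subr0 /in_mem /= /in_V_pred vsprojK.
rewrite -(raddf0 (to_quot (@in_V_pred F n V W))); apply/to_quotE.
by rewrite subr0 /in_mem /= /in_V_pred vsprojK.
Qed.

Definition lift_basis (j : 'I_m) : 'rV[F]_n := vsval (of_quot (iso_inv theta (delta_mx j 0))).

Definition lift_coords c : 'rV[F]_n := \sum_j c j 0 *: lift_basis j.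

Lemma lift_coords_linear : linear lift_coords.
Proof.
move=> a u v; rewrite /lift_coords scaler_sumr -big_split; apply: eq_bigr => j _.
by rewrite !mxE scalerDl scalerA.
Qed.
HB.instance Definition _ :=
  GRing.isLinear.Build F 'cV[F]_m 'rV[F]_n _ lift_coords lift_coords_linear.

Lemma lift_coords_in c : lift_coords c \in W.
Proof. by apply: memv_suml => j _; rewrite memvZ // subvsP. Qed.

Lemma lift_coordsK c : coords (lift_coords c) = c.
Proof.
rewrite [in RHS](matrix_sum_delta c) /lift_coords linear_sum; apply: eq_bigr => j _.
rewrite linearZ big_ord1; congr (_ *: _); rewrite /= /coords /to_subquot /lift_basis.
by rewrite vsvalK of_quotK iso_invK.
Qed.

(** Equations for the sum of [V] and the span of lifts of the first i columns of [g]. *)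
Definition flag_pred g (i : nat) w : bool :=
  (w \in W) && [forall j : 'I_m, (i <= j)%N ==> (((g^-1%g : G) *m coords w) j 0 == 0)].

Definition flag_space g i : subspace := <<enum (flag_pred g i)>>%VS.

Lemma flag_spaceP g i w : reflect
  (w \in W /\ forall j : 'I_m, (i <= j)%N -> ((g^-1%g : G) *m coords w) j 0 = 0)
  (w \in flag_space g i).
Proof.
rewrite span_enumP /flag_pred.
- apply: (iffP andP) => -[wW H]; split=> //.
    by move=> j ij; apply/eqP; have /forallP/(_ j)/implyP := H; apply.
  by apply/forallP => j; apply/implyP => ij; rewrite H.
- by rewrite mem0v /=; apply/forallP => j; rewrite linear0 mulmx0 mxE eqxx implybT.
move=> a u v /andP[uW /forallP Hu] /andP[vW /forallP Hv].
rewrite memvD ?memvZ //=; apply/forallP => j; apply/implyP => ij.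
rewrite linearP mulmxDr -scalemxAr !mxE.
have /implyP/(_ ij)/eqP := Hu j; rewrite mxE => ->.
by have /implyP/(_ ij)/eqP := Hv j; rewrite mxE => ->; rewrite mulr0 addr0.
Qed.

Lemma flag_space0 g : flag_space g 0 = V.
Proof.
apply/vspaceP => w; apply/flag_spaceP/idP => [[wW H]|wV].
  rewrite -coords_eq0 //; suff : (g^-1%g : G) *m coords w = 0.
    by move/(congr1 (mulmx g)); rewrite mulmxA mulmxV ?GLmx_valP // mul1mx mulmx0 => ->.
  by apply/matrixP => j z; rewrite ord1 H // mxE.
have wW : w \in W by apply: (subvP VW).
split=> // j _; move: wV; rewrite -coords_eq0 // => /eqP->.
by rewrite mulmx0 mxE.
Qed.

Lemma flag_spaceT g : flag_space g m = W.
Proof.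
apply/vspaceP => w; apply/flag_spaceP/idP => [[]//|wW]; split=> // j.
by rewrite leqNgt ltn_ord.
Qed.

Lemma GLmxVK g c : (g^-1%g : G) *m (g *m c) = c.
Proof. by rewrite mulmxA mulVmx ?GLmx_valP // mul1mx. Qed.

Lemma flag_space_notin g (i : 'I_m) v : coords v = col i g -> v \notin flag_space g i.
Proof.
move=> e; apply/negP => /flag_spaceP[_ /(_ i (leqnn i))].
by rewrite e colE GLmxVK mxE !eqxx => /eqP; rewrite oner_eq0.
Qed.

Lemma flag_spaceS g (i : 'I_m) v : v \in W -> coords v = col i g ->
  flag_space g i.+1 = (flag_space g i + <[v]>)%VS.
Proof.
move=> vW ev; apply/eqP; rewrite eqEsubv; apply/andP; split; last first.
  rewrite subv_add -memvE; apply/andP; split.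
    by apply/subvP => w /flag_spaceP[wW H]; apply/flag_spaceP; split=> // j /ltnW/H.
  apply/flag_spaceP; split=> // j ij; rewrite ev colE GLmxVK mxE -val_eqE /=.
  by rewrite (gtn_eqF ij).
apply/subvP => w /flag_spaceP[wW H]; set a := ((g^-1%g : G) *m coords w) i 0.
rewrite -[w](subrK (a *: v)) memv_add ?memvZ ?memv_line //.
apply/flag_spaceP; split=> [|j ij]; first by rewrite memvB ?memvZ.
rewrite linearB linearZ /= mulmxBr -scalemxAr ev colE GLmxVK.
rewrite mxE [in X in _ + X]mxE [in X in _ - X]mxE.
have [ji|ji|/val_inj eij] := ltngtP j i; first by rewrite ltnNge ij in ji.
  by rewrite H // sub0r mxE -val_eqE /= (gtn_eqF ji) mulr0 oppr0.
by rewrite eij [X in a * X]mxE !eqxx mulr1 subrr.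
Qed.

Lemma covered_flag_space g (i : 'I_m) : covered (flag_space g i) (flag_space g i.+1).
Proof.
have e : coords (lift_coords (col i g)) = col i g by apply: lift_coordsK.
rewrite (flag_spaceS (lift_coords_in _) e); apply: covered_add.
exact: flag_space_notin.
Qed.

Lemma flag_space_sub g g' i : (forall a c : 'I_m, (c < i <= a)%N -> (g'^-1 * g)%g a c = 0) ->
  (flag_space g i <= flag_space g' i)%VS.
Proof.
move=> H; apply/subvP => w /flag_spaceP[wW Hw]; apply/flag_spaceP; split=> // j ij.
have -> : (g'^-1%g : G) *m coords w = (g'^-1 * g)%g *m ((g^-1%g : G) *m coords w).
  by rewrite /= -mulmxA [g *m _]mulmxA mulmxV ?GLmx_valP // mul1mx.
rewrite mxE big1 // => c _; have [ic|ci] := leqP i c; first by rewrite Hw ?mulr0.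
by rewrite H ?mul0r ?ci.
Qed.

Definition flag_from g i : seq subspace := [seq flag_space g j | j <- rev (iota 0 i.+1)].

Lemma flag_fromS g i : flag_from g i.+1 = flag_space g i.+1 :: flag_from g i.
Proof. by rewrite /flag_from -[i.+2]addn1 iotaD rev_cat. Qed.

Definition mx_flag g := flag_from g m.

Lemma flag_from_flag g i : (i <= m)%N -> is_flag V (flag_space g i) (flag_from g i).
Proof.
elim: i => [|i IH] im; first by rewrite -[flag_from g 0]/[:: flag_space g 0] flag_space0 flag_last.
rewrite flag_fromS; apply: flag_cons (IH (ltnW im)).
exact: (covered_flag_space g (Ordinal im)).
Qed.

Lemma mx_flagP g : is_flag V W (mx_flag g).
Proof. by have := flag_from_flag g (leqnn m); rewrite flag_spaceT. Qed.

Lemma mx_flag_split g i : (i.+2 <= m)%N ->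
  mx_flag g = [seq flag_space g j | j <- rev (iota i.+3 (m - i.+2))]
     ++ [:: flag_space g i.+2, flag_space g i.+1, flag_space g i
         & [seq flag_space g j | j <- rev (iota 0 i)]].
Proof.
move=> im; rewrite /mx_flag /flag_from.
have -> : m.+1 = (i + 3 + (m - i.+2))%N by clear -im; lia.
rewrite !iotaD !add0n rev_cat map_cat addn3; congr (_ ++ _).
by rewrite rev_cat.
Qed.

Lemma mx_flag_eq g g' : (mx_flag g == mx_flag g') = upper_trig (g^-1 * g')%g.
Proof.
apply/eqP/idP => [e|u].
  have es i : (i <= m)%N -> flag_space g i = flag_space g' i.
    move=> im; have := congr1 (fun s => nth 0%VS (rev s) i) e.
    by rewrite /= /mx_flag /flag_from -!map_rev revK !(nth_map 0%N) ?size_iota // nth_iota.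
  apply/upper_trigP => a c ca.
  have : lift_coords (col c g') \in flag_space g' c.+1.
    rewrite (flag_spaceS (lift_coords_in (col c g')) (lift_coordsK _)).
    by rewrite memvE addvSr.
  rewrite -es // => /flag_spaceP[_ /(_ a ca)].
  by rewrite lift_coordsK colE mulmxA -colE mxE.
apply: eq_map => i; apply/eqP; rewrite eqEsubv; apply/andP; split; apply: flag_space_sub.
  move=> a c /andP[ci ia]; have := upper_trigV u; rewrite invMg invgK => /upper_trigP -> //.
  exact: leq_trans ia.
by move=> a c /andP[ci ia]; have /upper_trigP -> // := u; apply: leq_trans ia.
Qed.

Lemma flag_nth s U : is_flag V U s -> [/\ size s = (\dim U - \dim V).+1, nth 0%VS (rev s) 0 = V
  & forall i, (i < \dim U - \dim V)%N ->
      covered (nth 0%VS (rev s) i) (nth 0%VS (rev s) i.+1) /\ (nth 0%VS (rev s) i.+1 <= U)%VS].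
Proof.
move=> fs; elim/flag_ind: U s / fs => [|U X D XU fD [sD D0 Dc]].
  by rewrite subnn; split.
have [D' eD] := flag_head fD.
have dX := dimvS (flag_sub fD); have dU := covered_dim XU.
rewrite rev_cons; split.
- by rewrite /= sD dU subSn.
- by rewrite nth_rcons size_rev sD.
move=> i; rewrite dU subSn // ltnS leq_eqVlt => /orP[/eqP->|lt].
  rewrite !nth_rcons size_rev sD ltnSn ltnn eqxx; split=> //.
  have -> // : nth 0%VS (rev D) (\dim X - \dim V) = X.
  by rewrite nth_rev ?sD // subnn eD.
have [c1 c2] := Dc i lt; rewrite !nth_rcons size_rev sD !ltnS lt (ltnW lt); split=> //.
exact: subv_trans c2 (covered_sub XU).
Qed.

(** Any vectors v i in C i.+1 outside C i give the columns of [g]. They are independent modulo [V]: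
    in a relation, the last nonzero coefficient would put its v i into C i. *)
Lemma mx_flag_surj s : is_flag V W s -> exists g, mx_flag g = s.
Proof.
move=> fs; have [ss s0 sc] := flag_nth fs; pose C i := nth 0%VS (rev s) i.
have CV i : (i <= m)%N -> (V <= C i)%VS.
  elim: i => [|i IH] im; first by rewrite /C s0.
  by have [/covered_sub c _] := sc i im; apply: subv_trans c; apply: IH (ltnW im).
have Cmon i j : (i <= j)%N -> (j <= m)%N -> (C i <= C j)%VS.
  elim: j => [|j IH]; first by rewrite leqn0 => /eqP->.
  rewrite leq_eqVlt => /orP[/eqP->//|ij jm].
  by have [/covered_sub c _] := sc j jm; apply: subv_trans c; apply: IH (ltnW jm).
have exv (i : 'I_m) : exists v, (v \in C i.+1) && (v \notin C i).
  by have [/covered_ex[v v1 v2] _] := sc i (ltn_ord i); exists v; rewrite v1.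
pose v i := xchoose (exv i).
have vC i : v i \in C i.+1 by have /andP[] := xchooseP (exv i).
have vN i : v i \notin C i by have /andP[] := xchooseP (exv i).
have vW i : v i \in W by have [_ /subvP] := sc i (ltn_ord i); apply; apply: vC.
pose A : 'M[F]_m := \matrix_(a, i) coords (v i) a 0.
have Ac i : coords (v i) = col i A by apply/matrixP => a z; rewrite ord1 !mxE.
have uA : A \in unitmx.
  rewrite unitmxE -det_tr unitfE; apply/negP => /det0P[c cn0 cA].
  pose u := \sum_i c 0 i *: v i.
  have uW : u \in W by apply: memv_suml => i _; rewrite memvZ.
  have : coords u == 0.
    rewrite linear_sum; apply/eqP/matrixP => a z; rewrite ord1 summxE.
    transitivity ((c *m A^T) 0 a); last by rewrite cA !mxE.
    by rewrite mxE; apply: eq_bigr => i _; rewrite linearZ !mxE.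
  rewrite coords_eq0 // => uV.
  have H d (i : 'I_m) : (m - i <= d)%N -> c 0 i = 0.
    elim: d i => [|d IH] i; first by rewrite leqn0 subn_eq0 leqNgt ltn_ord.
    move=> id; apply/eqP; apply: contraT => ci; case/negP: (vN i).
    have : u \in C i by apply: (subvP (CV i _)) uV; apply: ltnW.
    rewrite /u (bigD1 i) //= => uC.
    rewrite -[v i]scale1r -(mulVf ci) -scalerA memvZ //.
    rewrite -[X in X \in _](addrK (\sum_(j | j != i) c 0 j *: v j)) memvB //.
    apply: memv_suml => j ji; have [ij|ij] := ltnP i j.
      by rewrite IH ?scale0r ?mem0v //; have := ltn_ord j; lia.
    have {}ij : (j < i)%N by rewrite ltn_neqAle ij andbT.
    by rewrite memvZ // (subvP (Cmon j.+1 i ij (ltnW (ltn_ord i)))).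
  by case/negP: cn0; apply/eqP/matrixP => z i; rewrite ord1 (H _ i (leqnn _)) mxE.
pose g : G := GLMx uA; exists g.
have gC i : (i <= m)%N -> flag_space g i = C i.
  elim: i => [|i IH] im; first by rewrite flag_space0 /C s0.
  have /= -> := @flag_spaceS g (Ordinal im) _ (vW _) (Ac _).
  rewrite IH ?(ltnW im) //.
  have [c _] := sc i im; symmetry; apply: (covered_addE c); first exact: (vC (Ordinal im)).
  exact: (vN (Ordinal im)).
rewrite -[RHS]revK -[rev s in RHS](mkseq_nth 0%VS) size_rev ss /mkseq -map_rev.
by apply/eq_in_map => i; rewrite mem_rev mem_iota add0n ltnS => /gC.
Qed.

Lemma flag_space_adj g (i i' : 'I_m) t j : i' = i.+1 :> nat -> (j <= m)%N -> j != i.+1 ->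
  flag_space (g * adj_GLmx i i' t)%g j = flag_space g j.
Proof.
move=> ei jm ji; have ii' : (i < i')%N by rewrite ei.
have dimf h e : (e <= m)%N -> \dim (flag_space h e) = (\dim V + e)%N.
  elim: e => [|e IH] em; first by rewrite flag_space0 addn0.
  by rewrite (covered_dim (covered_flag_space h (Ordinal em))) IH ?addnS // ltnW.
apply/eqP; rewrite eqEdim !dimf // leqnn andbT; apply: flag_space_sub => a c /andP[cj ja].
rewrite mulKg -[adj_GLmx _ _ _]mul1g adj_GLmxE // !GLmx1E.
have [ec|_] := eqVneq c i.
  rewrite ec in cj; have ia : (i < a)%N by apply: leq_trans ja.
  have -> : (a == i) = false by rewrite -val_eqE /= (gtn_eqF ia).
  rewrite mulr0 addr0; case: eqP => // ea.
  by case/eqP: ji; apply/eqP; rewrite eqn_leq cj andbT -ei -ea.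
have [ec|_] := eqVneq c i'.
  by rewrite ec in cj; case: eqP => // ea; move: (leq_trans cj ja); rewrite ea ltnNge (ltnW ii').
by case: eqP => // ea; move: (leq_trans cj ja); rewrite ea ltnn.
Qed.

(** Lifts of columns i and i' of [g] serve as v and v' in [between_sum]; then t v + v' lifts column
    i of [g * adj_GLmx i i' t]. This identifies (FS) for flags with [FSmx]. *)
Lemma mx_flag_adj_sum (M : zmodType) (psi : seq subspace -> M) g (i i' : 'I_m) s t :
    i' = i.+1 :> nat -> size t = i ->
    mx_flag g = s ++ [:: flag_space g i.+2, flag_space g i.+1, flag_space g i & t] ->
  \sum_(C | between (flag_space g i) (flag_space g i.+2) C)
      psi (s ++ [:: flag_space g i.+2, C, flag_space g i & t])
    = psi (mx_flag g) + \sum_u psi (mx_flag (g * adj_GLmx i i' u)%g).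
Proof.
move=> ei st es; have im : (i.+2 <= m)%N by rewrite -ei.
have [es1 et1] : s = [seq flag_space g j | j <- rev (iota i.+3 (m - i.+2))] /\
    t = [seq flag_space g j | j <- rev (iota 0 i)].
  have := mx_flag_split g im; rewrite es => /eqP; rewrite eqseq_cat; last first.
    have := congr1 size es; rewrite /mx_flag /flag_from size_map size_rev size_iota size_cat /= st.
    by rewrite size_map size_rev size_iota; lia.
  by case/andP => /eqP-> /eqP[->].
have adjE u : mx_flag (g * adj_GLmx i i' u)%g =
    s ++ [:: flag_space g i.+2, flag_space (g * adj_GLmx i i' u)%g i.+1, flag_space g i & t].
  have fE j : (j <= m)%N -> j != i.+1 -> flag_space (g * adj_GLmx i i' u)%g j = flag_space g j.
    exact: flag_space_adj.
  rewrite (mx_flag_split _ im) es1 et1 (fE i.+2) ?(fE i) //; try lia.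
  congr (_ ++ [:: _, _, _ & _]); apply/eq_in_map => j; rewrite mem_rev mem_iota => /andP[j1 j2].
    by apply: fE; lia.
  by apply: fE; lia.
rewrite es; under [in RHS]eq_bigr => u _ do rewrite adjE.
have cE (j : 'I_m) : coords (lift_coords (col j g)) = col j g by apply: lift_coordsK.
pose v := lift_coords (col i g); pose v' := lift_coords (col i' g).
have e1 : flag_space g i.+1 = (flag_space g i + <[v]>)%VS by apply: flag_spaceS (lift_coords_in _) (cE i).
have e2 : flag_space g i.+2 = (flag_space g i + <[v]> + <[v']>)%VS.
  by rewrite -e1 -ei; apply: flag_spaceS (lift_coords_in _) (cE i').
rewrite (@between_sum _ _ _ (fun C => psi (s ++ [:: flag_space g i.+2, C, flag_space g i & t]))
  _ _ v v') //; last 2 first.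
- exact: flag_space_notin (cE i).
- by rewrite -e1 -ei; apply: flag_space_notin (cE i').
rewrite -e1; congr (_ + _); apply: eq_bigr => u _.
congr (psi (_ ++ [:: _, _, _ & _])); rewrite -(flag_space_adj g u ei (ltnW (ltn_ord i))); last first.
  by rewrite neq_ltn ltnSn.
symmetry; apply: flag_spaceS; first by rewrite memvD ?memvZ ?lift_coords_in.
rewrite linearD linearZ /= !lift_coordsK; apply/matrixP => a z.
by rewrite [RHS]mxE adj_GLmxE ?ei // eqxx !mxE addrC.
Qed.

End FlagsOfMatrices.

(** * Functions on flags as functions on matrices, and the action of GL(W/V) *)

Section MatrixCochains.
Variables (F : finFieldType) (n : nat) (V W : {vspace 'rV[F]_n}) (VW : (V <= W)%VS).
Local Notation subspace := {vspace 'rV[F]_n}.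
Local Notation m := (\dim W - \dim V)%N.
Variable theta : lin_iso (subquot V W) 'cV[F]_m.
Local Notation G := (GLmx F m).
Implicit Types (w x : 'rV[F]_n) (g : G) (h : GL (subquot V W)) (X Y : subspace).

Lemma flag_replace U (A B C C' : subspace) s t : is_flag V U (s ++ [:: B, C, A & t]) ->
  covered A C' -> covered C' B -> is_flag V U (s ++ [:: B, C', A & t]).
Proof.
case: s => [|X s] /=.
  by case/and3P=> -> /and3P[_ _ ->] -> -> ->.
rewrite !cat_path !last_cat /= => /and3P[-> /and3P[-> -> /and3P[_ _ ->]] ->] -> ->.
by [].
Qed.

Section Cochains.
Variable M : zmodType.

Lemma FS_mx (psi : seq subspace -> M) : FS V W psi -> FSmx (fun g => psi (mx_flag theta g)).
Proof.
move=> fs g i i' ei; have im : (i.+2 <= m)%N by rewrite -ei.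
have e := mx_flag_split theta g im.
rewrite -(mx_flag_adj_sum VW psi ei _ e) ?size_map ?size_rev ?size_iota //.
have c1 := covered_flag_space theta g i.
have c2 : covered (flag_space theta g i.+1) (flag_space theta g i.+2).
  by rewrite -ei; apply: covered_flag_space.
have [AB dB] : (flag_space theta g i <= flag_space theta g i.+2)%VS /\
  \dim (flag_space theta g i.+2) = (\dim (flag_space theta g i) + 2)%N.
  by apply: (@between_dim _ _ _ _ (flag_space theta g i.+1)); rewrite /between c1.
apply: fs => // C /andP[C1 C2]; apply: (flag_replace (C := flag_space theta g i.+1) _ C1 C2).
by rewrite -e; apply: mx_flagP.
Qed.

Definition mx_cochain (a : G -> M) (s : seq subspace) : M :=
  if [pick g | mx_flag theta g == s] is Some g then a g else 0.

Lemma mx_cochainE a g : B_inv a -> mx_cochain a (mx_flag theta g) = a g.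
Proof.
move=> Ba; rewrite /mx_cochain; case: pickP => [g'|/(_ g)]; last by rewrite eqxx.
by rewrite mx_flag_eq // => u; rewrite -(Ba g' _ u) mulKVg.
Qed.

Lemma mx_cochain_FS a : B_inv a -> FSmx a -> FS V W (mx_cochain a).
Proof.
move=> Ba Fa s A B t AB dB fl; have [C0 C0b] := between_ex AB dB.
have [g eg] := mx_flag_surj VW theta (fl _ C0b).
have sz : m.+1 = (size s + (size t).+3)%N.
  by have := congr1 size eg; rewrite /mx_flag /flag_from size_map size_rev size_iota size_cat.
have im : ((size t).+2 <= m)%N by lia.
have im' : ((size t) < m)%N by lia.
have := mx_flag_split theta g im; rewrite eg => /eqP; rewrite eqseq_cat; last first.
  by rewrite size_map size_rev size_iota -[RHS]subSS sz addnK.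
case/andP=> _ /eqP[eB eC eA _].
rewrite eA eB eC in eg *.
rewrite (@mx_flag_adj_sum _ _ _ _ VW theta _ _ g (Ordinal im') (Ordinal im)) //.
rewrite mx_cochainE // -[RHS](Fa g (Ordinal im') (Ordinal im)) //; congr (_ + _).
by apply: eq_bigr => u _; rewrite mx_cochainE.
Qed.

(** Extension by 0 to flags from other subspaces: the right action needs a function in FS for all
    top subspaces at once. *)
Definition restrict_head (psi : seq subspace -> M) (s : seq subspace) : M :=
  if head 0%VS s == W then psi s else 0.

Lemma restrict_headE psi s : is_flag V W s -> restrict_head psi s = psi s.
Proof. by move=> fs; have [s' ->] := flag_head fs; rewrite /restrict_head /= eqxx. Qed.

Lemma restrict_head_FS psi : FS V W psi -> FSall V (restrict_head psi).
Proof.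
move=> fs U; have [->|ne] := eqVneq U W.
  by apply: FS_ext fs => s fs; rewrite restrict_headE.
apply: (@FS_ext _ _ V M U (fun=> 0)) => [s fs'|]; last exact: FS0.
by have [s' ->] := flag_head fs'; rewrite /restrict_head /= (negPf ne).
Qed.

End Cochains.

Lemma GL_subspaceP h X w : reflect
  (w \in W /\ exists2 x, x \in X & to_subquot V W w = h (to_subquot V W x))
  (w \in GL_subspace h X).
Proof.
have hl := iso_linear h.
rewrite /GL_subspace span_enumP /=.
- apply: (iffP andP) => -[wW H]; split=> //.
    by have /existsP[x /andP[xX /eqP e]] := H; exists x.
  by have [x xX e] := H; apply/existsP; exists x; rewrite xX e eqxx.
- rewrite mem0v /=; apply/existsP; exists 0; rewrite mem0v /=.
  have t0 : to_subquot V W 0 = 0 by rewrite /to_subquot !linear0.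
  by have := hl (-1) 0 0; rewrite scaler0 addr0 scaleN1r addNr t0 => ->.
move=> a u v /andP[uW /existsP[x /andP[xX /eqP ex]]] /andP[vW /existsP[y /andP[yX /eqP ey]]].
rewrite memvD ?memvZ //=; apply/existsP; exists (a *: x + y).
by rewrite memvD ?memvZ //= !to_subquot_linear ex ey hl.
Qed.

Lemma coords_GL h w x : to_subquot V W w = h (to_subquot V W x) <->
  coords theta w = coord_GLmx theta h *m coords theta x.
Proof.
rewrite -coord_mxE /coords; split=> [->//|].
exact: (can_inj (iso_funK theta)).
Qed.

Lemma GL_flag_space h g i : GL_subspace h (flag_space theta g i)
  = flag_space theta (coord_GLmx theta h * g)%g i.
Proof.
apply/vspaceP => w; apply/GL_subspaceP/flag_spaceP.
  move=> [wW [x /flag_spaceP[xW Hx] /coords_GL e]]; split=> // j ij.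
  by rewrite e invMg /= -mulmxA mulKmx ?coord_mx_unit // Hx.
move=> [wW Hw]; split=> //.
exists (lift_coords theta (((coord_GLmx theta h)^-1%g : G) *m coords theta w)).
  apply/flag_spaceP; split=> [|j ij]; first exact: lift_coords_in.
  rewrite lift_coordsK; have := Hw j ij; rewrite invMg /= mulmxA; done.
apply/coords_GL; rewrite lift_coordsK mulmxA mulmxV ?mul1mx //.
exact: GLmx_valP.
Qed.

Lemma GL_mx_flag h g : map (GL_subspace h) (mx_flag theta g)
  = mx_flag theta (coord_GLmx theta h * g)%g.
Proof. by rewrite /mx_flag /flag_from -map_comp; apply: eq_map => i; apply: GL_flag_space. Qed.

Lemma to_subquotB_eq x y : x \in W -> y \in W ->
  to_subquot V W x = to_subquot V W y -> x - y \in V.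
Proof.
move=> xW yW e; rewrite -(coords_eq0 theta) ?memvB // linearB subr_eq0.
by rewrite /= /coords e.
Qed.

Lemma GL_subspaceI h X Y : (V <= X <= W)%VS -> (V <= Y <= W)%VS ->
  GL_subspace h (X :&: Y)%VS = (GL_subspace h X :&: GL_subspace h Y)%VS.
Proof.
move=> /andP[VX XW] /andP[VY YW]; apply/vspaceP => w; rewrite memv_cap.
apply/GL_subspaceP/andP => [[wW [x xXY e]]|[]].
  move: xXY; rewrite memv_cap => /andP[xX xY].
  by split; apply/GL_subspaceP; split=> //; exists x.
move=> /GL_subspaceP[wW [x xX ex]] /GL_subspaceP[_ [y yY ey]]; split=> //.
exists x => //; rewrite memv_cap xX /=.
have exy : to_subquot V W x = to_subquot V W y.
  by apply: (can_inj (iso_funK h)); rewrite -ex.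
have := to_subquotB_eq (subvP XW _ xX) (subvP YW _ yY) exy.
by move=> /(subvP VY) xyY; rewrite -[x](subrK y) memvD.
Qed.

Lemma GL_subspaceK h X : (V <= X <= W)%VS -> GL_subspace (h^-1)%g (GL_subspace h X) = X.
Proof.
move=> /andP[VX XW]; apply/vspaceP => w; apply/GL_subspaceP/idP => [[wW [x]]|wX].
  move=> /GL_subspaceP[xW [y yX e]] ew.
  have {}ew : to_subquot V W w = to_subquot V W y by rewrite ew e /= iso_funK.
  have := to_subquotB_eq wW (subvP XW _ yX) ew.
  by move=> /(subvP VX) xyY; rewrite -[w](subrK y) memvD.
have wW := subvP XW _ wX; split=> //.
pose x := lift_coords theta (coord_GLmx theta h *m coords theta w).
have ex : to_subquot V W x = h (to_subquot V W w) by apply/coords_GL; rewrite lift_coordsK.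
exists x; last by rewrite ex /= iso_funK.
by apply/GL_subspaceP; split; [apply: lift_coords_in | exists w].
Qed.

Lemma GL_subspaceV h : GL_subspace h V = V.
Proof.
have := GL_flag_space h 1%g 0; rewrite !flag_space0 //.
Qed.

(** Lift [h] to a linear map f with values in [W]: the subspace is the direct sum of [V] and f(X),
    while the kernel of f meets X in [V]. *)
Lemma dim_GL_subspace h X : (V <= X <= W)%VS -> \dim (GL_subspace h X) = \dim X.
Proof.
move=> /andP[VX XW].
pose f := linfun (lift_coords theta \o mulmx (coord_GLmx theta h) \o coords theta).
have fE x : f x = lift_coords theta (coord_GLmx theta h *m coords theta x) by rewrite lfunE.
have fV x : x \in W -> (f x == 0) = (x \in V).
  move=> xW; rewrite -(coords_eq0 theta xW) fE; apply/eqP/eqP => [e|->].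
    have := congr1 (coords theta) e; rewrite lift_coordsK linear0.
    by move/(congr1 (mulmx ((coord_GLmx theta h)^-1%g : G))); rewrite GLmxVK mulmx0.
  by rewrite mulmx0 linear0.
have eX : GL_subspace h X = (V + f @: X)%VS.
  apply/vspaceP => w; apply/GL_subspaceP/memv_addP.
    move=> [wW [x xX /coords_GL e]]; exists (w - f x); last first.
      by exists (f x); rewrite ?memv_img // subrK.
    rewrite -(coords_eq0 theta) ?memvB ?fE ?lift_coords_in // linearB /= lift_coordsK e.
    by rewrite subrr.
  move=> [v vV [u /memv_imgP[x xX ->] ->]]; split.
    by rewrite fE memvD ?lift_coords_in //; apply: (subvP VW).
  exists x => //; apply/coords_GL; rewrite linearD /= fE lift_coordsK.
  by have := vV; rewrite -(coords_eq0 theta) ?(subvP VW) // => /eqP->; rewrite add0r.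
rewrite eX; have d1 := limg_ker_dim f X; have d2 := dimv_sum_cap V (f @: X).
have e1 : (X :&: lker f)%VS = V.
  apply/vspaceP => x; rewrite memv_cap memv_ker; apply/andP/idP => [[xX]|xV].
    by rewrite fV // (subvP XW).
  by rewrite (subvP VX) // fV // (subvP VW).
have e2 : (V :&: f @: X)%VS = 0%VS.
  apply/eqP; rewrite -subv0; apply/subvP => u; rewrite memv_cap => /andP[uV /memv_imgP[x xX eu]].
  move: uV; rewrite -(coords_eq0 theta); last by rewrite eu fE lift_coords_in.
  by rewrite eu fE lift_coordsK => /eqP->; rewrite linear0 mem0v.
by rewrite e2 dimv0 addn0 in d2; rewrite e1 in d1; rewrite d2 d1.
Qed.

Lemma GL_flag_pair h s t : is_flag V W s -> is_flag V W t ->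
  flag_pair V (map (GL_subspace h) t) (map (GL_subspace h) s) = flag_pair V t s.
Proof.
move=> fs ft; apply: (@flag_pair_map _ _ _ _ W) fs ft => //.
- exact: GL_subspaceI.
- move=> X Y Xi Yi /(congr1 (GL_subspace h^-1%g)).
  by rewrite (GL_subspaceK h Xi) (GL_subspaceK h Yi).
- exact: dim_GL_subspace.
exact: GL_subspaceV.
Qed.

End MatrixCochains.

(** * The weight space of the standard module *)

Section WeightSpace.
Variables (F : finFieldType) (n : nat) (k : fieldType) (V W : {vspace 'rV[F]_n}).
Hypothesis VW : (V <= W)%VS.
Local Notation m := (\dim W - \dim V)%N.
Variable theta : lin_iso (subquot V W) 'cV[F]_m.
Local Notation G := (GLmx F m).
Local Notation GLq := (GL (subquot V W)).
Local Notation SV := (subvs_of (St k F m)).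
Local Notation e_St := (steinberg_elt k F m).
Implicit Types (g : G) (h : GLq) (a b : SV).

Lemma coord_GLmxM h h' : coord_GLmx theta (h * h')%g = (coord_GLmx theta h * coord_GLmx theta h')%g.
Proof.
apply/val_inj/matrixP => i j.
have cE (A : 'M[F]_m) : A i j = (A *m (delta_mx j 0 : 'cV_m)) i 0 by rewrite -colE mxE.
rewrite cE [RHS]cE; congr (fun_of_matrix _ _ _).
rewrite -[delta_mx j 0](iso_invK theta) /= -mulmxA -!coord_mxE.
by [].
Qed.

Lemma coord_GLmx1 : coord_GLmx theta 1%g = 1%g.
Proof. by apply: (mulgI (coord_GLmx theta 1%g)); rewrite -coord_GLmxM !mulg1. Qed.

Lemma coord_GLmxV h : coord_GLmx theta h^-1%g = ((coord_GLmx theta h)^-1)%g.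
Proof. by apply: (mulgI (coord_GLmx theta h)); rewrite -coord_GLmxM !mulgV coord_GLmx1. Qed.

Lemma coord_GLmx_surj g : exists h, coord_GLmx theta h = g.
Proof.
pose f u := iso_inv theta (g *m theta u); pose f' u := iso_inv theta (invmx g *m theta u).
have fl : linear f by move=> b u v; rewrite /f iso_linear mulmxDr -scalemxAr iso_inv_linear.
have fK : cancel f f'.
  by move=> u; rewrite /f /f' iso_invK mulKmx ?GLmx_valP // iso_funK.
have f'K : cancel f' f.
  by move=> u; rewrite /f /f' iso_invK mulKVmx ?GLmx_valP // iso_funK.
exists (LinIso fl fK f'K); apply/val_inj/matrixP => i j.
by rewrite /= mxE /= /f !iso_invK -colE mxE.
Qed.

Lemma St_inv a : B_inv (vsval a) /\ FSmx (vsval a).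
Proof. by apply/StP/subvsP. Qed.

Lemma St_rep_in h a : grp_mul (grp_elt k (coord_GLmx theta h)) (vsval a) \in St k F m.
Proof.
have [Ba Fa] := St_inv a; apply/StP; split=> [g b ub|g i i' ei]; rewrite !grp_elt_mul.
  by rewrite mulgA Ba.
under eq_bigr => t _ do rewrite grp_elt_mul mulgA.
exact: Fa.
Qed.

Lemma St_repE h a g : vsval (St_rep k theta h a) g = vsval a ((coord_GLmx theta h)^-1 * g)%g.
Proof. by rewrite /St_rep vsprojK ?St_rep_in // grp_elt_mul. Qed.

Lemma SV_eq a b : (forall g, vsval a g = vsval b g) -> a = b.
Proof. by move=> e; apply/val_inj/ffunP. Qed.

Lemma SV_linE c a b g : vsval (c *: a + b) g = c * vsval a g + vsval b g.
Proof. by rewrite linearP !ffunE. Qed.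

Lemma SV_scaleE c a g : vsval (c *: a) g = c * vsval a g.
Proof. by rewrite linearZ ffunE. Qed.

Lemma St_rep_is_rep : is_rep (St_rep k theta).
Proof.
split=> [h c a b|a|h h' a]; apply: SV_eq => g.
- by rewrite SV_linE !St_repE SV_linE.
- by rewrite St_repE coord_GLmx1 invg1 mul1g.
by rewrite !St_repE coord_GLmxM invMg mulgA.
Qed.

Lemma apartment_in (L : G) : grp_mul (grp_elt k L) e_St \in St k F m.
Proof. by apply/left_idealP; exists (grp_elt k L). Qed.

(** The signed sum of the flags L s B over the permutations s, that is, the class of an apartment of
    the building. *)
Definition apartment (L : G) : SV := vsproj (St k F m) (grp_mul (grp_elt k L) e_St).

Lemma apartmentE L g : vsval (apartment L) g = e_St (L^-1 * g)%g.
Proof. by rewrite vsprojK ?apartment_in // grp_elt_mul. Qed.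

Lemma SV_expand a : a = \sum_(L : G | lower_unitrig L) (vsval a L : k) *: apartment L.
Proof.
have [Ba Fa] := St_inv a; apply: val_inj; rewrite /= [LHS](St_expand Ba Fa) linear_sum.
by apply: eq_bigr => L _; rewrite linearZ /= vsprojK ?apartment_in.
Qed.

Definition flag_vec g : Delta_wt V k W := DeltaWt (flag_class_wt k (mx_flagP VW theta g)).

Lemma flag_vec_of s (x : Delta_wt V k W) : is_flag V W s ->
  Delta_wt_val x = flag_class_k V k s -> exists2 g, mx_flag theta g = s & x = flag_vec g.
Proof.
move=> fs ex; have [g eg] := mx_flag_surj VW theta fs.
by exists g => //; apply: val_inj; rewrite /= ex eg.
Qed.

Lemma flag_vec_B_inv : B_inv flag_vec.
Proof.
move=> g u uu; apply: val_inj; congr (flag_class_k V k _).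
by apply/eqP; rewrite eq_sym mx_flag_eq // mulKg.
Qed.

Lemma flag_vec_FS : FSmx flag_vec.
Proof.
move=> g i i' ei; apply: val_inj; rewrite raddfD raddf_sum raddf0 /=.
exact: (FS_mx VW theta (@flag_class_k_FS F n V k W)).
Qed.

Lemma Delta_wt_flag_ind (Q : Delta_wt V k W -> Prop) : Q 0 ->
  (forall c g x, Q x -> Q (c *: flag_vec g + x)) -> forall x, Q x.
Proof.
move=> Q0 QS [x xP]; have [x' -> //] : exists2 x' : Delta_wt V k W, DeltaWt xP = x' & Q x'.
suff [x' ex Qx] : exists2 x' : Delta_wt V k W, x = Delta_wt_val x' & Q x'.
  by exists x' => //; apply: val_inj.
elim/Delta_wt_ind: x / xP => [|c s x fs [x' -> Qx]]; first by exists 0.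
have [g <-] := mx_flag_surj VW theta fs.
by exists (c *: flag_vec g + x'); last exact: QS.
Qed.

Definition eval_wt a (x : Delta_wt V k W) : k^o :=
  Delta_k_eval (restrict_head W (mx_cochain theta (vsval a : G -> k^o))) (Delta_wt_val x).

Lemma eval_wt_FS a : FSall V (restrict_head W (mx_cochain theta (vsval a : G -> k^o))).
Proof. by have [Ba Fa] := St_inv a; apply: restrict_head_FS; apply: mx_cochain_FS. Qed.

Lemma eval_wt_linr a : linear (eval_wt a).
Proof. by move=> c x y; rewrite /eval_wt -(Delta_k_eval_linear (eval_wt_FS a)). Qed.

Lemma eval_wt0 a : eval_wt a 0 = 0.
Proof. by have := eval_wt_linr a (-1) 0 0; rewrite scaler0 addr0 scaleN1r addNr. Qed.

Lemma eval_wt_flag a g : eval_wt a (flag_vec g) = vsval a g.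
Proof.
have [Ba Fa] := St_inv a; have fg := mx_flagP VW theta g.
by rewrite /eval_wt (Delta_k_eval_class (eval_wt_FS a) fg) (restrict_headE _ fg) mx_cochainE.
Qed.

Lemma eval_wt_linl x : linear (eval_wt^~ x).
Proof.
move=> c a b; elim/Delta_wt_flag_ind: x => [|d g x IH].
  by rewrite !eval_wt0 scaler0 addr0.
rewrite !eval_wt_linr IH !eval_wt_flag SV_linE !scalerDr addrACA; congr (_ + _ + _).
exact: mulrCA.
Qed.

Definition eval_hom (x : Delta_wt V k W) : 'Hom(SV, k^o) := linfun (eval_wt^~ x).

Lemma eval_homE x a : eval_hom x a = eval_wt a x.
Proof.
pose f : {linear SV -> k^o} := HB.pack (eval_wt^~ x) (GRing.isLinear.Build _ _ _ _ _ (eval_wt_linl x)).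
exact: (lfunE f).
Qed.

Lemma eval_hom_linear : linear eval_hom.
Proof.
by move=> c x y; apply/lfunP => a; rewrite add_lfunE scale_lfunE !eval_homE eval_wt_linr.
Qed.

(** Flag vectors are themselves B-invariant and satisfy (FS), so [FSmx_expand] applies to them:
    those of the big cell form a basis, with coordinates given by the apartments. *)
Lemma Delta_wt_expand x : x = \sum_(L : G | lower_unitrig L) (eval_wt (apartment L) x : k) *: flag_vec L.
Proof.
elim/Delta_wt_flag_ind: x => [|c g x IH].
  by rewrite big1 // => L _; rewrite eval_wt0 scale0r.
rewrite [in LHS]IH [flag_vec g in LHS](FSmx_expand g flag_vec_B_inv flag_vec_FS) scaler_sumr -big_split.
apply: eq_bigr => L _ /=; rewrite scalerA -scalerDl; congr (_ *: _).
by rewrite eval_wt_linr eval_wt_flag apartmentE.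
Qed.

Definition hom_vec (phi : 'Hom(SV, k^o)) : Delta_wt V k W :=
  \sum_(L : G | lower_unitrig L) (phi (apartment L) : k) *: flag_vec L.

Lemma eval_homK : cancel eval_hom hom_vec.
Proof.
move=> x; rewrite [RHS]Delta_wt_expand; apply: eq_bigr => L _.
by rewrite eval_homE.
Qed.

Lemma eval_wt_sum a (I : finType) (P : pred I) (c : I -> k) (x : I -> Delta_wt V k W) :
  eval_wt a (\sum_(i | P i) c i *: x i) = \sum_(i | P i) c i * eval_wt a (x i).
Proof.
elim: (index_enum I) => [|i s IH]; first by rewrite !big_nil eval_wt0.
by rewrite !big_cons; case: ifP => // _; rewrite eval_wt_linr IH.
Qed.

Lemma hom_vecK : cancel hom_vec eval_hom.
Proof.
move=> phi; apply/lfunP => a; rewrite eval_homE eval_wt_sum [in RHS](SV_expand a) linear_sum.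
by apply: eq_bigr => L _; rewrite linearZ eval_wt_flag mulrC.
Qed.

Definition wt_action h (x : Delta_wt V k W) : Delta_wt V k W :=
  \sum_(L : G | lower_unitrig L) (eval_wt (apartment L) x : k) *: flag_vec (coord_GLmx theta h * L)%g.

Lemma wt_action_linear h : linear (wt_action h).
Proof.
move=> c x y; rewrite /wt_action scaler_sumr -big_split; apply: eq_bigr => L _ /=.
by rewrite eval_wt_linr scalerA -scalerDl.
Qed.

(** [wt_action] is prescribed on the big cell only. It permutes all flags because the translate of
    [flag_vec] is again B-invariant and satisfies (FS), hence is determined there. *)
Lemma wt_action_flag h g : wt_action h (flag_vec g) = flag_vec (coord_GLmx theta h * g)%g.
Proof.
rewrite [RHS](@FSmx_expand k F m _ (fun g => flag_vec (coord_GLmx theta h * g)%g)) //.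
- by apply: eq_bigr => L _; rewrite eval_wt_flag apartmentE.
- by move=> g' u uu; rewrite mulgA; apply: flag_vec_B_inv.
move=> g' i i' ei /=; under eq_bigr => t _ do rewrite mulgA.
exact: flag_vec_FS.
Qed.

Lemma linear_at0 (M N : lmodType k) (f : M -> N) : linear f -> f 0 = 0.
Proof. by move=> /(_ (-1) 0 0); rewrite scaler0 addr0 scaleN1r addNr. Qed.

Section Action.
Variable rho : GLq -> Delta_wt V k W -> Delta_wt V k W.
Hypothesis rho_flag : flag_action rho.

Lemma flag_action_vec h g : rho h (flag_vec g) = flag_vec (coord_GLmx theta h * g)%g.
Proof.
have [_ rf] := rho_flag; apply: val_inj.
rewrite /= (rf h (mx_flag theta g)) ?GL_mx_flag //; exact: mx_flagP.
Qed.

Lemma eval_wt_action h a x : eval_wt a (rho h x) = eval_wt (St_rep k theta h^-1%g a) x.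
Proof.
have [[rl _ _] _] := rho_flag.
elim/Delta_wt_flag_ind: x => [|c g x IH]; first by rewrite (linear_at0 (rl h)) !eval_wt0.
rewrite rl !eval_wt_linr IH flag_action_vec !eval_wt_flag St_repE.
by rewrite coord_GLmxV invgK.
Qed.

Lemma Delta_wt_iso_St_dual : rep_iso rho (dual_rep (St_rep k theta)).
Proof.
pose f : {linear Delta_wt V k W -> 'Hom(SV, k^o)} :=
  HB.pack eval_hom (GRing.isLinear.Build _ _ _ _ _ eval_hom_linear).
exists f; split; first by exists hom_vec; [apply: eval_homK | apply: hom_vecK].
move=> h x; apply/lfunP => a; rewrite /= eval_homE eval_wt_action.
have [Sl _ _] := St_rep_is_rep.
have dl : linear (fun a => eval_hom x (St_rep k theta h^-1%g a)).
  by move=> c a1 a2; rewrite Sl linearP.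
pose d : {linear SV -> k^o} := HB.pack (fun a => eval_hom x (St_rep k theta h^-1%g a))
  (GRing.isLinear.Build _ _ _ _ _ dl).
by rewrite /dual_rep (lfunE d) /= eval_homE.
Qed.

End Action.

Lemma wt_action_flag_action : flag_action wt_action.
Proof.
split; first split.
- exact: wt_action_linear.
- elim/Delta_wt_flag_ind=> [|c g x IH]; first exact: linear_at0 (wt_action_linear _).
  by rewrite wt_action_linear IH wt_action_flag coord_GLmx1 mul1g.
- move=> h h'; elim/Delta_wt_flag_ind=> [|c g x IH].
    by rewrite !(linear_at0 (wt_action_linear _)).
  by rewrite !wt_action_linear IH !wt_action_flag coord_GLmxM mulgA.
move=> h s x fs ex; have [g <- ->] := flag_vec_of fs ex.
by rewrite wt_action_flag /= GL_mx_flag.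
Qed.

End WeightSpace.

(** * The socle of the Steinberg representation *)

Section Socle.
Variables (F : finFieldType) (n : nat) (k : fieldType) (V W : {vspace 'rV[F]_n}).
Hypothesis VW : (V <= W)%VS.
Local Notation m := (\dim W - \dim V)%N.
Variable theta : lin_iso (subquot V W) 'cV[F]_m.
Hypothesis q_neq0 : (#|F|%:R : k) != 0.
Local Notation G := (GLmx F m).
Local Notation GLq := (GL (subquot V W)).
Local Notation SV := (subvs_of (St k F m)).
Local Notation St_act := (St_rep k theta).
Implicit Types (g : G) (h : GLq) (a b : SV) (x y : Delta_k V k).
Local Notation fvec g := (flag_class_k V k (mx_flag theta g)).
Local Notation flag_vec := (flag_vec k VW theta).

Lemma form_k_biadditive :
  biadditive ((fun u v => (flag_form u v)%:~R) : Delta V -> Delta V -> k^o).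
Proof.
by have [fr fl] := flag_form_biadditive V; split=> u v w; rewrite ?fr ?fl rmorphB.
Qed.

Lemma form_k_linear_r x : linear (form_k x : Delta_k V k -> k^o).
Proof. exact: (tens_bilin_linear_r form_k_biadditive x). Qed.

Lemma form_k_class s t : form_k (flag_class_k V k s) (flag_class_k V k t)
  = (flag_form (Delta_class V s) (Delta_class V t))%:~R.
Proof. exact: (tens_bilin_mk form_k_biadditive). Qed.

Lemma form_fvec g g' :
  form_k (fvec g) (fvec g') = (flag_pair V (mx_flag theta g') (mx_flag theta g))%:~R.
Proof. by rewrite form_k_class (@flag_form_class _ _ _ W) //; apply: mx_flagP. Qed.

Lemma form_fvec_sym g g' : form_k (fvec g) (fvec g') = form_k (fvec g') (fvec g).
Proof. by rewrite !form_fvec (@flag_pair_sym _ _ _ W) //; apply: mx_flagP. Qed.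

Lemma form_fvec_inv f g g' : form_k (fvec (f * g)%g) (fvec (f * g')%g) = form_k (fvec g) (fvec g').
Proof.
have [h <-] := coord_GLmx_surj theta f.
rewrite !form_fvec -!GL_mx_flag (GL_flag_pair VW theta) //; exact: mx_flagP.
Qed.

Lemma form_fvec_diag g : form_k (fvec g) (fvec g) != 0.
Proof.
rewrite form_fvec; have [e ->] := flag_pair_diag (mx_flagP VW theta g).
by rewrite -[(_ ^ _)%N%:~R]/((#|F| ^ e)%N%:R) natrX expf_neq0.
Qed.

Lemma form_wt_orth (x : Delta_wt V k W) U s : is_flag V U s -> U != W ->
  form_k (Delta_wt_val x) (flag_class_k V k s) = 0.
Proof.
move=> fs ne; have fl := form_k_linear_l (flag_class_k V k s).
elim/(@Delta_wt_flag_ind F n k V W VW theta): x => [|c g x IH]; first exact: (linear_at0 fl).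
rewrite [LHS]fl IH addr0 form_k_class.
by rewrite (flag_form_class0 (mx_flagP VW theta g) fs ne) [LHS]mulr0.
Qed.

Definition gram_fun x : grp_alg k G := [ffun g => form_k x (fvec g)].

Lemma gram_funE x g : gram_fun x g = form_k x (fvec g).
Proof. by rewrite ffunE. Qed.

Lemma gram_in x : gram_fun x \in St k F m.
Proof.
have fl := form_k_linear_r x.
pose f : {linear Delta_k V k -> k^o} :=
  HB.pack (form_k x : Delta_k V k -> k^o) (GRing.isLinear.Build _ _ _ _ _ fl).
apply/StP; split=> [g u uu|g i i' ei].
  rewrite !gram_funE; congr (form_k x).
  exact: (congr1 (@Delta_wt_val F n V k W) (@flag_vec_B_inv F n k V W VW theta g u uu)).
rewrite gram_funE; under eq_bigr => t _ do rewrite gram_funE.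
have fs : FS V W (fun s => f (flag_class_k V k s)).
  by move=> s A B t AB dB fl'; rewrite -(raddf_sum f) (flag_class_k_FS k AB dB fl') raddf0.
exact: (FS_mx VW theta fs g ei).
Qed.

Definition gram x : SV := vsproj (St k F m) (gram_fun x).

Lemma gramE x g : vsval (gram x) g = form_k x (fvec g).
Proof. by rewrite vsprojK ?gram_in // gram_funE. Qed.

Lemma gram_linear : linear gram.
Proof.
move=> c x y; apply: SV_eq => g; rewrite SV_linE !gramE.
exact: (form_k_linear_l (fvec g)).
Qed.
HB.instance Definition _ := GRing.isLinear.Build k (Delta_k V k) SV _ gram gram_linear.

Lemma gram_rad x : x \in @rad_pred F n V k -> gram x = 0.
Proof.
by move=> /asboolP H; apply: SV_eq => g; rewrite gramE H linear0 ffunE.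
Qed.

(** Flags from other subspaces are orthogonal to the weight space, so vanishing against the flags
    from [W] is vanishing against everything. *)
Lemma gram_wt_eq0 (x : Delta_wt V k W) : gram (Delta_wt_val x) = 0 ->
  Delta_wt_val x \in @rad_pred F n V k.
Proof.
move=> gx; apply/asboolP => y; have fl := form_k_linear_r (Delta_wt_val x).
elim/Delta_k_ind: y => [|c U s y fs IH]; first exact: (linear_at0 fl).
rewrite [LHS]fl IH addr0; have [eU|ne] := eqVneq U W; last first.
  by rewrite (form_wt_orth _ fs ne) scaler0.
rewrite eU in fs; have [g <-] := mx_flag_surj VW theta fs.
by rewrite -gramE gx linear0 ffunE scaler0.
Qed.

Lemma gram_fvec_rep h g : St_act h (gram (fvec g)) = gram (fvec (coord_GLmx theta h * g)%g).
Proof.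
apply: SV_eq => g'; rewrite St_repE // [LHS]gramE [RHS]gramE.
apply: etrans (esym (form_fvec_inv (coord_GLmx theta h) g _)) _.
by rewrite mulKVg.
Qed.

Lemma St_act_sum h (I : finType) (P : pred I) (c : I -> k) (v : I -> SV) :
  St_act h (\sum_(i | P i) c i *: v i) = \sum_(i | P i) c i *: St_act h (v i).
Proof.
have [Sl _ _] := St_rep_is_rep k theta.
elim: (index_enum I) => [|i s IH]; first by rewrite !big_nil (linear_at0 (Sl h)).
by rewrite !big_cons; case: ifP => // _; rewrite Sl IH.
Qed.

(** Indexing by the group algebra makes the span a [limg] and provides, through the inverse of
    [linfun gram_comb], linearly chosen coefficients for [gram_pair]. *)
Definition gram_comb (c : grp_alg k G) : SV := \sum_g (c g : k) *: gram (fvec g).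

Lemma gram_comb_sum c : gram_comb c = \sum_g (c g : k) *: gram (fvec g).
Proof. by []. Qed.

Lemma gram_comb_linear : linear gram_comb.
Proof.
move=> t c d; rewrite /gram_comb scaler_sumr -big_split; apply: eq_bigr => g _ /=.
by rewrite !ffunE scalerA -scalerDl.
Qed.
HB.instance Definition _ := GRing.isLinear.Build k (grp_alg k G) SV _ gram_comb gram_comb_linear.

Lemma gram_comb_elt g : gram_comb (grp_elt k g) = gram (fvec g).
Proof.
rewrite /gram_comb (bigD1 g) //= ffunE eqxx scale1r big1 ?addr0 // => g' /negPf ne.
by rewrite ffunE ne scale0r.
Qed.

Definition gram_span : {vspace SV} := limg (linfun gram_comb).

Lemma gram_spanP a : reflect (exists c, a = gram_comb c) (a \in gram_span).
Proof.
apply: (iffP memv_imgP) => [[c _ ->]|[c ->]]; exists c; rewrite ?lfunE ?memvf //.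
Qed.

Lemma gram_span_gen g : gram (fvec g) \in gram_span.
Proof. by apply/gram_spanP; exists (grp_elt k g); rewrite gram_comb_elt. Qed.

Lemma gram_span_sub (U : {vspace SV}) : (forall g, gram (fvec g) \in U) -> (gram_span <= U)%VS.
Proof.
by move=> H; apply/subvP => a /gram_spanP[c ->]; apply: memv_suml => g _; rewrite memvZ.
Qed.

Lemma gram_span_inv : invariant_sub St_act gram_span.
Proof.
move=> h a /gram_spanP[c ->]; rewrite St_act_sum; apply: memv_suml => g _.
by rewrite memvZ // gram_fvec_rep gram_span_gen.
Qed.

Lemma SV_vanish a : (forall L, lower_unitrig L -> vsval a L = 0) -> a = 0.
Proof.
have [Ba Fa] := St_inv a => H; apply: SV_eq => g; rewrite linear0 ffunE.
exact: (vanish_lower Ba Fa).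
Qed.

Definition lift_mx g : GLq := projT1 (cid (coord_GLmx_surj theta g)).

Lemma lift_mxK g : coord_GLmx theta (lift_mx g) = g.
Proof. exact: projT2 (cid (coord_GLmx_surj theta g)). Qed.

(* Averaging over the lower unitriangular group, which fixes the flag of w0 and
   whose order is a power of q, turns any nonzero vector of U into an invariant
   one; these are the multiples of the vector of w0. *)
Lemma gram_span_min (U : {vspace SV}) : invariant_sub St_act U -> U <> 0%VS ->
  (gram_span <= U)%VS.
Proof.
move=> Uinv Un0; pose w := w0 F m.
have [a aU an0] : exists2 a, a \in U & a != 0.
  exists (vpick U); first exact: memv_pick.
  by rewrite vpick0; apply/eqP.
have [g0 ag0] : exists g0, vsval a g0 != 0.
  apply: contrapT => H; case/eqP: an0; apply: SV_eq => g; rewrite linear0 ffunE.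
  by apply/eqP; apply: contraT => ne; case: H; exists g.
(* Translation by w g0^-1 moves the nonzero value from g0 to w. *)
pose a' := St_act (lift_mx (w * g0^-1)%g) a.
have a'w : vsval a' w != 0 by rewrite St_repE // lift_mxK invMg invgK mulgKV.
have [Ba' _] := St_inv a'.
pose y := \sum_(L : G | lower_unitrig L) St_act (lift_mx L) a'.
have yU : y \in U by apply: memv_suml => L _; apply: (Uinv _ _ (Uinv _ _ aU)).
have yE g : vsval y g = \sum_(L : G | lower_unitrig L) vsval a' (L^-1 * g)%g.
  rewrite linear_sum sum_ffunE; apply: eq_bigr => L _.
  by rewrite /= St_repE // lift_mxK.
have yw : vsval y w != 0.
  (* All terms agree, since L^-1 w lies in w B; their number is a power of q, hence nonzero in k. *)
  rewrite yE (eq_bigr (fun=> vsval a' w)) => [|L lL]; last first.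
    have u := w0_lower (lower_unitrigV lL).
    by rewrite -(Ba' w _ u) mulKVg.
  have [N cN] := card_lower_unitrig F m.
  rewrite sumr_const -[X in _ *+ X]cardsE cN -[_ *+ _]mulr_natr natrX mulf_neq0 //.
  exact: expf_neq0.
have yL L g : lower_unitrig L -> vsval y (L * g)%g = vsval y g.
  move=> lL; rewrite !yE (reindex_inj (mulgI L)) /=; apply: eq_big => [L'|L' _].
    apply/idP/idP => H; last exact: lower_unitrigM.
    by rewrite -(mulKg L L') lower_unitrigM // lower_unitrigV.
  by rewrite invMg mulgA mulgKV.
pose f0 := gram (fvec w).
have f0w : vsval f0 w != 0 by rewrite gramE form_fvec_diag.
have f0L L g : lower_unitrig L -> vsval f0 (L * g)%g = vsval f0 g.
  move=> lL; rewrite [LHS]gramE [RHS]gramE.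
  transitivity (form_k (fvec (L^-1 * w)%g) (fvec g)).
    by apply: etrans (esym (form_fvec_inv L^-1%g w (L * g)%g)) _; rewrite mulKg.
  congr (form_k _ (fvec g)).
  have u := w0_lower (lower_unitrigV lL).
  rewrite -[(L^-1 * w)%g](mulKVg w).
  exact: (congr1 (@Delta_wt_val F n V k W) (@flag_vec_B_inv F n k V W VW theta w _ u)).
(* Both functions are constant on the big cell, so the difference of the two sides vanishes
   there. *)
have prop (b c : SV) : (forall L g, lower_unitrig L -> vsval b (L * g)%g = vsval b g) ->
    (forall L g, lower_unitrig L -> vsval c (L * g)%g = vsval c g) ->
    (vsval b 1%g : k) *: c = (vsval c 1%g : k) *: b.
  move=> Hb Hc; apply/eqP; rewrite -subr_eq0; apply/eqP/SV_vanish => L lL.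
  rewrite -scaleNr SV_linE SV_scaleE -[L]mulg1 Hb // Hc //.
  by rewrite mulNr [X in _ - X]mulrC subrr.
have nz (b : SV) : vsval b w != 0 -> b != 0.
  by apply: contraNneq => ->; rewrite linear0 ffunE.
have y1 : vsval y 1%g != 0.
  apply/negP => /eqP y10; case/negP: (nz _ yw); apply/eqP/SV_vanish => L lL.
  by rewrite -[L]mulg1 yL.
have ef0 : f0 = (vsval y 1%g : k)^-1 *: ((vsval f0 1%g : k) *: y).
  by rewrite (prop f0 y f0L yL) scalerA mulVf ?scale1r.
have f0U : f0 \in U by rewrite ef0 !memvZ.
apply: gram_span_sub => g.
have -> : gram (fvec g) = St_act (lift_mx (g * w^-1)%g) f0.
  by rewrite gram_fvec_rep lift_mxK mulgKV.
exact: Uinv.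
Qed.

Lemma gram_span_neq0 : gram_span <> 0%VS.
Proof.
move=> e; have := gram_span_gen 1%g; rewrite e memv0 => /eqP e1.
by have := form_fvec_diag 1%g; rewrite -gramE e1 linear0 ffunE eqxx.
Qed.

Lemma gram_span_simple : simple_sub St_act gram_span.
Proof.
split; [exact: gram_span_inv | exact: gram_span_neq0 | move=> U Uinv UI].
have [->|/eqP Un0] := eqVneq U 0%VS; [by left | right].
by apply/eqP; rewrite eqEsubv UI gram_span_min.
Qed.

(** [gram_span] lies in every nonzero submodule, so it is the only simple one; the chosen [socle] is
    then forced by antisymmetry of inclusion. *)
Lemma socle_gram_span : socle St_act = gram_span.
Proof.
have sI : is_socle St_act gram_span.
  split=> [U [Uinv Un0 Umin]|T]; last by apply; apply: gram_span_simple.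
  have [e|->//] := Umin gram_span gram_span_inv (gram_span_min Uinv Un0).
  by case: gram_span_neq0.
have [s1 s2] : is_socle St_act (socle St_act).
  exact: (@xgetPex _ 0%VS [set S | is_socle St_act S]%classic (ex_intro _ _ sI)).
apply/eqP; rewrite eqEsubv; apply/andP; split; last exact: s1 gram_span_simple.
by apply: s2; have [] := sI.
Qed.

End Socle.

(** * The weight space of the simple module *)

Section SimpleWeightSpace.
Variables (F : finFieldType) (n : nat) (k : fieldType) (V W : {vspace 'rV[F]_n}).
Hypothesis VW : (V <= W)%VS.
Local Notation m := (\dim W - \dim V)%N.
Variable theta : lin_iso (subquot V W) 'cV[F]_m.
Local Notation G := (GLmx F m).
Local Notation GLq := (GL (subquot V W)).
Local Notation SV := (subvs_of (St k F m)).
Local Notation St_act := (St_rep k theta).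
Implicit Types (g : G) (h : GLq) (a b : SV) (x y : Delta_wt V k W) (z : L_wt V k W).
Local Notation flag_vec := (flag_vec k VW theta).
Local Notation gram := (gram theta).
Local Notation gram_comb := (gram_comb theta).
Local Notation gram_span := (gram_span k theta).
Local Notation rad := (@rad_pred F n V k).

Lemma gram_quot (u v : Delta_k V k) : to_quot rad u = to_quot rad v -> gram u = gram v.
Proof.
move/to_quotE/(gram_rad VW theta)/eqP; rewrite (raddfB gram) subr_eq0 => /eqP.
exact.
Qed.

Lemma L_wt_mk_subproof x : to_quot rad (Delta_wt_val x) \in @L_wt_pred F n V k W.
Proof. by apply/asboolP; exists (Delta_wt_val x); rewrite (Delta_wt_id (Delta_wt_valP x)). Qed.

Definition L_wt_mk x : L_wt V k W := LWt (L_wt_mk_subproof x).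

Lemma L_wt_rep z : exists x, z = L_wt_mk x.
Proof.
have /asboolP[y ey] := L_wt_valP z.
have yP : Sk_act (idem_k k W) y \in @Delta_wt_pred F n V k W by apply/asboolP; exists y.
by exists (DeltaWt yP); apply: val_inj.
Qed.

Definition L_gram z : SV := gram (of_quot (L_wt_val z)).

Lemma L_gram_mk x : L_gram (L_wt_mk x) = gram (Delta_wt_val x).
Proof. by apply: gram_quot; rewrite of_quotK. Qed.

Lemma L_wt_mk_linear : linear L_wt_mk.
Proof. by move=> c x y; apply: val_inj; rewrite /= !linearP. Qed.

Lemma gram_wt_linear : linear (fun x => gram (Delta_wt_val x)).
Proof. by move=> c x y; rewrite -[Delta_wt_val _]/(\val (c *: x + y)) !linearP. Qed.

Lemma L_gram_linear : linear L_gram.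
Proof.
move=> c z z'; have [x ->] := L_wt_rep z; have [y ->] := L_wt_rep z'.
by rewrite -L_wt_mk_linear !L_gram_mk gram_wt_linear.
Qed.

Lemma L_gram_inj : injective L_gram.
Proof.
move=> z z'; have [x ->] := L_wt_rep z; have [y ->] := L_wt_rep z'.
rewrite !L_gram_mk => e; apply: val_inj; apply/to_quotE.
apply: (@gram_wt_eq0 _ _ _ _ _ VW theta (x - y)).
by rewrite -[Delta_wt_val _]/(\val (x - y)) !raddfB /= e subrr.
Qed.

Lemma gram_comb_wt (c : grp_alg k G) :
  gram (Delta_wt_val (\sum_g (c g : k) *: flag_vec g)) = gram_comb c.
Proof.
rewrite -[Delta_wt_val _]/(\val _) raddf_sum linear_sum; apply: eq_bigr => g _.
by rewrite !linearZ.
Qed.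

Lemma L_gram_in z : L_gram z \in gram_span.
Proof.
have [x ->] := L_wt_rep z; rewrite L_gram_mk.
elim/(@Delta_wt_flag_ind F n k V W VW theta): x => [|c g x IH]; first by rewrite (linear_at0 gram_wt_linear) mem0v.
by rewrite gram_wt_linear memvD ?memvZ // gram_span_gen.
Qed.

Section Action.
Variable rho : GLq -> Delta_wt V k W -> Delta_wt V k W.
Hypothesis rho_flag : flag_action rho.

Lemma gram_rho h x : gram (Delta_wt_val (rho h x)) = St_act h (gram (Delta_wt_val x)).
Proof.
have [[rl _ _] _] := rho_flag; have [Sl _ _] := St_rep_is_rep k theta.
elim/(@Delta_wt_flag_ind F n k V W VW theta): x => [|c g x IH].
  by rewrite (linear_at0 (rl h)) !(linear_at0 gram_wt_linear) (linear_at0 (Sl h)).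
rewrite rl !gram_wt_linear Sl IH; congr (_ *: _ + _).
by rewrite (flag_action_vec VW theta rho_flag) /= gram_fvec_rep.
Qed.

(** Uses chosen preimages; the injective map [L_gram] into St shows that the choice is immaterial
    and transports the axioms of a representation. *)
Definition L_action h z : L_wt V k W := L_wt_mk (rho h (projT1 (cid (L_wt_rep z)))).

Lemma L_gram_action h z : L_gram (L_action h z) = St_act h (L_gram z).
Proof.
rewrite L_gram_mk gram_rho; congr (St_act h _).
by rewrite [in RHS](projT2 (cid (L_wt_rep z))) L_gram_mk.
Qed.

Lemma L_action_induced : induced_action rho L_action.
Proof.
have [Sl S1 SM] := St_rep_is_rep k theta; split.
  split=> [h c z z'|z|h h' z]; apply: L_gram_inj.
  - by rewrite L_gram_linear !L_gram_action L_gram_linear Sl.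
  - by rewrite L_gram_action S1.
  - by rewrite !L_gram_action SM.
move=> h x z ez; have -> : L_action h z = L_wt_mk (rho h x); last by [].
have -> : z = L_wt_mk x by apply: val_inj.
by apply: L_gram_inj; rewrite L_gram_action !L_gram_mk gram_rho.
Qed.

Lemma L_wt_iso_gram_span (rhoL : GLq -> L_wt V k W -> L_wt V k W) :
  induced_action rho rhoL -> rep_iso rhoL (sub_rep St_act gram_span).
Proof.
move=> [_ rhoL_ind].
pose f0 z := vsproj gram_span (L_gram z).
have f0l : linear f0 by move=> c z z'; rewrite /f0 L_gram_linear linearP.
pose f : {linear L_wt V k W -> subvs_of gram_span} :=
  HB.pack f0 (GRing.isLinear.Build _ _ _ _ _ f0l).
have fE z : vsval (f z) = L_gram z by rewrite vsprojK ?L_gram_in.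
pose f' (y : subvs_of gram_span) :=
  L_wt_mk (\sum_g (((linfun gram_comb)^-1%VF (vsval y) : grp_alg k G) g : k) *: flag_vec g).
have f'K : cancel f' f.
  move=> y; apply: val_inj; rewrite /= fE /f' L_gram_mk gram_comb_wt.
  have := limg_lfunVK (subvsP y); rewrite lfunE; exact.
exists f; split; last first.
  move=> h z; apply: val_inj; have [x ->] := L_wt_rep z.
  have -> : rhoL h (L_wt_mk x) = L_wt_mk (rho h x) by apply: val_inj; apply: rhoL_ind.
  have xI : gram (Delta_wt_val x) \in gram_span by rewrite -L_gram_mk L_gram_in.
  rewrite [LHS]fE /sub_rep fE !L_gram_mk gram_rho [RHS]vsprojK //.
  exact: (@gram_span_inv _ _ _ _ _ VW theta h _ xI).
exists f' => // z; apply: L_gram_inj; rewrite -!fE; congr vsval; exact: f'K.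
Qed.

End Action.

(** * Self-duality of the image of the form *)

Lemma inj_dim_bij (M N : vectType k) (f : {linear M -> N}) :
  injective f -> dim M = dim N -> bijective f.
Proof.
move=> fI dMN; have f0 : lker (linfun f) == 0%VS.
  by apply/lker0P => u v; rewrite !lfunE; apply: fI.
have flim : limg (linfun f) = fullv.
  apply/eqP; rewrite eqEdim subvf limg_dim_eq ?(eqP f0) ?capv0 //.
  by rewrite !dimvf dMN leqnn.
exists ((linfun f)^-1%VF) => u; first by rewrite -[f u]lfunE lker0_lfunK.
by rewrite -[LHS]lfunE limg_lfunVK // flim memvf.
Qed.

(** The form carried over to its image: for a = gram x and b in the image it is <x, y>, where y is a
    combination of flag classes with gram y = b. *)
Definition gram_pair a b : k^o := \sum_g ((linfun gram_comb)^-1%VF b : grp_alg k G) g * vsval a g.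

Lemma gram_pair_linl b : linear (gram_pair^~ b).
Proof.
move=> c a a'; rewrite /gram_pair scaler_sumr -big_split; apply: eq_bigr => g _ /=.
by rewrite SV_linE mulrDr; congr (_ + _); apply: mulrCA.
Qed.

Lemma gram_pair_linr a : linear (gram_pair a).
Proof.
move=> c b b'; rewrite /gram_pair scaler_sumr -big_split; apply: eq_bigr => g _ /=.
by rewrite linearP !ffunE mulrDl; congr (_ + _); rewrite -mulrA.
Qed.

Lemma gram_combE (c : grp_alg k G) g :
  vsval (gram_comb c) g = \sum_g' c g' * form_k (flag_class_k V k (mx_flag theta g'))
     (flag_class_k V k (mx_flag theta g)).
Proof.
rewrite linear_sum sum_ffunE; apply: eq_bigr => g' _.
by rewrite [LHS]SV_scaleE (gramE VW).
Qed.

(** By symmetry of the form the first argument may be expanded instead of the second, so the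
    coefficients chosen for [b] do not matter. *)
Lemma gram_pair_combl c b : b \in gram_span ->
  gram_pair (gram_comb c) b = \sum_g c g * vsval b g.
Proof.
move=> bI; have eb : gram_comb ((linfun gram_comb)^-1%VF b) = b.
  by have := limg_lfunVK bI; rewrite lfunE.
rewrite /gram_pair -{2}eb; set d := _ b.
under eq_bigr => g _ do rewrite gram_combE mulr_sumr.
under [in RHS]eq_bigr => g _ do rewrite gram_combE mulr_sumr.
rewrite exchange_big; apply: eq_bigr => g _; apply: eq_bigr => g' _ /=.
by rewrite mulrCA form_fvec_sym.
Qed.

Lemma gram_pair_combr a c : a \in gram_span ->
  gram_pair a (gram_comb c) = \sum_g c g * vsval a g.
Proof.
move=> /gram_spanP[d ->]; rewrite gram_pair_combl; last by apply/gram_spanP; exists c.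
under eq_bigr => g _ do rewrite gram_combE mulr_sumr.
under [in RHS]eq_bigr => g _ do rewrite gram_combE mulr_sumr.
rewrite exchange_big; apply: eq_bigr => g _; apply: eq_bigr => g' _ /=.
by rewrite mulrCA form_fvec_sym.
Qed.

Lemma gram_pair_rep h a b : a \in gram_span -> b \in gram_span ->
  gram_pair (St_act h a) b = gram_pair a (St_act h^-1%g b).
Proof.
move=> aI /gram_spanP[c ->]; rewrite gram_pair_combr; last exact: (@gram_span_inv _ _ _ _ _ VW theta h _ aI).
pose c' : grp_alg k G := [ffun g => c (coord_GLmx theta h * g)%g].
have c'E g : c' g = c (coord_GLmx theta h * g)%g by rewrite ffunE.
have -> : St_act h^-1%g (gram_comb c) = gram_comb c'.
  rewrite [gram_comb c]gram_comb_sum St_act_sum (reindex_inj (mulgI (coord_GLmx theta h))).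
  rewrite gram_comb_sum; apply: eq_bigr => g _; rewrite c'E; congr (_ *: _).
  have e := @gram_fvec_rep F n k V W VW theta h^-1%g (coord_GLmx theta h * g)%g.
  by rewrite coord_GLmxV mulKg in e.
rewrite gram_pair_combr // (reindex_inj (mulgI (coord_GLmx theta h))) /=.
by apply: eq_bigr => g _; rewrite c'E St_repE // mulKg.
Qed.

(** Pairing with the vector of the flag of g evaluates at g, so the pairing is nondegenerate on the
    image; equality of dimensions makes it a bijection onto the dual. *)
Lemma gram_span_self_dual :
  rep_iso (sub_rep St_act gram_span) (dual_rep (sub_rep St_act gram_span)).
Proof.
pose S := subvs_of gram_span.
have [Sl _ _] := St_rep_is_rep k theta.
have pl (u : S) : linear (fun v : S => gram_pair (vsval u) (vsval v)).
  by move=> c v v'; rewrite linearP gram_pair_linr.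
pose p (u : S) : {linear S -> k^o} :=
  HB.pack (fun v : S => gram_pair (vsval u) (vsval v)) (GRing.isLinear.Build _ _ _ _ _ (pl u)).
pose f0 (u : S) : 'Hom(S, k^o) := linfun (p u).
have f0E u v : f0 u v = gram_pair (vsval u) (vsval v) by rewrite lfunE.
have f0l : linear f0.
  move=> c u u'; apply/lfunP => v.
  by rewrite add_lfunE scale_lfunE !f0E linearP gram_pair_linl.
pose f : {linear S -> 'Hom(S, k^o)} := HB.pack f0 (GRing.isLinear.Build _ _ _ _ _ f0l).
exists f; split.
  apply: inj_dim_bij; last by rewrite [RHS]muln1.
  move=> u u' e; apply/val_inj/SV_eq => g.
  have pg (w : S) : f0 w (vsproj gram_span (gram_comb (grp_elt k g))) = vsval (vsval w) g.
    rewrite f0E vsprojK; last by apply/gram_spanP; exists (grp_elt k g).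
    rewrite gram_pair_combr ?subvsP // (bigD1 g) //= ffunE eqxx mul1r big1 ?addr0 // => g' /negPf ne.
    by rewrite ffunE ne mul0r.
  by rewrite -!pg; congr (fun_of_lfun _ _).
move=> h u; apply/lfunP => v.
have sl : linear (fun v : S => f0 u (sub_rep St_act gram_span h^-1%g v)).
  by move=> c v1 v2; rewrite /sub_rep linearP Sl !linearP.
pose d : {linear S -> k^o} := HB.pack (fun v : S => f0 u (sub_rep St_act gram_span h^-1%g v))
  (GRing.isLinear.Build _ _ _ _ _ sl).
have -> : dual_rep (sub_rep St_act gram_span) h (f u) v = d v by rewrite /dual_rep (lfunE d).
have sI h' (w : S) : vsval (sub_rep St_act gram_span h' w) = St_act h' (vsval w).
  by rewrite vsprojK //; apply: (@gram_span_inv _ _ _ _ _ VW theta h' _ (subvsP w)).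
by rewrite /= !f0E !sI gram_pair_rep ?subvsP.
Qed.

End SimpleWeightSpace.

Theorem theorem1p1 (F : finFieldType) (n : nat) (k : fieldType) (l : nat)
    (k_char : has_characteristic k l) (l_ndvd_q : ~~ (l %| #|F|)%N)
    (V W : {vspace 'rV[F]_n}) (VW : (V <= W)%VS)
    (theta : lin_iso (subquot V W) 'cV[F]_(\dim W - \dim V)) :
  (exists rho : GL (subquot V W) -> Delta_wt V k W -> Delta_wt V k W,
     flag_action rho) /\
  (forall rho : GL (subquot V W) -> Delta_wt V k W -> Delta_wt V k W,
     flag_action rho ->
     rep_iso rho (dual_rep (St_rep k theta)) /\
     (exists rhoL : GL (subquot V W) -> L_wt V k W -> L_wt V k W,
        induced_action rho rhoL) /\
     (forall rhoL : GL (subquot V W) -> L_wt V k W -> L_wt V k W,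
        induced_action rho rhoL ->
        rep_iso rhoL (sub_rep (St_rep k theta) (socle (St_rep k theta))))) /\
  rep_iso (sub_rep (St_rep k theta) (socle (St_rep k theta)))
          (dual_rep (sub_rep (St_rep k theta) (socle (St_rep k theta)))).
Proof.
have q_neq0 : (#|F|%:R : k) != 0 by rewrite k_char.
rewrite (socle_gram_span VW theta q_neq0).
split; first by exists (wt_action VW theta); apply: wt_action_flag_action.
split; last exact: gram_span_self_dual.
move=> rho rho_flag; split; first exact: Delta_wt_iso_St_dual.
split; first by exists (L_action rho); apply: (L_action_induced VW theta rho_flag).
by move=> rhoL; apply: L_wt_iso_gram_span.
Qed.
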